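(* Let $\lambda=\sum_{i=1}^n m_i\omega_i$ be a dominant integral weight of $\mathfrak{sp}_{2n}$. (i) For each $\mathbf s\in S(\lambda)$ fix an arbitrary order of the factors $f_\alpha$ in the product $\prod_{\alpha>0}f_\alpha^{s_\alpha}$, and let $f^{\mathbf s}=\prod_{\alpha>0}f_\alpha^{s_\alpha}\in U(\mathfrak n^-)$ be the ordered product. Then the elements $f^{\mathbf s}v_\lambda$, $\mathbf s\in S(\lambda)$, form a basis of $V(\lambda)$. (ii) $\dim V(\lambda)=\sharp S(\lambda)$. (iii) $\mathrm{char}\,V(\lambda)=\sum_{\mathbf s\in S(\lambda)}e^{\lambda-\mathrm{wt}(\mathbf s)}$.
   Context: Work over $\mathbb C$. Let $\mathfrak g=\mathfrak{sp}_{2n}=\mathfrak n^+\oplus\mathfrak h\oplus\mathfrak n^-$ be a Cartan decomposition, with simple roots $\alpha_1,\dots,\alpha_n$ (standard labelling, $\alpha_n$ the long simple root) and fundamental weights $\omega_1,\dots,\omega_n$. The positive roots are $$\alpha_{i,j}=\alpha_i+\alpha_{i+1}+\dots+\alpha_j,\quad \alpha_{i,\overline{j}}=\alpha_i+\alpha_{i+1}+\dots+\alpha_n+\alpha_{n-1}+\dots+\alpha_j,\qquad 1\le i\le j\le n,$$ where $\alpha_{i,n}=\alpha_{i,\overline n}$; there are $n^2$ of them. Write $\alpha_{\overline i}=\alpha_{i,\overline i}$ (and note $\alpha_i=\alpha_{i,i}$). For each positive root $\alpha$ fix a nonzero $f_\alpha\in\mathfrak n^-_{-\alpha}$. $V(\lambda)$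 is the irreducible $\mathfrak g$-module with highest weight $\lambda$ and highest weight vector $v_\lambda$. Symplectic Dyck paths: let $J=\{1<2<\dots<n<\overline{n-1}<\dots<\overline1\}$, and for $x\in J$ let $x+1$ be the smallest element of $J$ bigger than $x$. A (symplectic) Dyck path is a sequence $\mathbf p=(p(0),\dots,p(k))$, $k\ge0$, of positive roots such that: (a) $p(0)=\alpha_i$ for some $1\le i\le n$; (b) $p(k)=\alpha_j$ or $p(k)=\alpha_{\overline j}$ for some $i\le j\le n$; (c) if $p(s)=\alpha_{r,q}$ with $r,q\in J$, then $p(s+1)=\alpha_{r,q+1}$ or $p(s+1)=\alpha_{r+1,q}$. Let $\mathbb D$ be the set of Dyck paths. $P(\lambda)\subset\mathbb R_{\ge0}^{n^2}$ is the polytope of all $(s_\alpha)_{\alpha>0}$ with $s_\alpha\ge0$ such that for every $\mathbf p=(p(0),\dots,p(k))\in\mathbb D$: if $p(0)=\alpha_i$ and $p(k)=\alpha_j$, then $s_{p(0)}+\dots+s_{p(k)}\le m_i+\dots+m_j$; if $p(0)=\alpha_i$ and $p(k)=\alpha_{\overline j}$, then $s_{p(0)}+\dots+s_{p(k)}\le m_i+\dots+m_n$. $S(\lambda)$ is the set of integral points of $P(\lambda)$. For $\mathbf s\in S(\lambda)$ the weight is $\mathrm{wt}(\mathbf s)=\sum_{1\le j\le k\le n}s_{\alpha_{j,k}}\alpha_{j,k}+\sum_{1\le j\le k<n}s_{\alpha_{j,\overline k}}\alpha_{j,\overline k}$. *)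

(* Defs.v *)
From HB Require Import structures.
From mathcomp Require Import all_boot all_order all_algebra.
From mathcomp Require Import finmap.
From mathcomp Require Import boolp classical_sets cardinality fsbigop reals.
From mathcomp Require Import complex monalg.
From mathcomp Require Import zify.

Set Implicit Arguments.
Unset Strict Implicit.
Unset Printing Implicit Defensive.

Import Order.TTheory GRing.Theory Num.Theory.
Local Open Scope ring_scope.
Local Open Scope classical_set_scope.

(* Indices are 0-based: i in {1..n} is encoded by i.-1 : 'I_n. *)

(* J = {1 < .. < n < \bar{n-1} < .. < \bar 1} is encoded by its position:
   1 <= j <= n is at position j.-1, and \bar j at position 2n-1-j, so that
   bar is order-reversing on J and \bar n = n. *)
Definition J (n : nat) := 'I_(n.*2.-1).

Lemma J_subproof n (i : 'I_n) : (i < n.*2.-1)%N.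
Proof.
by have := ltn_ord i; lia.
Qed.

Definition jpos n (i : 'I_n) : J n := Ordinal (J_subproof i).
Definition jbar n (i : 'I_n) : J n := rev_ord (jpos i).

Lemma Jabs_subproof n (x : J n) : (minn x (rev_ord x) < n)%N.
Proof.
by have := ltn_ord x; rewrite /=; lia.
Qed.

(* The i such that x = i or x = \bar i. *)
Definition jabs n (x : J n) : 'I_n := Ordinal (Jabs_subproof x).

(* (i, q) encodes the positive root alpha_{i,q}, for i <= q <= \bar i. *)
Definition posroot (n : nat) :=
  {a : 'I_n * J n | ((jpos a.1 <= a.2) && (a.2 <= jbar a.1))%N}.

Lemma root_jpos_subproof n (i : 'I_n) :
  ((jpos (i, jpos i).1 <= (i, jpos i).2)
     && ((i, jpos i).2 <= jbar (i, jpos i).1))%N.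
Proof.
by have := ltn_ord i; rewrite /=; lia.
Qed.

Lemma root_jbar_subproof n (i : 'I_n) :
  ((jpos (i, jbar i).1 <= (i, jbar i).2)
     && ((i, jbar i).2 <= jbar (i, jbar i).1))%N.
Proof.
by have := ltn_ord i; rewrite /=; lia.
Qed.

Definition alpha n (i : 'I_n) : posroot n :=
  exist _ (i, jpos i) (root_jpos_subproof i).
Definition alpha_bar n (i : 'I_n) : posroot n :=
  exist _ (i, jbar i) (root_jbar_subproof i).

Definition dyck_step n (a b : posroot n) : bool :=
  (((val b).1 == (val a).1) && ((val b).2 == (val a).2.+1 :> nat))
  || (((val b).1 == (val a).1.+1 :> nat) && ((val b).2 == (val a).2)).

(* The sequence p(0), p(1), .., p(k) is given as a :: p. *)
Definition dyck n (a : posroot n) (p : seq (posroot n)) : bool :=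
  [exists i : 'I_n, exists j : 'I_n,
     [&& a == alpha i, (i <= j)%N
       & (last a p == alpha j) || (last a p == alpha_bar j)]]
  && path (@dyck_step n) a p.

Definition polytope (R : realType) n (m : 'I_n -> nat) : set (posroot n -> R) :=
  [set x | (forall a, 0 <= x a) /\
    forall (a : posroot n) (p : seq (posroot n)), dyck a p ->
      forall i j : 'I_n, a = alpha i ->
        (last a p = alpha j ->
           \sum_(b <- a :: p) x b <= (\sum_(l < n | (i <= l <= j)%N) m l)%:R) /\
        (last a p = alpha_bar j ->
           \sum_(b <- a :: p) x b <= (\sum_(l < n | (i <= l)%N) m l)%:R)].

(* Coordinates being nonnegative, integral points have coordinates in nat. *)
Definition lattice_points (R : realType) n (m : 'I_n -> nat) :
    set {ffun posroot n -> nat} :=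
  [set s | polytope (R := R) m (fun a => (s a)%:R)].

Section Symplectic.
Variables (F : fieldType) (n : nat).

(* sp_{2n} with respect to the form ((0, 1), (-1, 0)); its Cartan subalgebra h
   consists of the matrices diag(x_1, .., x_n, -x_1, .., -x_n). *)
Definition symp_form : 'M[F]_(n + n) := block_mx 0 1%:M (- 1%:M) 0.

Definition in_sp (X : 'M[F]_(n + n)) : Prop :=
  X^T *m symp_form + symp_form *m X = 0.

Definition bracket (X Y : 'M[F]_(n + n)) := X *m Y - Y *m X.

Definition cartan (x : 'rV[F]_n) : 'M[F]_(n + n) :=
  block_mx (diag_mx x) 0 0 (- diag_mx x).

(* Linear forms on h are represented in the basis epsilon_1, .., epsilon_n,
   epsilon_i (cartan x) = x_i. *)
Definition weval (mu x : 'rV[F]_n) : F := \sum_(i < n) mu 0 i * x 0 i.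

(* alpha_i = epsilon_i - epsilon_{i+1} for i < n, alpha_n = 2 epsilon_n *)
Definition simple_root (i : 'I_n) : 'rV[F]_n :=
  \row_j (if i.+1 == n then 2 * (j == i)%:R
          else (j == i)%:R - (j == i.+1 :> nat)%:R).

(* omega_i = epsilon_1 + .. + epsilon_i; see fund_weight_coroot *)
Definition fund_weight (i : 'I_n) : 'rV[F]_n := \row_j (j <= i)%N%:R.

Definition coroot (i : 'I_n) : 'rV[F]_n :=
  \row_j ((j == i)%:R - (j == i.+1 :> nat)%:R).

Lemma fund_weight_coroot (i j : 'I_n) :
  weval (fund_weight i) (coroot j) = (i == j)%:R.
Proof.
rewrite /weval; under eq_bigr do rewrite !mxE mulrBr.
rewrite sumrB (bigD1 j) //= eqxx mulr1 big1 ?addr0; last first.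
  by move=> k /negPf ->; rewrite mulr0.
have [jn|jn] := ltnP j.+1 n; last first.
  rewrite big1 ?subr0; last first.
    by move=> k _; rewrite ltn_eqF ?mulr0 // (leq_trans (ltn_ord k)).
  congr (_%:R); congr nat_of_bool; rewrite eq_sym -val_eqE eqn_leq /=.
  by rewrite -[(i <= j)%N]ltnS (leq_trans (ltn_ord i) jn) andbT.
rewrite (bigD1 (Ordinal jn)) //= eqxx mulr1 big1 ?addr0; last first.
  by move=> k; rewrite -val_eqE /= => /negPf ->; rewrite mulr0.
by rewrite -val_eqE /=; case: ltngtP => //= _; rewrite ?subrr ?subr0.
Qed.

(* alpha_{i,q} is the sum of the alpha_{|x|} over i <= x <= q in J, where
   |k| = |\bar k| = k. *)
Definition root_weight (a : posroot n) : 'rV[F]_n :=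
  \sum_(x : J n | (jpos (val a).1 <= x <= (val a).2)%N) simple_root (jabs x).

Definition wt (s : {ffun posroot n -> nat}) : 'rV[F]_n :=
  \sum_(a : posroot n) root_weight a *+ s a.

Definition dominant_weight (m : 'I_n -> nat) : 'rV[F]_n :=
  \sum_(i < n) fund_weight i *+ m i.

(* The element e^mu of the integral group ring of the dual of h. *)
Definition formal_exp (mu : 'rV[F]_n) : {malg int['rV[F]_n]} := << mu >>.

Definition in_root_space (beta : 'rV[F]_n) (X : 'M[F]_(n + n)) : Prop :=
  in_sp X /\ forall x, bracket (cartan x) X = weval beta x *: X.

Section Modules.
Variable V : lmodType F.

(* Only the values of rho on sp_{2n} matter. *)
Definition is_sp_module (rho : 'M[F]_(n + n) -> V -> V) : Prop :=
  [/\ forall X, in_sp X -> forall (c : F) (u v : V),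
        rho X (c *: u + v) = c *: rho X u + rho X v,
      forall X Y, in_sp X -> in_sp Y -> forall (c : F) (u : V),
        rho (c *: X + Y) u = c *: rho X u + rho Y u
    & forall X Y, in_sp X -> in_sp Y -> forall u : V,
        rho (bracket X Y) u = rho X (rho Y u) - rho Y (rho X u)].

Variable rho : 'M[F]_(n + n) -> V -> V.

Definition is_submodule (U : set V) : Prop :=
  [/\ U 0,
      forall (c : F) u v, U u -> U v -> U (c *: u + v)
    & forall X u, in_sp X -> U u -> U (rho X u)].

Definition irreducible_module : Prop :=
  (exists u : V, u <> 0) /\
  forall U : set V, is_submodule U -> U = [set 0] \/ U = setT.

Definition weight_space (mu : 'rV[F]_n) : set V :=
  [set u | forall x, rho (cartan x) u = weval mu x *: u].

Definition highest_weight_vector (lambda : 'rV[F]_n) (v : V) : Prop :=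
  [/\ v <> 0, weight_space lambda v
    & forall (a : posroot n) X, in_root_space (root_weight a) X -> rho X v = 0].

(* V is the module V(lambda), and v = v_lambda. *)
Definition is_irreducible_highest_weight (lambda : 'rV[F]_n) (v : V) : Prop :=
  [/\ is_sp_module rho, irreducible_module & highest_weight_vector lambda v].

(* The action on v of the product of the f_a, for a in w from left to right,
   taken in the universal enveloping algebra of n^-. *)
Definition monomial_act (f : posroot n -> 'M[F]_(n + n)) (w : seq (posroot n))
    (v : V) : V :=
  foldr (fun a u => rho (f a) u) v w.

(* (b i), for i in S, is a basis of the subspace U. *)
Definition is_basis (U : set V) (I : choiceType) (S : set I) (b : I -> V) :
    Prop :=
  [/\ forall i, S i -> U (b i),
      forall (t : {fset I}) (c : I -> F), [set` t] `<=` S ->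
        \sum_(i <- t) c i *: b i = 0 -> forall i, i \in t -> c i = 0
    & forall u, U u -> exists (t : {fset I}) (c : I -> F),
        [set` t] `<=` S /\ u = \sum_(i <- t) c i *: b i].

Definition has_dim (U : set V) (d : nat) : Prop :=
  exists b : 'I_d -> V, is_basis U [set: 'I_d] b.

(* ch is the formal sum over mu of dim V_mu times e^mu. *)
Definition is_character (ch : {malg int['rV[F]_n]}) : Prop :=
  forall mu : 'rV[F]_n, exists d : nat,
    has_dim (weight_space mu) d /\ ch@_mu = d%:Z.

End Modules.
End Symplectic.

(* Main.v *)
Require Import Defs.
From mathcomp Require Import all_boot all_order fingroup perm all_algebra.
From mathcomp Require Import finmap.
From mathcomp Require Import boolp classical_sets cardinality fsbigop reals.
From mathcomp Require Import complex monalg.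
From mathcomp Require Import zify ring.

Set Implicit Arguments.
Unset Strict Implicit.
Unset Printing Implicit Defensive.

Import Order.TTheory GRing.Theory Num.Theory.
Local Open Scope ring_scope.
(* Write w v for the product of the f_a, a in the word w, applied to v. Roots are
   edges on the 2n positions of the standard basis, so words of roots are
   multigraphs, and an element of n^+ acts on them, modulo shorter words, by
   replacing one vertex.

   Spanning. If F is the root vector of alpha_{i,j} or alpha_{i,\bar i} and N
   exceeds the bound attached to the corresponding Dyck paths, then F^N v = 0.
   Applying elements of n^+ gives a vanishing sum, with positive coefficients, of
   words with one and the same vertex degrees. A Dyck path is a chain of nested
   edges, and such a chain is lexicographically maximal among the multigraphs with
   its degrees; hence a monomial violating an inequality is a combination of
   smaller ones.

   Independence. A module with the same annihilator is generated by the highest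
   weight vector of a tensor product of modules of alternating tensors. A lattice
   point s of P(lambda), with l minimal such that m_l > 0, is the sum of a lattice
   point of P(lambda - omega_l) and of the indicator function of an antichain of
   roots alpha_{a,q} with a <= l <= q. The antichain is the leading monomial of a
   minor of the generic element of n^-, so that, by induction, s is detected by a
   coordinate of the tensor product. The annihilators agree because the tensor
   product carries a positive definite contravariant form. *)

(** * The Lie algebra and its root vectors *)

(** V is given only abstractly, so concrete facts are read off the tensor model U and carried over.
    In U, a root vector F of alpha_{i,j} or alpha_{i,\bar i} has square zero on the highest weight
    vector of the l-th alternating factor, and kills it unless i <= l <= j (with j = n in the second
    case); hence F^N kills the highest weight vector of U as soon as N > m_i + .. + m_j.

    This relation and linear independence pass to V through the submodule of V x U generated by the
    pair (v, t) of highest weight vectors, which meets both factors trivially. For V x 0 the reason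
    is irreducibility. The factor 0 x U is the delicate one, since the irreducibility of the module
    generated by t is not known beforehand: there the form acts, because t is orthogonal to all
    nonempty words applied to t.

    The coefficients in the vanishing sums are never computed: they count words, so they cannot
    cancel in characteristic zero. Spanning and independence use two different lexicographic orders
    on multigraphs, one favouring nested edges and the other antichains; the two halves share only
    the set S(lambda). *)

Section SympMatrix.
Variables (K : numClosedFieldType) (n : nat).
Implicit Types (p q r s : nat) (x : 'rV[K]_n).

(* The basis vectors are ordered by increasing weight: the vector at position p has
   weight - wtv p, and p |-> 2n-1-p exchanges opposite weights. *)
Definition pos (j : 'I_(n + n)) : nat :=
  match split j with inl l => (n + n).-1 - l | inr r => r end.

Lemma pos_lshift (l : 'I_n) : pos (lshift n l) = ((n + n).-1 - l)%N.
Proof. by rewrite /pos (unsplitK (inl l)). Qed.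

Lemma pos_rshift (r : 'I_n) : pos (rshift n r) = r.
Proof. by rewrite /pos (unsplitK (inr r)). Qed.

Lemma pos_lt j : (pos j < n + n)%N.
Proof.
by case: (split_ordP j) => l ->; rewrite ?pos_lshift ?pos_rshift;
  have := ltn_ord l; lia.
Qed.

Lemma pos_inj : injective pos.
Proof.
move=> j k; case: (split_ordP j) => l ->; case: (split_ordP k) => l' ->;
  rewrite ?pos_lshift ?pos_rshift => e; have := ltn_ord l; have := ltn_ord l'.
- by move=> *; congr lshift; apply: val_inj => /=; lia.
- lia.
- lia.
- by move=> *; congr rshift; apply: val_inj.
Qed.

Lemma pos_surj p : (p < n + n)%N -> exists j, pos j = p.
Proof.
move=> pn; have [pn'|pn'] := ltnP p n.
  by exists (rshift n (Ordinal pn')); rewrite pos_rshift.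
have pm : ((n + n).-1 - p < n)%N by lia.
by exists (lshift n (Ordinal pm)); rewrite pos_lshift /=; lia.
Qed.

Definition evec p : 'cV[K]_(n + n) := \col_j (pos j == p)%:R.

Local Notation Om := (symp_form K n).

(* sp_2n is the symmetric square of the standard module. *)
Definition sym_prod (u v : 'cV[K]_(n + n)) := u *m v^T *m Om + v *m u^T *m Om.
Definition spgen p q := sym_prod (evec p) (evec q).

Definition om p q : K :=
  if (p + q).+1 == (n + n)%N then (if (p < n)%N then -1 else 1) else 0.

Lemma F_sym p q : spgen p q = spgen q p.
Proof. by rewrite /spgen /sym_prod addrC. Qed.

(** Thanks to this convention [om_evec] and [bracket_F] hold for all natural numbers, without bounds
    on the positions. *)
Lemma evec_out p : (n + n <= p)%N -> evec p = 0.
Proof.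
move=> pn; apply/matrixP => j k; rewrite !mxE.
by have := pos_lt j; case: eqP => // ->; rewrite ltnNge pn.
Qed.

Lemma F_out p q : (n + n <= p)%N -> spgen p q = 0.
Proof. by move=> /evec_out e; rewrite /spgen /sym_prod e !(trmx0, mul0mx, mulmx0) addr0. Qed.

Lemma evec_delta (j : 'I_(n + n)) : evec (pos j) = delta_mx j 0.
Proof.
apply/matrixP => k l; rewrite !mxE ord1 eqxx andbT.
by rewrite (inj_eq pos_inj).
Qed.

Lemma OmT : Om^T = - Om.
Proof.
rewrite /symp_form tr_block_mx opp_block_mx !trmx0 !oppr0 opprK.
by rewrite linearN /= !trmx1.
Qed.

Lemma OmOm : Om *m Om = - 1%:M.
Proof.
rewrite /symp_form mulmx_block !mul0mx !mulmx0 !addr0 !add0r !mul1mx mulmx1.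
by rewrite [in RHS]scalar_mx_block opp_block_mx !oppr0.
Qed.

Lemma Om_ll (i j : 'I_n) : Om (lshift n i) (lshift n j) = 0.
Proof. by rewrite /symp_form block_mxEul mxE. Qed.
Lemma Om_lr (i j : 'I_n) : Om (lshift n i) (rshift n j) = (i == j)%:R.
Proof. by rewrite /symp_form block_mxEur mxE. Qed.
Lemma Om_rl (i j : 'I_n) : Om (rshift n i) (lshift n j) = - (i == j)%:R.
Proof. by rewrite /symp_form block_mxEdl !mxE. Qed.
Lemma Om_rr (i j : 'I_n) : Om (rshift n i) (rshift n j) = 0.
Proof. by rewrite /symp_form block_mxEdr mxE. Qed.

Lemma omE (i j : 'I_(n + n)) : Om i j = om (pos i) (pos j).
Proof.
rewrite /om; case: (split_ordP i) => a ->; case: (split_ordP j) => b ->;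
  rewrite ?Om_ll ?Om_lr ?Om_rl ?Om_rr ?pos_lshift ?pos_rshift;
  have := ltn_ord a; have := ltn_ord b => ha hb.
- by case: eqP => // e; exfalso; lia.
- rewrite -val_eqE /=; have -> : ((n + n).-1 - a < n)%N = false by lia.
  by do 2 (case: eqP => ?) => //; exfalso; lia.
- rewrite -val_eqE /= hb.
  by do 2 (case: eqP => ?); rewrite ?oppr0 //; exfalso; lia.
- by case: eqP => // e; exfalso; lia.
Qed.

Lemma om_evec p q : (evec p)^T *m Om *m evec q = (om p q)%:M.
Proof.
have [pn|pn] := ltnP p (n + n); last first.
  rewrite (evec_out pn) trmx0 !mul0mx /om.
  by case: eqP => [e|_]; [exfalso; lia|rewrite raddf0].
have [qn|qn] := ltnP q (n + n); last first.
  rewrite (evec_out qn) !mulmx0 /om.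
  by case: eqP => [e|_]; [exfalso; lia|rewrite raddf0].
have [i <-] := pos_surj pn; have [j <-] := pos_surj qn.
rewrite !evec_delta trmx_delta -rowE -colE -omE.
by apply/matrixP => a b; rewrite !mxE !ord1 eqxx mulr1n.
Qed.

Lemma om_anti p q : om p q = - om q p.
Proof.
rewrite /om addnC; case: eqP => [e|]; last by rewrite oppr0.
by case: ltnP => ?; case: ltnP => ?; rewrite ?opprK //; lia.
Qed.

Lemma mul_rank1 p q r s :
  (evec p *m (evec q)^T *m Om) *m (evec r *m (evec s)^T *m Om) =
  om q r *: (evec p *m (evec s)^T *m Om).
Proof.
rewrite -!mulmxA (mulmxA Om) (mulmxA _ (Om *m _)) (mulmxA _ Om) om_evec.
by rewrite mul_scalar_mx -scalemxAr.
Qed.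

Lemma bracket_F p q r s : bracket (spgen p q) (spgen r s) =
  om q r *: spgen p s + om q s *: spgen p r + om p r *: spgen q s + om p s *: spgen q r.
Proof.
rewrite /bracket /spgen /sym_prod !mulmxDl !mulmxDr !mul_rank1.
rewrite (om_anti s p) (om_anti s q) (om_anti r p) (om_anti r q).
set a1 := om q r; set a2 := om q s; set a3 := om p r; set a4 := om p s.
move: (_ *m Om) => x1; move: (_ *m Om) => x2.
move: (_ *m Om) => x3; move: (_ *m Om) => x4.
move: (_ *m Om) => x5; move: (_ *m Om) => x6.
move: (_ *m Om) => x7; move: (_ *m Om) => x8.
rewrite !scalerDr !scaleNr !opprD !opprK -!addrA.
apply/matrixP => i j; rewrite !mxE; ring.
Qed.

Lemma F_in_sp p q : in_sp (spgen p q).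
Proof.
rewrite /in_sp /spgen /sym_prod.
rewrite linearD /= !trmx_mul !trmxK OmT mulmxDl mulmxDr !mulNmx !mulmxA.
by rewrite -opprD [X in - X]addrC addNr.
Qed.

(** For X in sp the matrix X Om^T = X Om^{-1} is symmetric, hence a combination of symmetric
    products of basis vectors; each of them is counted twice in the double sum. *)
Lemma sp_expand (X : 'M[K]_(n + n)) : in_sp X ->
  X = 2^-1 *: \sum_i \sum_j ((X *m Om^T) i j *: spgen (pos i) (pos j)).
Proof.
move=> spX; set Z := X *m Om^T.
have eX : X = Z *m Om.
  by rewrite /Z -mulmxA OmT mulNmx OmOm opprK mulmx1.
have symZ : Z^T = Z.
  rewrite /Z trmx_mul trmxK; move/eqP: spX; rewrite addr_eq0 => /eqP spX.
  have <- : Om *m (X^T *m Om) *m Om^T = Om *m X^T.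
    by rewrite -!mulmxA OmT !(mulmxN, OmOm, mulmx1, opprK).
  by rewrite spX mulmxN mulmxA OmOm !mulNmx mul1mx opprK.
have eZ : Z *m Om = \sum_i \sum_j
    Z i j *: (evec (pos i) *m (evec (pos j))^T *m Om).
  rewrite {1}(matrix_sum_delta Z) mulmx_suml; apply: eq_bigr => i _.
  rewrite mulmx_suml; apply: eq_bigr => j _.
  by rewrite -scalemxAl !evec_delta trmx_delta mul_delta_mx.
have eZ' : Z *m Om = \sum_i \sum_j
    Z i j *: (evec (pos j) *m (evec (pos i))^T *m Om).
  rewrite eZ exchange_big; apply: eq_bigr => i _; apply: eq_bigr => j _.
  by rewrite -{1}symZ mxE.
have -> : \sum_i \sum_j Z i j *: spgen (pos i) (pos j) = X + X.
  rewrite {1}eX eZ eX eZ' -big_split; apply: eq_bigr => i _ /=.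
  by rewrite -big_split; apply: eq_bigr => j _ /=; rewrite -scalerDr.
by rewrite -mulr2n -scaler_nat scalerA mulVf ?scale1r // pnatr_eq0.
Qed.

Definition wtv p : 'rV[K]_n :=
  \row_j ((j == p :> nat)%:R - ((j + p).+1 == n + n)%N%:R).

Lemma weval_wtv p x (pn : (p < n)%N) : weval (wtv p) x = x 0 (Ordinal pn).
Proof.
rewrite /weval (bigD1 (Ordinal pn)) //= big1 => [|j jp].
  rewrite mxE /= eqxx; have -> : ((p + p).+1 == n + n)%N = false by lia.
  by rewrite subr0 mul1r addr0.
rewrite mxE; have := jp; rewrite -val_eqE /= => /negPf ->.
have -> : ((j + p).+1 == n + n)%N = false by have := ltn_ord j; lia.
by rewrite subr0 mul0r.
Qed.

Lemma wtv_bar p q : (p + q).+1 = (n + n)%N -> wtv p = - wtv q.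
Proof.
move=> e; apply/rowP => j; rewrite !mxE opprB; congr (_%:R - _%:R).
  by congr nat_of_bool; apply/eqP/eqP; lia.
by congr nat_of_bool; apply/eqP/eqP; lia.
Qed.

Lemma wevalN (mu : 'rV[K]_n) x : weval (- mu) x = - weval mu x.
Proof. by rewrite /weval -sumrN; apply: eq_bigr => i _; rewrite mxE mulNr. Qed.

Lemma wevalD (mu nu : 'rV[K]_n) x : weval (mu + nu) x = weval mu x + weval nu x.
Proof.
by rewrite /weval -big_split; apply: eq_bigr => i _; rewrite mxE mulrDl.
Qed.

Lemma weval_inj (mu nu : 'rV[K]_n) : (forall x, weval mu x = weval nu x) -> mu = nu.
Proof.
move=> e; apply/rowP => j; have := e (delta_mx 0 j).
have d (ka : 'rV[K]_n) : weval ka (delta_mx 0 j) = ka 0 j.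
  rewrite /weval (bigD1 j) //= big1 => [|i ij]; rewrite mxE !eqxx ?mulr1 ?addr0 //.
  by rewrite (negPf ij) mulr0.
by rewrite !d.
Qed.

Lemma cartan_evec x p : cartan x *m evec p = - weval (wtv p) x *: evec p.
Proof.
have [pn|pn] := ltnP p (n + n); last by rewrite evec_out // mulmx0 scaler0.
have [j <-] := pos_surj pn; rewrite evec_delta.
apply/matrixP => i k; rewrite ord1 -colE {k} [LHS]mxE [RHS]mxE [X in _ = _ * X]mxE /cartan andbT.
case: (split_ordP j) => a ->; case: (split_ordP i) => b ->; rewrite ?eq_shift.
- rewrite (block_mxEul (diag_mx x)) mxE pos_lshift.
  rewrite (@wtv_bar _ a); last by have := ltn_ord a; lia.
  rewrite wevalN opprK (weval_wtv x (ltn_ord a)).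
  rewrite (_ : Ordinal _ = a); last exact: val_inj.
  by case: eqP => [->|]; rewrite ?mulr1 ?mulr0 ?mulr1n ?mulr0n.
- by rewrite (block_mxEdl (diag_mx x)) mxE mulr0.
- by rewrite (block_mxEur (diag_mx x)) mxE mulr0.
- rewrite (block_mxEdr (diag_mx x)) !mxE pos_rshift (weval_wtv x (ltn_ord a)).
  rewrite (_ : Ordinal _ = a); last exact: val_inj.
  by case: eqP => [->|]; rewrite ?mulr1 ?mulr0 ?mulr1n ?mulr0n ?oppr0.
Qed.

Lemma tr_cartan x : (cartan x)^T = cartan x.
Proof.
by rewrite /cartan tr_block_mx !trmx0 linearN /= !tr_diag_mx.
Qed.

Lemma cartan_in_sp x : in_sp (cartan x).
Proof.
rewrite /in_sp tr_cartan /cartan /symp_form !mulmx_block.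
rewrite !(mul0mx, mulmx0, mul1mx, mulmx1, mulNmx, mulmxN, addr0, add0r, opprK).
by rewrite add_block_mx !addr0 !subrr block_mx_const.
Qed.

Lemma Om_cartan x : Om *m cartan x = - (cartan x *m Om).
Proof.
have /eqP := cartan_in_sp x; rewrite /in_sp tr_cartan addr_eq0.
by move=> /eqP ->; rewrite opprK.
Qed.

Lemma cartan_rank1 x p q : bracket (cartan x) (evec p *m (evec q)^T *m Om) =
  - weval (wtv p + wtv q) x *: (evec p *m (evec q)^T *m Om).
Proof.
have e1 : cartan x *m (evec p *m (evec q)^T *m Om) =
    - weval (wtv p) x *: (evec p *m (evec q)^T *m Om).
  by rewrite !mulmxA cartan_evec -!scalemxAl.
have e2 : evec p *m (evec q)^T *m Om *m cartan x =
    weval (wtv q) x *: (evec p *m (evec q)^T *m Om).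
  rewrite -mulmxA Om_cartan mulmxN mulmxA -(mulmxA (evec p) _ (cartan x)).
  rewrite -{1}(tr_cartan x) -trmx_mul cartan_evec linearZ /=.
  by rewrite -scalemxAr -scalemxAl scaleNr opprK.
by rewrite /bracket e1 e2 -scalerBl wevalD opprD.
Qed.

Lemma bracketDr (X Y Z : 'M[K]_(n + n)) : bracket X (Y + Z) = bracket X Y + bracket X Z.
Proof. by rewrite /bracket mulmxDl mulmxDr opprD addrACA. Qed.

Lemma bracket_cartan_F x p q :
  bracket (cartan x) (spgen p q) = - weval (wtv p + wtv q) x *: spgen p q.
Proof.
rewrite {1}/spgen /sym_prod bracketDr !cartan_rank1 [wtv q + _]addrC -scalerDr.
by [].
Qed.

End SympMatrix.

(** * Positive roots as unordered pairs of positions *)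

Section Roots.
Variable n : nat.
Implicit Types a b : posroot n.

(* The root alpha_{i,q} is eps_i - eps_{q+1} with eps_{\bar k} = - eps_k; it is
   encoded by the unordered pair of positions {ra, rb}, where rb = \bar{q+1}. *)
Definition ra a : nat := (val a).1.
Definition rq a : nat := (val a).2.
Definition rb a : nat := (n.*2.-2 - rq a)%N.

Lemma rootP a : [/\ (ra a < n)%N, (ra a <= rb a)%N, ((ra a + rb a).+1 < n + n)%N,
  (ra a <= rq a)%N & (rq a + rb a).+2 = (n + n)%N].
Proof.
rewrite /rb /rq /ra; case: a => [[i q] /= /andP[h1 h2]] /=.
by have := ltn_ord i; have := ltn_ord q; move: h1 h2 => /=; split; lia.
Qed.

Lemma root_inj a b : ra a = ra b -> rb a = rb b -> a = b.
Proof.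
move=> e1 e2; have := rootP a; have := rootP b => -[_ _ _ _ hb] [_ _ _ _ ha].
have e3 : rq a = rq b by lia.
move: e1 e3; rewrite /ra /rq => e1 e3.
apply: val_inj; case: (val a) (val b) e1 e3 => [x y] [z t] /= e1 e3.
by congr (_, _); apply: val_inj.
Qed.

Lemma root_ex x y : (x <= y)%N -> ((x + y).+1 < n + n)%N ->
  exists a, ra a = x /\ rb a = y.
Proof.
move=> xy xyn.
have xn : (x < n)%N by lia.
have qn : (n.*2.-2 - y < n.*2.-1)%N by lia.
have h : ((jpos (Ordinal xn, Ordinal qn : J n).1 <= (Ordinal xn, Ordinal qn : J n).2)
    && ((Ordinal xn, Ordinal qn : J n).2 <= jbar (Ordinal xn, Ordinal qn : J n).1))%N.
  by rewrite /=; lia.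
by exists (exist _ (Ordinal xn, Ordinal qn : J n) h : posroot n); rewrite /rb /rq /ra /=; split=> //; lia.
Qed.

(** [None] occurs exactly for the pairs with x + y + 1 >= 2n, whose [spgen] lies in h + n^+. So
    every pair of positions gives either a letter or an operator that does not lengthen words. *)
Definition root_of x y : option (posroot n) :=
  [pick a | ((ra a == x) && (rb a == y)) || ((ra a == y) && (rb a == x))].

Lemma root_ofP x y a : root_of x y = Some a ->
  (ra a = x /\ rb a = y) \/ (ra a = y /\ rb a = x).
Proof.
rewrite /root_of; case: pickP => // b hb [<-].
by case/orP: hb => /andP[/eqP-> /eqP->]; [left|right].
Qed.

Lemma root_ofN x y : root_of x y = None -> (n + n <= (x + y).+1)%N.
Proof.
rewrite /root_of; case: pickP => // h _; rewrite leqNgt; apply/negP => xyn.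
have [xy|/ltnW yx] := leqP x y.
  by have [a [e1 e2]] := root_ex xy xyn; have := h a; rewrite e1 e2 !eqxx.
have [||a [e1 e2]] := @root_ex y x => //; first by rewrite addnC.
by have := h a; rewrite e1 e2 !eqxx orbT.
Qed.

Lemma root_ofE a : root_of (ra a) (rb a) = Some a.
Proof.
case e: (root_of _ _) => [b|]; last first.
  by have := root_ofN e; have [_ _] := rootP a; rewrite ltnNge => /negPf ->.
congr Some; have [_ ab _ _ _] := rootP a; have [_ bb _ _ _] := rootP b.
by have [[]|[]] := root_ofP e => e1 e2; apply: root_inj; lia.
Qed.

Variable K : numClosedFieldType.

Lemma simple_root_wtv (x : J n) :
  simple_root K (jabs x) = wtv K n x - wtv K n x.+1.
Proof.
have xn := ltn_ord x; apply/rowP => j; have jn := ltn_ord j.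
rewrite !mxE -!val_eqE /=.
set xa := minn _ _.
have [xn1|xn1] := ltnP x.+1 n.
  have -> : (xa.+1 == n) = false by rewrite /xa; lia.
  have -> : xa = x by rewrite /xa; lia.
  have -> : ((j + x).+1 == n + n)%N = false by lia.
  have -> : ((j + x.+1).+1 == n + n)%N = false by lia.
  by rewrite !subr0.
have [xn2|xn2] := ltnP x n.
  have -> : (xa.+1 == n) by rewrite /xa; lia.
  have -> : xa = x by rewrite /xa; lia.
  have -> : ((j + x).+1 == n + n)%N = false by lia.
  have -> : (j == x.+1 :> nat) = false by lia.
  have -> : ((j + x.+1).+1 == n + n)%N = (j == x :> nat) by lia.
  by rewrite sub0r subr0 opprK mulr_natl mulr2n.
have -> : (xa.+1 == n) = false by rewrite /xa; lia.
have -> : (j == x :> nat) = false by lia.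
have -> : (j == x.+1 :> nat) = false by lia.
have -> : ((j + x).+1 == n + n)%N = (j == xa.+1 :> nat) by rewrite /xa; lia.
have -> : ((j + x.+1).+1 == n + n)%N = (j == xa :> nat) by rewrite /xa; lia.
by rewrite !sub0r opprK addrC.
Qed.

Lemma root_weightE a : root_weight K a = wtv K n (ra a) + wtv K n (rb a).
Proof.
have [an ab abn aq qbn] := rootP a.
rewrite /root_weight (eq_bigr (fun x : J n => wtv K n x - wtv K n x.+1)); last first.
  by move=> x _; exact: simple_root_wtv.
rewrite -(big_mkord (fun x => ra a <= x <= rq a)%N (fun x => wtv K n x - wtv K n x.+1)).
rewrite (eq_bigl (fun x => (true && (x < (rq a).+1)) && (ra a <= x))%N); last first.
  by move=> x /=; rewrite ltnS andbC.
have qn : ((rq a).+1 <= n.*2.-1)%N by lia.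
rewrite -(big_nat_widenl (ra a) 0 (n.*2.-1) (fun x => true && (x < (rq a).+1))%N) //.
rewrite -(big_nat_widen (ra a) _ _ (fun=> true) _ qn).
rewrite (eq_bigr (fun x => - (wtv K n x.+1 - wtv K n x))); last first.
  by move=> x _; rewrite opprB.
rewrite sumrN telescope_sumr; last lia.
rewrite opprB (@wtv_bar _ _ (rq a).+1 (rb a)) ?opprK //; lia.
Qed.

Lemma wtv_pair_inj (p q x y : nat) : (p < n + n)%N -> (q < n + n)%N ->
  (x < n + n)%N -> (y < n + n)%N -> (x + y).+1 != (n + n)%N ->
  wtv K n p + wtv K n q = wtv K n x + wtv K n y ->
  (p = x /\ q = y) \/ (p = y /\ q = x).
Proof.
move=> pn qn xn yn xyn e.
(* Coordinate j of [e] with the negative terms moved across: it counts j in the multisets {p, q,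
   \bar x, \bar y} and {x, y, \bar p, \bar q}. As the bar exchanges the two, the identity extends to
   all positions in [E]. *)
have E0 j : (j < n)%N ->
  ((j == p) + (j == q) + ((j + x).+1 == n + n) + ((j + y).+1 == n + n) =
   (j == x) + (j == y) + ((j + p).+1 == n + n) + ((j + q).+1 == n + n))%N.
  move=> jn; have := congr1 (fun u : 'rV[K]_n => u 0 (Ordinal jn)) e.
  rewrite !mxE /= => {}e; apply/eqP; rewrite -(eqr_nat K) !natrD; apply/eqP.
  move: e; set a1 := _%:R; set a2 := _%:R; set a3 := _%:R; set a4 := _%:R.
  set a5 := _%:R; set a6 := _%:R; set a7 := _%:R; set a8 := _%:R => e.
  have : a1 - a2 + (a3 - a4) + (a2 + a4 + a6 + a8) = a5 - a6 + (a7 - a8) + (a2 + a4 + a6 + a8).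
    by rewrite e.
  move=> e'; transitivity (a1 - a2 + (a3 - a4) + (a2 + a4 + a6 + a8)); first by ring.
  by rewrite e'; ring.
have barE j k : (j < n + n)%N ->
    ((j + k).+1 == n + n)%N = (k == (n + n).-1 - j)%N by move=> ?; apply/eqP/eqP; lia.
have E j : (j < n + n)%N -> let j' := ((n + n).-1 - j)%N in
  ((j == p) + (j == q) + (x == j') + (y == j') =
   (j == x) + (j == y) + (p == j') + (q == j'))%N.
  move=> jn j'; have [jn'|jn'] := ltnP j n; first by have := E0 j jn'; rewrite !barE.
  have j'n : (j' < n)%N by rewrite /j'; lia.
  have := E0 j' j'n; rewrite !barE ?(leq_trans j'n) ?leq_addr //.
  have -> : ((n + n).-1 - j' = j)%N by rewrite /j'; lia.
  rewrite !(eq_sym j) !(eq_sym j').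
  move: (p == j) (q == j) (x == j) (y == j) => b1 b2 b3 b4.
  move: (p == j') (q == j') (x == j') (y == j') => b5 b6 b7 b8; lia.
clear E0 e; have px : p = x \/ p = y.
  have [->|/negPf px] := eqVneq p x; first by left.
  have [->|/negPf py] := eqVneq p y; first by right.
  have := E p pn; rewrite /= eqxx px py.
  have -> : (p == (n + n).-1 - p)%N = false by apply/eqP; lia.
  case: (q =P _) => // qE _; have := E x xn; rewrite /= eqxx eq_sym px.
  have -> : (x == (n + n).-1 - x)%N = false by apply/eqP; lia.
  have -> : (y == (n + n).-1 - x)%N = false by apply/eqP; move/eqP: xyn; lia.
  have -> : (p == (n + n).-1 - x)%N = (x == q) by apply/eqP/eqP; lia.
  by case: (x == q); case: (x == y); case: (q == _).
have := E q qn; rewrite /= eqxx.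
have -> : (q == (n + n).-1 - q)%N = false by apply/eqP; lia.
case: px => ->; rewrite ![y == _]eq_sym ![x == _]eq_sym;
  case: (q =P x) => qx; case: (q =P y) => qy; do ?case: (_ == _) => //=; intuition lia.
Qed.

(** The Cartan subalgebra acts on the symmetric tensor X Om^T through both indices, so a nonzero
    entry (i, j) forces the weights of its two positions to add up to the root; by [wtv_pair_inj]
    only one unordered pair of positions remains. *)
Lemma root_space_F a (X : 'M[K]_(n + n)) :
  in_root_space (- root_weight K a) X -> exists k, X = k *: spgen K n (ra a) (rb a).
Proof.
move=> [spX wX]; have eX := sp_expand spX.
set Z := X *m (symp_form K n)^T in eX.
have ZE i j (x : 'rV[K]_n) : (weval (wtv K n (pos i) + wtv K n (pos j)) x) * Z i j =
    weval (root_weight K a) x * Z i j.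
  have cZ : cartan x *m Z + Z *m cartan x = - weval (root_weight K a) x *: Z.
    rewrite -wevalN /Z [in RHS]scalemxAl -wX /bracket mulmxBl !mulmxA; congr (_ + _).
    by rewrite -!mulmxA OmT !(mulNmx, mulmxN, opprK, Om_cartan).
  move/(congr1 (fun M : 'M_(n + n) => M i j)): cZ; rewrite [LHS]mxE [RHS]mxE.
  have -> : (cartan x *m Z) i j = - weval (wtv K n (pos i)) x * Z i j.
    have h : delta_mx 0 i *m cartan x = (- weval (wtv K n (pos i)) x *: delta_mx 0 i :> 'rV_(n + n)).
      apply: trmx_inj; rewrite trmx_mul tr_cartan trmx_delta -evec_delta cartan_evec.
      by rewrite linearZ /= trmx_delta -evec_delta.
    have := congr1 (fun M : 'rV_(n + n) => (M *m Z) 0 j) h.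
    rewrite -mulmxA -!rowE -scalemxAl -rowE.
    by rewrite mxE => ->; rewrite !mxE.
  have -> : (Z *m cartan x) i j = - weval (wtv K n (pos j)) x * Z i j.
    have := congr1 (fun M : 'cV_(n + n) => (Z *m M) i 0) (cartan_evec x (pos j)).
    rewrite evec_delta mulmxA -colE -scalemxAr -colE.
    by rewrite mxE => ->; rewrite !mxE.
  by rewrite -mulrDl -opprD -wevalD !mulNr => /oppr_inj.
exists (2^-1 * \sum_i \sum_j Z i j); rewrite {1}eX -scalerA; congr (_ *: _).
rewrite scaler_suml; apply: eq_bigr => i _.
rewrite scaler_suml; apply: eq_bigr => j _.
have [->|Zij] := eqVneq (Z i j) 0; first by rewrite !scale0r.
have := @wtv_pair_inj (pos i) (pos j) (ra a) (rb a).
have [an ab abn _ _] := rootP a.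
case=> [||||||[-> ->]|[-> ->]] //; rewrite ?pos_lt //; try lia.
  rewrite -root_weightE; apply: weval_inj => x.
  exact: (mulIf Zij (ZE i j x)).
by rewrite F_sym.
Qed.

Lemma F_root_space p q :
  in_root_space (- (wtv K n p + wtv K n q)) (spgen K n p q).
Proof.
by split; [exact: F_in_sp | move=> x; rewrite bracket_cartan_F wevalN].
Qed.

Lemma F_pos_root_space p q : (p < n + n)%N -> (q < n + n)%N -> (n + n <= p + q)%N ->
  exists a, in_root_space (root_weight K a) (spgen K n p q).
Proof.
move=> pn qn pq; set p' := ((n + n).-1 - p)%N; set q' := ((n + n).-1 - q)%N.
case e: (root_of p' q') => [a|]; last by have := root_ofN e; rewrite /p' /q'; lia.
exists a; have -> : root_weight K a = - (wtv K n p + wtv K n q).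
  rewrite root_weightE opprD (@wtv_bar _ _ p p') ?(@wtv_bar _ _ q q') ?opprK; try (rewrite /p' /q'; lia).
  by have [[-> ->]|[-> ->]] := root_ofP e; rewrite // addrC.
exact: F_root_space.
Qed.

Lemma F_evec p q r : spgen K n p q *m evec K n r =
  om K n q r *: evec K n p + om K n p r *: evec K n q.
Proof.
rewrite /spgen /sym_prod mulmxDl -!mulmxA !(mulmxA _^T) !om_evec.
by rewrite !mul_mx_scalar.
Qed.

Lemma evec_ext (X Y : 'M[K]_(n + n)) :
  (forall r, (r < n + n)%N -> X *m evec K n r = Y *m evec K n r) -> X = Y.
Proof.
move=> e; apply/matrixP => i j.
have := congr1 (fun M : 'cV_(n + n) => M i 0) (e _ (pos_lt j)).
by rewrite evec_delta -!colE !mxE.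
Qed.

Lemma F_cartan p q : (p + q).+1 = (n + n)%N ->
  exists x, spgen K n p q = cartan x.
Proof.
wlog pn : p q / (p < n)%N.
  move=> h e; have [pn|pn] := ltnP p n; first exact: h.
  by rewrite F_sym; apply: h; lia.
move=> e; exists (\row_j (- (j == p :> nat)%:R)); apply: evec_ext => r rn.
rewrite F_evec cartan_evec /om.
have qn : (q < n)%N = false by lia.
rewrite pn qn; have [rn'|rn'] := ltnP r n.
  have -> : ((p + r).+1 == n + n)%N = false by lia.
  rewrite scale0r addr0 weval_wtv mxE /= opprK.
  have -> : ((q + r).+1 == n + n)%N = (r == p) by lia.
  by case: eqP => [->|_]; rewrite ?scale0r.
have -> : ((q + r).+1 == n + n)%N = false by lia.
rewrite scale0r add0r.
have rn2 : ((n + n).-1 - r < n)%N by lia.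
rewrite (@wtv_bar _ _ r ((n + n).-1 - r)%N); last lia.
rewrite wevalN opprK weval_wtv mxE /=.
have -> : ((p + r).+1 == n + n)%N = ((n + n).-1 - r == p)%N by lia.
case: eqP => h; last by rewrite oppr0 !scale0r.
by have -> : r = q by lia.
Qed.

End Roots.

(** * Highest weight modules and the degree filtration *)

Definition linear_op (K : fieldType) (U1 U2 : lmodType K) (g : U1 -> U2) :=
  forall c u1 u2, g (c *: u1 + u2) = c *: g u1 + g u2.

Section LinearSpan.
Variables (K : fieldType) (U : lmodType K).
Implicit Types (G : U -> Prop) (u : U).

(** As an inductive predicate the span allows proofs by induction, without families of coefficients;
    [lspan_fset] later recovers such a family. *)
Inductive lspan G : U -> Prop :=
| lspan_nil : lspan G 0
| lspan_cons c g u of G g & lspan G u : lspan G (c *: g + u).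

Lemma lspanD G u1 u2 : lspan G u1 -> lspan G u2 -> lspan G (u1 + u2).
Proof.
elim=> [|c g u Gg _ IH] h; first by rewrite add0r.
by rewrite -addrA; apply: lspan_cons => //; exact: IH.
Qed.

Lemma lspanZ G c u : lspan G u -> lspan G (c *: u).
Proof.
elim=> [|d g u' Gg _ IH]; first by rewrite scaler0; exact: lspan_nil.
by rewrite scalerDr scalerA; apply: lspan_cons.
Qed.

Lemma lspan_mem G g : G g -> lspan G g.
Proof.
by move=> Gg; rewrite -[g]scale1r -[X in lspan _ X]addr0; apply: lspan_cons Gg _; exact: lspan_nil.
Qed.

Lemma lspanB G u1 u2 : lspan G u1 -> lspan G u2 -> lspan G (u1 - u2).
Proof. by move=> h1 h2; rewrite -scaleN1r; apply: lspanD h1 _; exact: lspanZ. Qed.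

Lemma lspan_sum G (I : Type) (r : seq I) (P : pred I) (f : I -> U) :
  (forall i, P i -> lspan G (f i)) -> lspan G (\sum_(i <- r | P i) f i).
Proof. by move=> h; apply: big_ind => //; [exact: lspan_nil|exact: lspanD]. Qed.

Lemma lspan_trans G G' u : (forall g, G g -> lspan G' g) -> lspan G u -> lspan G' u.
Proof.
move=> h; elim=> [|c g u' Gg _ IH]; first exact: lspan_nil.
by apply: lspanD => //; apply: lspanZ; exact: h.
Qed.

Lemma lspan_sub G G' u : (forall g, G g -> G' g) -> lspan G u -> lspan G' u.
Proof. by move=> h; apply: lspan_trans => g /h; exact: lspan_mem. Qed.

End LinearSpan.

Lemma linear_op0 (K : fieldType) (U1 U2 : lmodType K) (f : U1 -> U2) :
  linear_op f -> f 0 = 0.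
Proof.
move=> h; have := h (-1) 0 0; rewrite scaler0 addr0 scaleN1r addNr.
by [].
Qed.

Lemma lspan_img (K : fieldType) (U1 U2 : lmodType K) (f : U1 -> U2)
    (G : U1 -> Prop) (G' : U2 -> Prop) u : linear_op f ->
  (forall g, G g -> lspan G' (f g)) -> lspan G u -> lspan G' (f u).
Proof.
move=> lf h; elim=> [|c g u' Gg _ IH]; first by rewrite linear_op0 //; exact: lspan_nil.
by rewrite lf; apply: lspanD => //; apply: lspanZ; exact: h.
Qed.

Section LinearOp.
Variables (K : fieldType) (U1 U2 : lmodType K) (f : U1 -> U2).
Hypothesis lf : linear_op f.

Lemma linear_opD u1 u2 : f (u1 + u2) = f u1 + f u2.
Proof. by have := lf 1 u1 u2; rewrite !scale1r. Qed.
Lemma linear_opZ c u : f (c *: u) = c *: f u.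
Proof. by have := lf c u 0; rewrite addr0 linear_op0 // addr0. Qed.
Lemma linear_opB u1 u2 : f (u1 - u2) = f u1 - f u2.
Proof. by rewrite -scaleN1r linear_opD linear_opZ scaleN1r. Qed.
Lemma linear_op_sum (I : Type) (r : seq I) (P : pred I) (g : I -> U1) :
  f (\sum_(i <- r | P i) g i) = \sum_(i <- r | P i) f (g i).
Proof. exact: (big_morph f linear_opD (linear_op0 lf)). Qed.
End LinearOp.

Section HighestWeight.
Variables (K : numClosedFieldType) (n : nat) (U : lmodType K).
Variable phi : nat -> nat -> U -> U.
Implicit Types (a b : posroot n) (w : seq (posroot n)) (u : U) (d p q r : nat).

(** Only the operators of the spanning family [spgen p q] and their brackets are kept, so that the
    same statements apply to V, to the tensor model and to the product of the two. *)
Record sp_ops : Prop := SpOps {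
  sp_lin : forall p q, linear_op (phi p q);
  sp_sym : forall p q u, phi p q u = phi q p u;
  sp_comm : forall p q r (s : nat) u,
    phi p q (phi r s u) - phi r s (phi p q u) =
    om K n q r *: phi p s u + om K n q s *: phi p r u
    + om K n p r *: phi q s u + om K n p s *: phi q r u }.

Record hw_vec (v : U) (h : nat -> nat -> K) : Prop := HwVec {
  hw_pos : forall p q, (n + n <= p + q)%N -> phi p q v = 0;
  hw_cartan : forall p q, (p + q).+1 = (n + n)%N -> phi p q v = h p q *: v }.

Definition opr a u := phi (ra a) (rb a) u.
Definition act w u := foldr opr u w.

Variables (v : U) (h : nat -> nat -> K).
Hypotheses (sp : sp_ops) (hw : hw_vec v h).

Definition pbw_lt d := lspan (fun g => exists w, (size w < d)%N /\ g = act w v).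

Lemma opr_lin a : linear_op (opr a). Proof. exact: (sp_lin sp). Qed.
Hint Resolve opr_lin : core.

Lemma act_lin w : linear_op (act w).
Proof. by elim: w => [|a w IH] c u1 u2 //=; rewrite IH opr_lin. Qed.

Lemma act_cat w w' u : act (w ++ w') u = act w (act w' u).
Proof. by rewrite /act foldr_cat. Qed.

Lemma root_of_phi p q a u : root_of n p q = Some a -> phi p q u = opr a u.
Proof. by rewrite /opr => /root_ofP [[-> ->]|[-> ->]] //; rewrite (sp_sym sp). Qed.

Lemma W_mono d d' u : (d <= d')%N -> pbw_lt d u -> pbw_lt d' u.
Proof.
move=> dd'; apply: lspan_sub => g [w [wd ->]]; exists w.
by rewrite (leq_trans wd).
Qed.

Lemma W_act_mem w d : (size w < d)%N -> pbw_lt d (act w v).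
Proof. by move=> wd; apply: lspan_mem; exists w. Qed.

Lemma W_opr a d u : pbw_lt d u -> pbw_lt d.+1 (opr a u).
Proof.
apply: lspan_img => // g [w [wd ->]].
by apply: lspan_mem; exists (a :: w).
Qed.

(** Commuting the operator past a letter uses up this letter and leaves single operators applied to
    a shorter word. Each of them adds at most one letter, so the length never grows. *)
Lemma W_raise_act p q w : (n + n <= (p + q).+1)%N ->
  pbw_lt (size w).+1 (phi p q (act w v)).
Proof.
elim: w p q => [|a w IH] p q pq /=.
  have [pq'|pq'] := leqP (n + n) (p + q).
    by rewrite (hw_pos hw) //; exact: lspan_nil.
  by rewrite (hw_cartan hw); [apply/lspanZ/(@W_act_mem [::])|lia].
have any r (s : nat) : pbw_lt (size w).+2 (phi r s (act w v)).
  case e: (root_of n r s) => [b|].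
    by rewrite (root_of_phi _ e); apply: (@W_act_mem (b :: w)).
  by apply: W_mono (IH _ _ (root_ofN e)).
have := sp_comm sp p q (ra a) (rb a) (act w v).
move/(canRL (subrK _)) => ->; apply: lspanD; last by apply: W_opr; exact: IH.
by do ![apply: lspanD | apply: lspanZ]; exact: any.
Qed.

Lemma W_raise p q d u : (n + n <= (p + q).+1)%N -> pbw_lt d u -> pbw_lt d (phi p q u).
Proof.
move=> pq; apply: lspan_img => [|g [w [wd ->]]]; first exact: (sp_lin sp).
exact: W_mono (W_raise_act _ pq).
Qed.

Lemma W_phi p q d u : pbw_lt d u -> pbw_lt d.+1 (phi p q u).
Proof.
move=> Wu; case e: (root_of n p q) => [a|].
  by rewrite (root_of_phi _ e); exact: W_opr.
by apply: W_mono (W_raise (root_ofN e) Wu).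
Qed.

Lemma W_shift a w1 w2 :
  pbw_lt (size (w1 ++ w2)).+1 (act (w1 ++ a :: w2) v - act (a :: w1 ++ w2) v).
Proof.
elim: w1 => [|b w1 IH] /=; first by rewrite subrr; exact: lspan_nil.
set x := act (w1 ++ a :: w2) v in IH *; set y := act (w1 ++ w2) v.
rewrite (_ : _ - _ = opr b (x - opr a y) + (opr b (opr a y) - opr a (opr b y))).
  apply: lspanD; first exact: W_opr.
  rewrite (sp_comm sp); do ![apply: lspanD | apply: lspanZ];
  by apply: W_phi; exact: W_act_mem.
by rewrite (linear_opB (opr_lin b)) subrKA.
Qed.

(** This makes the order of the factors in a monomial immaterial: only the multiset of letters
    counts modulo shorter words. *)
Lemma W_perm w w' : perm_eq w w' -> pbw_lt (size w) (act w v - act w' v).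
Proof.
elim: w w' => [|a w IH] w' pw.
  by move: pw; rewrite perm_sym => /perm_nilP ->; rewrite subrr; exact: lspan_nil.
have aw' : a \in w' by rewrite -(perm_mem pw) mem_head.
case/splitPr: aw' pw => w1 w2 pw.
have {}pw : perm_eq w (w1 ++ w2).
  by rewrite -(perm_cons a) (perm_trans pw) // -cat1s perm_catCA.
rewrite (_ : _ - _ = opr a (act w v - act (w1 ++ w2) v) +
   (act (a :: w1 ++ w2) v - act (w1 ++ a :: w2) v)).
  apply: lspanD; first exact/W_opr/IH.
  rewrite -opprB -scaleN1r /= (perm_size pw); apply: lspanZ; exact: W_shift.
by rewrite (linear_opB (opr_lin a)) subrKA.
Qed.

(** A loop at z (a long root) yields the new edge twice, once for each end, as a derivation should.
    A pair that is not a root yields nothing, its operator being absorbed by the shorter words. *)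
Definition root_repl (z c : nat) a : seq (posroot n) :=
  (if ra a == z then seq_of_opt (root_of n c (rb a)) else [::]) ++
  (if rb a == z then seq_of_opt (root_of n (ra a) c) else [::]).

Fixpoint word_repl (z c : nat) w : seq (seq (posroot n)) :=
  if w is a :: w' then
    [seq a' :: w' | a' <- root_repl z c a] ++ [seq a :: w'' | w'' <- word_repl z c w']
  else [::].

(** The bracket of [spgen c \bar z] with the letter a also contracts c with an end of a equal to
    \bar c, which leaves [spgen \bar z y] with y the other end. This operator does not lengthen
    words exactly when z <= y. *)
Definition repl_ok (z c : nat) a :=
  ((ra a + c).+1 = (n + n)%N -> (z <= rb a)%N) /\
  ((rb a + c).+1 = (n + n)%N -> (z <= ra a)%N).

(* Modulo shorter words, [spgen c \bar z] replaces one vertex z by c. *)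
Definition repl_op (z c : nat) u :=
  om K n ((n + n).-1 - z) z *: phi c ((n + n).-1 - z) u.

Lemma repl_op_lin z c : linear_op (repl_op z c).
Proof.
move=> k u1 u2; rewrite /repl_op (sp_lin sp) scalerDr !scalerA.
by rewrite [_ * k]mulrC.
Qed.

Lemma om_repl z x : (z < n + n)%N ->
  om K n ((n + n).-1 - z) z * om K n ((n + n).-1 - z) x = (x == z)%:R.
Proof.
move=> zn; rewrite /om; have -> : (((n + n).-1 - z + z).+1 == n + n)%N by lia.
have -> : (((n + n).-1 - z + x).+1 == n + n)%N = (x == z) by lia.
by case: eqP => _; case: ifP => _; rewrite ?mulrNN ?mulr1 ?mulr0.
Qed.

(** Since z < c, the operator [phi c \bar z] kills v, and so it acts on a word as a derivation,
    letter by letter. *)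
Lemma W_repl z c w : (z < c)%N -> (c < n + n)%N -> (forall a, a \in w -> repl_ok z c a) ->
  pbw_lt (size w) (repl_op z c (act w v) - \sum_(w' <- word_repl z c w) act w' v).
Proof.
move=> zc cn; elim: w => [|a w IH] ok.
  rewrite big_nil subr0 /repl_op /= (hw_pos hw) ?scaler0; first exact: lspan_nil.
  lia.
have {}IH : pbw_lt (size w) (repl_op z c (act w v) - \sum_(w' <- word_repl z c w) act w' v).
  by apply: IH => b bw; apply: ok; rewrite inE bw orbT.
have [ok1 ok2] := ok a (mem_head _ _); clear ok.
set x := ra a in ok1 ok2; set y := rb a in ok1 ok2.
set zb := ((n + n).-1 - z)%N; set X := act w v in IH *.
rewrite /= big_cat !big_map /=.
have piece t t' : pbw_lt (size w).+1 ((t == z)%:R *: phi c t' X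
    - \sum_(j <- (if t == z then seq_of_opt (root_of n c t') else [::])) opr j X).
  case: eqP => _; last by rewrite big_nil scale0r subr0; exact: lspan_nil.
  rewrite scale1r; case e: (root_of n c t') => [b|] /=.
    by rewrite big_seq1 (root_of_phi _ e) subrr; exact: lspan_nil.
  by rewrite big_nil subr0; apply: W_raise (root_ofN e) _; exact: W_act_mem.
have piece2 t t' : ((t + c).+1 = n + n -> z <= t')%N ->
    pbw_lt (size w).+1 (om K n c t *: phi zb t' X).
  move=> ht; rewrite /om addnC; case: eqP => [/ht zt|_].
    by apply/lspanZ/W_raise; [rewrite /zb; lia | exact: W_act_mem].
  by rewrite scale0r; exact: lspan_nil.
have sym j t : root_of n t j = root_of n j t.
  by rewrite /root_of; apply: eq_pick => b /=; rewrite orbC.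
(* The bracket with the first letter has four terms: two replacements, each compared with its new
   letter, and two side terms made harmless by [repl_ok]. *)
rewrite (_ : _ - _ = opr a (repl_op z c X - \sum_(w' <- word_repl z c w) act w' v)
  + (((x == z)%:R *: phi c y X
       - \sum_(j <- (if x == z then seq_of_opt (root_of n c y) else [::])) opr j X)
  + ((y == z)%:R *: phi c x X
       - \sum_(j <- (if y == z then seq_of_opt (root_of n c x) else [::])) opr j X))
  + om K n zb z *: (om K n c x *: phi zb y X + om K n c y *: phi zb x X)).
  apply: lspanD; last by apply/lspanZ/lspanD; exact: piece2.
  by apply: lspanD; [exact: W_opr | apply: lspanD; exact: piece].
rewrite (linear_opB (opr_lin a)) (linear_op_sum (opr_lin a)) /root_repl big_cat /= (sym c x).
rewrite -/x -/y; set S1 := \sum_(_ <- _) _; set S2 := \sum_(_ <- _) _.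
set S3 := \sum_(_ <- _) _.
have zn : (z < n + n)%N by lia.
rewrite {1}/repl_op -/zb.
have -> : phi c zb (opr a X) = opr a (phi c zb X) + (om K n zb x *: phi c y X
   + om K n zb y *: phi c x X + om K n c x *: phi zb y X + om K n c y *: phi zb x X).
  by rewrite -(sp_comm sp) addrC subrK.
rewrite -!(om_repl _ zn) -/zb /repl_op -/zb (linear_opZ (opr_lin _)).
rewrite !scalerDr !scalerA.
move: (_ *: opr _ _) (_ *: phi c y X) (_ *: phi c x X) (_ *: phi zb y X) (_ *: phi zb x X).
move=> t1 t2 t3 t4 t5; move: S1 S2 S3 => S1 S2 S3.
rewrite !opprD !addrA.
by rewrite [LHS](ACl (1*8*2*6*3*7*4*5)).
Qed.

(** A list with repetitions stands for a sum with positive integer coefficients. Replacements keep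
    this form, so a word that has once been reached cannot be cancelled. *)
Definition vanishing d (L : seq (seq (posroot n))) :=
  (forall w, w \in L -> size w = d) /\ pbw_lt d (\sum_(w <- L) act w v).

Lemma word_repl_size z c w w' : w' \in word_repl z c w -> size w' = size w.
Proof.
elim: w w' => [|a w IH] w' //=; rewrite mem_cat => /orP[] /mapP[x hx ->] //=.
by rewrite (IH _ hx).
Qed.

Lemma vanishing_repl d L z c : (z < c)%N -> (c < n + n)%N ->
  (forall w a, w \in L -> a \in w -> repl_ok z c a) ->
  vanishing d L -> vanishing d (flatten [seq word_repl z c w | w <- L]).
Proof.
move=> zc cn ok [sL WL]; split.
  by move=> w' /flatten_mapP[w wL hw']; rewrite (word_repl_size hw') sL.
have : pbw_lt d (repl_op z c (\sum_(w <- L) act w v)).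
  by apply/lspanZ/W_raise => //; lia.
rewrite (linear_op_sum (repl_op_lin z c)) big_flatten big_map => WS.
rewrite -[X in pbw_lt _ X](subKr (\sum_(w <- L) repl_op z c (act w v))) -sumrB.
apply: lspanB => //.
rewrite big_seq; apply: lspan_sum => w wL.
rewrite -(sL _ wL); apply: W_repl => // a; exact: ok.
Qed.

Section Weights.
Variables (H : U -> U) (ht : posroot n -> nat) (lam : K).
Hypotheses (H_lin : linear_op H) (ht_gt0 : forall a, (0 < ht a)%N).
Hypotheses (H_opr : forall a u, H (opr a u) = opr a (H u) - (ht a)%:R *: opr a u).
Hypothesis (H_v : H v = lam *: v).

Let htw w := (\sum_(a <- w) ht a)%N.

Lemma H_act w : H (act w v) = (lam - (htw w)%:R) *: act w v.
Proof.
elim: w => [|a w IH]; first by rewrite /htw big_nil subr0.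
rewrite /= H_opr IH (linear_opZ (opr_lin a)) -scalerBl /htw big_cons natrD.
by rewrite opprD addrA addrAC.
Qed.

Let kill (s : seq nat) u := foldr (fun k u => H u - (lam - k%:R) *: u) u s.

Lemma kill_lin (s : seq nat) : linear_op (kill s).
Proof.
elim: s => [|k s IH] c u1 u2 //=; rewrite IH H_lin scalerDr scalerBr !scalerA.
by rewrite [c * _]mulrC opprD addrACA.
Qed.

Lemma kill_eigen (s : seq nat) u mu : H u = mu *: u ->
  kill s u = (\prod_(k <- s) (mu - lam + k%:R)) *: u.
Proof.
move=> Hu; elim: s => [|k s IH]; first by rewrite big_nil scale1r.
rewrite /= IH (linear_opZ H_lin) Hu !scalerA -scalerBl big_cons.
by congr (_ *: _); ring.
Qed.

(** If all heights are at most M, the product of H - lam + k for k = 1, .., M kills every nonempty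
    word of the combination, while it multiplies v by M!, which is not zero. *)
Lemma hw_notin_lower c : v <> 0 ->
  lspan (fun g => exists w, w <> [::] /\ g = act w v) (c *: v) -> c = 0.
Proof.
move=> v0 hc.
have [M] : exists M, lspan (fun g => exists w, (0 < htw w <= M)%N /\ g = act w v) (c *: v).
  elim: hc => [|d g u [w [w0 ->]] _ [M IH]]; first by exists 0; exact: lspan_nil.
  exists (maxn M (htw w)); apply: lspan_cons; last first.
    apply: lspan_sub IH => g' [w' [/andP[h1 h2] ->]]; exists w'; split=> //.
    by rewrite h1 leq_max h2.
  exists w; split=> //; rewrite leq_max leqnn orbT andbT.
  by case: w w0 => // a w _; rewrite /htw big_cons addn_gt0 ht_gt0.
move=> /(lspan_img (kill_lin (iota 1 M)) (G' := fun=> False)) hk.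
have k0 u : lspan (fun=> False) u -> u = 0 by elim.
have /k0 : lspan (fun=> False) (kill (iota 1 M) (c *: v)).
  apply: hk => g [w [/andP[w1 w2] ->]].
  rewrite (kill_eigen _ (H_act w)) (_ : \prod_(_ <- _) _ = 0) ?scale0r; first exact: lspan_nil.
  apply/eqP; rewrite prodf_seq_eq0; apply/hasP; exists (htw w).
    by rewrite mem_iota w1 add1n ltnS.
  by rewrite addrAC subrK subrr eqxx.
rewrite (linear_opZ (kill_lin _)) (kill_eigen _ H_v) scalerA subrr.
move/eqP; rewrite scaler_eq0 => /orP[|/eqP //].
rewrite mulf_eq0 => /orP[/eqP //|]; rewrite prodf_seq_eq0 => /hasP[k].
by rewrite mem_iota add0r pnatr_eq0 => /andP[k0' _] /eqP k00; rewrite k00 in k0'.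
Qed.

End Weights.

Lemma words_stable p q u :
  lspan (fun g => exists w, g = act w v) u -> lspan (fun g => exists w, g = act w v) (phi p q u).
Proof.
apply: lspan_img => [|g [w ->]]; first exact: (sp_lin sp).
have : pbw_lt (size w).+2 (phi p q (act w v)) by apply: W_phi; exact: W_act_mem.
by apply: lspan_sub => g' [w' [_ ->]]; exists w'.
Qed.

Lemma words_split u : lspan (fun g => exists w, g = act w v) u ->
  exists c t, u = c *: v + t /\ lspan (fun g => exists w, w <> [::] /\ g = act w v) t.
Proof.
elim=> [|c g u' [w ->] _ [d [t [-> ht]]]].
  by exists 0, 0; rewrite scale0r addr0; split=> //; exact: lspan_nil.
case: w => [|a w]; first by exists (c + d), t; rewrite addrA -scalerDl.
exists d, (c *: act (a :: w) v + t); rewrite addrCA; split=> //.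
by apply: lspan_cons => //; exists (a :: w).
Qed.

End HighestWeight.

(** * Nested words are lexicographically maximal *)

Section LexOrder.
Variables (T : finType) (key : T -> nat).
Hypothesis key_inj : injective key.
Implicit Types s t u : T -> nat.

(** The smallest key is the most significant one. *)
Definition lexlt s t :=
  [exists a, (s a < t a)%N && [forall b, (key b < key a)%N ==> (s b == t b)]].

Lemma lexltP s t : reflect
  (exists a, (s a < t a)%N /\ forall b, (key b < key a)%N -> s b = t b) (lexlt s t).
Proof.
apply: (iffP existsP) => -[a].
  case/andP=> h /forallP hb; exists a; split=> // b kb.
  by apply/eqP; have := hb b; rewrite kb.
case=> h hb; exists a; rewrite h; apply/forallP => b; apply/implyP => /hb ->.
by rewrite eqxx.
Qed.

Lemma lexlt_irr s : lexlt s s = false.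
Proof. by apply/lexltP => -[a []]; rewrite ltnn. Qed.

Lemma lexlt_trans t s u : lexlt s t -> lexlt t u -> lexlt s u.
Proof.
case/lexltP=> a [ha hb] /lexltP[a' [ha' hb']]; apply/lexltP.
have [kk|kk|/key_inj e] := ltngtP (key a) (key a').
- exists a; rewrite -hb' //; split=> // b kb; rewrite hb // hb' //.
  exact: ltn_trans kk.
- exists a'; rewrite hb //; split=> // b kb; rewrite hb ?hb' //.
  exact: ltn_trans kk.
- exists a; subst a'; split; first exact: ltn_trans ha'.
  by move=> b kb; rewrite hb // hb'.
Qed.

Lemma lexlt_total s t : s =1 t \/ lexlt s t || lexlt t s.
Proof.
have [/forallP h|] := boolP [forall a, s a == t a]; first by left=> a; apply/eqP.
rewrite negb_forall => /existsP[a0 ha0]; right.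
case: (@arg_minnP _ a0 (fun a => s a != t a) key ha0) => a ha hmin.
have hb b : (key b < key a)%N -> s b = t b.
  by move=> kb; apply/eqP; apply: contraLR kb => /hmin; rewrite -leqNgt.
have [lt|lt|e] := ltngtP (s a) (t a); last by rewrite e eqxx in ha.
  by apply/orP; left; apply/lexltP; exists a.
by apply/orP; right; apply/lexltP; exists a; split=> // b /hb.
Qed.

Lemma lexlt_add2l u s t : lexlt (fun a => u a + s a)%N (fun a => u a + t a)%N = lexlt s t.
Proof.
apply: eq_existsb => a; rewrite ltn_add2l; congr (_ && _).
by apply: eq_forallb => b; rewrite eqn_add2l.
Qed.

Lemma eq_lexlt s s' t t' : s =1 s' -> t =1 t' -> lexlt s t = lexlt s' t'.
Proof.
move=> es et; apply: eq_existsb => a; rewrite es et; congr (_ && _).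
by apply: eq_forallb => b; rewrite es et.
Qed.

(** A numerical measure that turns descent along [lexlt], for multiplicities bounded by N, into
    induction on a natural number. *)
Definition lexrank N t := #|[set s : {ffun T -> 'I_N.+1} | lexlt (fun a => s a) t]|.

Lemma lexrank_lt N s t : (forall a, (s a <= N)%N) -> lexlt s t ->
  (lexrank N s < lexrank N t)%N.
Proof.
move=> sN st; apply: proper_card; apply/properP; split.
  by apply/fintype.subsetP => u; rewrite !inE => us; apply: lexlt_trans us st.
pose s' := [ffun a => inord (s a) : 'I_N.+1].
have s'E : (fun a => s' a : nat) =1 s by move=> a; rewrite ffunE inordK // ltnS.
by exists s'; rewrite inE (eq_lexlt s'E (frefl _)) // lexlt_irr.
Qed.

End LexOrder.

Section NestedWords.
Variable n : nat.
Implicit Types (a b : posroot n) (w : seq (posroot n)).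

(** In terms of edges, [rle_rb] says that the interval [ra b, rb b] is contained in [ra a, rb a]:
    chains of roots are nested families of edges. *)
Definition rle a b := (ra a <= ra b)%N && (rq a <= rq b)%N.
Definition rlt a b := (a != b) && rle a b.

Lemma rle_trans : transitive rle.
Proof.
move=> b a c /andP[h1 h2] /andP[h3 h4]; apply/andP; split.
  exact: leq_trans h3.
exact: leq_trans h4.
Qed.

Lemma root_injq a b : ra a = ra b -> rq a = rq b -> a = b.
Proof.
move=> e1 e2; apply: root_inj => //.
by have [_ _ _ _ ?] := rootP a; have [_ _ _ _ ?] := rootP b; lia.
Qed.

Lemma rle_anti a b : rle a b -> rle b a -> a = b.
Proof.
move=> /andP[h1 h2] /andP[h3 h4].
by apply: root_injq; apply/eqP; rewrite eqn_leq ?h1 ?h2 ?h3 ?h4.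
Qed.

Lemma rlt_trans : transitive rlt.
Proof.
move=> b a c /andP[ab h1] /andP[bc h2]; rewrite /rlt (rle_trans h1 h2) andbT.
by apply: contraNneq ab => e; subst c; apply/eqP; apply: rle_anti.
Qed.

Lemma rle_rb a b : rle a b = (ra a <= ra b)%N && (rb b <= rb a)%N.
Proof.
rewrite /rle; have [_ _ _ _ ha] := rootP a; have [_ _ _ _ hb] := rootP b.
by congr (_ && _); apply/idP/idP; lia.
Qed.

Definition nested w := {in w &, forall a b, rle a b || rle b a}.

(** Both keys compare the lower end first. For equal lower ends [key1] puts the longer edge first,
    which favours nested edges; [key2] puts the shorter one first, which favours families where both
    ends increase. *)
Definition key1 a := (ra a * (n + n) + (n + n - rb a))%N.
Definition key2 a := (ra a * (n + n) + rb a)%N.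

Lemma key1_lt a b : (key1 a < key1 b)%N =
  (ra a < ra b)%N || (ra a == ra b) && (rb b < rb a)%N.
Proof.
rewrite /key1; have [han hab ha _ _] := rootP a; have [hbn hbb hb _ _] := rootP b.
have [lt|lt|->] := ltngtP (ra a) (ra b); rewrite /=.
- by have := leq_mul lt (leqnn (n + n)); rewrite mulSn => h; apply/idP; lia.
- by have := leq_mul lt (leqnn (n + n)); rewrite mulSn => h; apply/negP/negP; rewrite -leqNgt; lia.
by apply/idP/idP; lia.
Qed.

Lemma key2_lt a b : (key2 a < key2 b)%N =
  (ra a < ra b)%N || (ra a == ra b) && (rb a < rb b)%N.
Proof.
rewrite /key2; have [han hab ha _ _] := rootP a; have [hbn hbb hb _ _] := rootP b.
have [lt|lt|->] := ltngtP (ra a) (ra b); rewrite /=.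
- by have := leq_mul lt (leqnn (n + n)); rewrite mulSn => h; apply/idP; lia.
- by have := leq_mul lt (leqnn (n + n)); rewrite mulSn => h; apply/negP/negP; rewrite -leqNgt; lia.
by apply/idP/idP; lia.
Qed.

Lemma key1_inj : injective key1.
Proof.
move=> a b e; have := key1_lt a b; have := key1_lt b a; rewrite e !ltnn => h1 h2.
by apply: root_inj; move: h1 h2; case: ltngtP => //= _; case: ltngtP.
Qed.

Lemma key2_inj : injective key2.
Proof.
move=> a b e; have := key2_lt a b; have := key2_lt b a; rewrite e !ltnn => h1 h2.
by apply: root_inj; move: h1 h2; case: ltngtP => //= _; case: ltngtP.
Qed.

Definition inc a x := ((ra a == x) + (rb a == x))%N.
Definition vdeg w x := (\sum_(a <- w) inc a x)%N.

Lemma sum_count_mem (T : finType) (g : T -> nat) (w : seq T) :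
  (\sum_(a <- w) g a = \sum_a count_mem a w * g a)%N.
Proof.
elim: w => [|b w IH].
  by rewrite big_nil big1 // => a _; rewrite mul0n.
rewrite big_cons IH (bigD1 b) //= [RHS](bigD1 b) //= eqxx mulnDl mul1n addnA.
by congr (_ + _)%N; apply: eq_bigr => a ab; rewrite eq_sym (negPf ab) add0n.
Qed.

(** At the first edge a where the counts differ, suppose that ws has fewer copies. Equality of
    degrees at the two ends of a gives later edges b, c of ws through these ends, and such edges
    cross. *)
Lemma nested_lex_max ws w : nested ws -> vdeg w =1 vdeg ws ->
  perm_eq ws w \/ lexlt key1 (fun a => count_mem a w) (fun a => count_mem a ws).
Proof.
move=> nws dw; have [e|] := lexlt_total key1 (fun a => count_mem a ws) (fun a => count_mem a w).
  by left; apply/allP => a _; apply/eqP; exact: e.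
case/orP=> [|]; last by right.
case/lexltP=> a [lta eqa].
have other x : (0 < inc a x)%N -> exists b, [/\ b \in ws, (key1 a < key1 b)%N & (0 < inc b x)%N].
  move=> ax.
  have [/existsP[b /and3P[h1 h2 h3]]|] :=
      boolP [exists b, [&& b \in ws, (key1 a < key1 b)%N & (0 < inc b x)%N]].
    by exists b.
  rewrite negb_exists => /forallP h.
  have := dw x; rewrite /vdeg (sum_count_mem _ w) (sum_count_mem _ ws) => e; exfalso.
  have : (\sum_b count_mem b ws * inc b x < \sum_b count_mem b w * inc b x)%N.
    rewrite (bigD1 a) //= [X in (_ < X)%N](bigD1 a) //= -addSn leq_add //.
      by rewrite ltn_pmul2r.
    apply: leq_sum => b ba; have := h b; rewrite !negb_and -!leqNgt leqn0.
    have [k1|k1|/key1_inj e'] := ltngtP (key1 a) (key1 b); last by rewrite e' eqxx in ba.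
      case/or3P=> // [/count_memPn -> //|/eqP ->]; by rewrite !muln0.
    by rewrite eqa.
  by rewrite e ltnn.
(* Being later than a, b starts at ra a and ends before rb a, whereas c starts after ra a and ends
   at rb a or beyond; neither interval contains the other. *)
have [b [bws kb ib]] := other (ra a) ltac:(by rewrite /inc eqxx).
have [c [cws kc ic]] := other (rb a) ltac:(by rewrite /inc eqxx addn1).
have [_ hb _ _ _] := rootP b; have [_ hc _ _ _] := rootP c; have [_ ha _ _ _] := rootP a.
have /orP := nws _ _ bws cws; rewrite !rle_rb.
move: kb kc; rewrite !key1_lt => kb kc hbc; exfalso; clear - kb kc ib ic hb hc ha hbc.
have {}ib : ra b = ra a \/ rb b = ra a.
  by move: ib; rewrite /inc; do 2 case: eqP; auto.
have {}ic : ra c = rb a \/ rb c = rb a.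
  by move: ic; rewrite /inc; do 2 case: eqP; auto.
have {}kb : (ra a < ra b)%N \/ ra a = ra b /\ (rb b < rb a)%N.
  by case/orP: kb => [|/andP[/eqP]]; auto.
have {}kc : (ra a < ra c)%N \/ ra a = ra c /\ (rb c < rb a)%N.
  by case/orP: kc => [|/andP[/eqP]]; auto.
by case: hbc => /andP[]; lia.
Qed.

End NestedWords.

(** * Straightening *)

Section WordRepl.
Variable n : nat.
Implicit Types (a b r : posroot n) (w : seq (posroot n)).

Lemma root_repl_inc z c a a' x : a' \in root_repl z c a ->
  (inc a' x + (x == z) = inc a x + (x == c))%N.
Proof.
have mem_opt (o : option (posroot n)) b : b \in seq_of_opt o -> o = Some b.
  by case: o => [b'|] //=; rewrite inE => /eqP ->.
rewrite mem_cat => /orP[]; case: eqP => // ez /mem_opt /root_ofP; rewrite /inc.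
  by case=> -[-> ->]; rewrite ez !(eq_sym x); lia.
by case=> -[-> ->]; rewrite ez !(eq_sym x); lia.
Qed.

Lemma word_repl_vdeg z c w w' x : w' \in word_repl z c w ->
  (vdeg w' x + (x == z) = vdeg w x + (x == c))%N.
Proof.
rewrite /vdeg; elim: w w' => [|a w IH] w' //=; rewrite mem_cat => /orP[] /mapP[y hy ->].
  rewrite !big_cons addnAC (root_repl_inc x hy); lia.
by rewrite !big_cons -addnA (IH _ hy) addnA.
Qed.

Lemma word_repl_mem z c w1 a a' w2 : a' \in root_repl z c a ->
  w1 ++ a' :: w2 \in word_repl z c (w1 ++ a :: w2).
Proof.
move=> h; elim: w1 => [|b w1 IH] /=; rewrite mem_cat; apply/orP.
  by left; apply: map_f.
by right; apply: map_f.
Qed.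

Lemma root_repl_vertex (Q : nat -> Prop) z c a a' : a' \in root_repl z c a ->
  Q c -> Q (ra a) -> Q (rb a) -> Q (ra a') /\ Q (rb a').
Proof.
have mem_opt (o : option (posroot n)) b : b \in seq_of_opt o -> o = Some b.
  by case: o => [b'|] //=; rewrite inE => /eqP ->.
move=> h qc qa qb; move: h.
rewrite mem_cat => /orP[]; case: eqP => // ez /mem_opt /root_ofP;
  by case=> -[-> ->].
Qed.

Lemma word_repl_vertex (Q : nat -> Prop) z c w w' : w' \in word_repl z c w -> Q c ->
  (forall a, a \in w -> Q (ra a) /\ Q (rb a)) ->
  (forall a, a \in w' -> Q (ra a) /\ Q (rb a)).
Proof.
elim: w w' => [|a w IH] w' //=; rewrite mem_cat => /orP[] /mapP[y hy ->] qc qw b;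
  rewrite inE => /orP[/eqP ->|bw].
- by have [q1 q2] := qw a (mem_head _ _); apply: root_repl_vertex hy _ _ _.
- by apply: qw; rewrite inE bw orbT.
- by apply: qw; exact: mem_head.
- by apply: (IH _ hy qc) bw => d dw; apply: qw; rewrite inE dw orbT.
Qed.

End WordRepl.

Section Straightening.
Variables (K : numClosedFieldType) (n : nat) (U : lmodType K).
Variables (phi : nat -> nat -> U -> U) (v : U) (h : nat -> nat -> K).
Hypotheses (sp : sp_ops n phi) (hw : hw_vec n phi v h).
Implicit Types (a b r : posroot n) (w : seq (posroot n)).

(** Q restricts the vertices that may occur in the words of L; [repl_ok] is deduced from it. *)
Let good (Q : nat -> Prop) d (L : seq (seq (posroot n))) :=
  [/\ vanishing phi v d L,
      forall w w', w \in L -> w' \in L -> vdeg w =1 vdeg w'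
    & forall w a, w \in L -> a \in w -> Q (ra a) /\ Q (rb a)].

Let good_repl (Q : nat -> Prop) d L z c : (z < c)%N -> (c < n + n)%N -> Q c ->
  (forall a, Q (ra a) -> Q (rb a) -> repl_ok z c a) ->
  good Q d L -> good Q d (flatten [seq word_repl z c w | w <- L]).
Proof.
move=> zc cn Qc ok [vL dL QL]; split.
- apply: (vanishing_repl sp hw) => // w a wL aw.
  by have [] := QL _ _ wL aw; exact: ok.
- move=> w w' /flatten_mapP[w1 w1L h1] /flatten_mapP[w2 w2L h2] x.
  apply/eqP; rewrite -(eqn_add2r (x == z)).
  by rewrite (word_repl_vdeg x h1) (word_repl_vdeg x h2) (dL _ _ w1L w2L).
- move=> w a /flatten_mapP[w1 w1L h1].
  by apply: word_repl_vertex h1 Qc _ a => b bw; apply: QL bw.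
Qed.

(** From copies of the edge (i, k), the ends k are replaced by the ends rb r, and afterwards the
    ends i by the ends ra r. Each step also produces all other replacements of the same vertex, but
    these have the same degrees. *)
Lemma vanishing_nested i k ws a0 : ra a0 = i -> rb a0 = k -> (k == i) || (n <= k)%N ->
  (forall r, r \in ws -> (i <= ra r)%N /\ (k <= rb r)%N) ->
  act phi (nseq (size ws) a0) v = 0 ->
  exists L, [/\ vanishing phi v (size ws) L, ws \in L &
    forall w, w \in L -> vdeg w =1 vdeg ws].
Proof.
move=> a0i a0k ki hws nil0.
have [_ ik ikn _ _] := rootP a0; rewrite a0i a0k in ik ikn.
pose g r := odflt r (root_of n i (rb r)).
have gP r : r \in ws -> ra (g r) = i /\ rb (g r) = rb r.
  move=> /hws[h1 h2]; have [_ h3 h4 _ _] := rootP r; rewrite /g.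
  case e: (root_of n i (rb r)) => [b|] /=; last by have := root_ofN e; lia.
  have [_ h5 _ _ _] := rootP b.
  by have [[]|[]] := root_ofP e; lia.
have gE r : r \in ws -> root_of n i (rb r) = Some (g r).
  by move=> /gP[e1 e2]; rewrite -{1}e1 -e2 root_ofE.
(* If k = i, all vertices are at least k and [repl_ok] is clear. If k >= n, a side term needs the
   vertex \bar{rb r} < n <= k, which could only be i; but i + rb r + 1 < 2n. *)
pose Q1 x := x = i \/ (k <= x)%N.
have st1 todo : {subset todo <= ws} -> forall dn L,
    good Q1 (size ws) L -> dn ++ nseq (size todo) a0 \in L ->
    exists L', good Q1 (size ws) L' /\ dn ++ map g todo \in L'.
  elim: todo => [|r todo IH] sub dn L gL mL; first by exists L.
  have rws : r \in ws by apply: sub; exact: mem_head.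
  have sub' : {subset todo <= ws} by move=> b bt; apply: sub; rewrite inE bt orbT.
  have [i_r k_r] := hws _ rws; have [_ h3 h4 _ _] := rootP r.
  have [g1 g2] := gP _ rws.
  have [rk|rk] := eqVneq (rb r) k.
    have ga : g r = a0 by apply: root_inj; rewrite ?g1 ?g2 ?a0i ?a0k.
    rewrite /= ga -[dn ++ _ :: _]cat_rcons; rewrite -cat_rcons in mL.
    exact: IH sub' _ _ gL mL.
  rewrite /= -[dn ++ _ :: _]cat_rcons; apply: (IH sub' _ (flatten [seq word_repl k (rb r) w | w <- L])).
    apply: good_repl gL; [lia|lia|by right; lia|].
    move=> a [qa|qa] [qb|qb]; have [_ hab habn _ _] := rootP a;
      by split; case/orP: ki => [/eqP|] ? ?; lia.
  apply/flatten_mapP; exists (dn ++ nseq (size (r :: todo)) a0) => //.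
  rewrite cat_rcons; apply: word_repl_mem.
  by rewrite mem_cat a0k eqxx a0i gE //= mem_head orbT.
(* The replaced vertex i is now the least one allowed, so [repl_ok] is immediate. *)
pose Q2 x := (i <= x)%N.
have st2 todo : {subset todo <= ws} -> forall dn L,
    good Q2 (size ws) L -> dn ++ map g todo \in L ->
    exists L', good Q2 (size ws) L' /\ dn ++ todo \in L'.
  elim: todo => [|r todo IH] sub dn L gL mL; first by exists L.
  have rws : r \in ws by apply: sub; exact: mem_head.
  have sub' : {subset todo <= ws} by move=> b bt; apply: sub; rewrite inE bt orbT.
  have [i_r k_r] := hws _ rws; have [_ h3 h4 _ _] := rootP r.
  have [g1 g2] := gP _ rws.
  have [rk|rk] := eqVneq (ra r) i.
    have ga : g r = r by apply: root_inj; rewrite ?g1 ?g2.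
    rewrite /= ga -cat_rcons in mL; rewrite -[dn ++ _ :: _]cat_rcons; exact: IH sub' _ _ gL mL.
  rewrite -[dn ++ _ :: _]cat_rcons; apply: (IH sub' _ (flatten [seq word_repl i (ra r) w | w <- L])).
    apply: good_repl gL; rewrite /Q2; [lia|lia|lia|].
    by move=> a qa qb; split=> _; lia.
  apply/flatten_mapP; exists (dn ++ map g (r :: todo)) => //.
  rewrite cat_rcons; apply: word_repl_mem.
  by rewrite mem_cat g1 eqxx g2 root_ofE mem_head.
have gd0 : good Q1 (size ws) [:: nseq (size ws) a0].
  split.
  - split; first by move=> w; rewrite inE => /eqP ->; rewrite size_nseq.
    by rewrite big_seq1 nil0; exact: lspan_nil.
  - by move=> w w'; rewrite !inE => /eqP -> /eqP ->.
  - move=> w a; rewrite inE => /eqP -> /nseqP[-> _]; rewrite a0i a0k.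
    by split; [left|right].
have [L1 [gL1 mL1]] := st1 ws (fun _ => id) [::] _ gd0 (mem_head _ _).
have gL1' : good Q2 (size ws) L1.
  case: gL1 => h1 h2 h3; split=> // w a wL aw.
  by have := h3 _ _ wL aw; rewrite /Q1 /Q2; lia.
have [L2 [[h1 h2 h3] mL2]] := st2 ws (fun _ => id) [::] _ gL1' mL1.
by exists L2; split=> // w wL; exact: h2.
Qed.

Let below d ws w := (size w < d)%N \/
  size w = d /\ lexlt (@key1 n) (fun a => count_mem a w) (fun a => count_mem a ws).

Lemma straighten_nested i k ws a0 : nested ws -> ra a0 = i -> rb a0 = k ->
  (k == i) || (n <= k)%N ->
  (forall r, r \in ws -> (i <= ra r)%N /\ (k <= rb r)%N) ->
  act phi (nseq (size ws) a0) v = 0 ->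
  lspan (fun g => exists w, below (size ws) ws w /\ g = act phi w v) (act phi ws v).
Proof.
move=> nws a0i a0k ki hws nil0.
have [L [[sL WL] wsL dL]] := vanishing_nested a0i a0k ki hws nil0.
set G := (G in lspan G _).
have WG u : pbw_lt n phi v (size ws) u -> lspan G u.
  by apply: lspan_sub => g [w [hw' ->]]; exists w; split=> //; left.
(* The coefficient of ws in the vanishing sum: the number of rearrangements of ws in L, positive
   because ws itself is one. *)
have c0 : (count (perm_eq ws) L)%:R != 0 :> K.
  by rewrite pnatr_eq0 -lt0n -has_count; apply/hasP; exists ws => //; rewrite perm_refl.
rewrite -[act phi ws v](scalerK c0); apply: lspanZ.
have -> : (count (perm_eq ws) L)%:R *: act phi ws v =
    \sum_(w <- L) act phi w v - \sum_(w <- L | ~~ perm_eq ws w) act phi w v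
    + \sum_(w <- L | perm_eq ws w) (act phi ws v - act phi w v).
  rewrite sumrB (bigID (perm_eq ws)) /= addrK addrC subrK.
  by rewrite -sum1_count natr_sum scaler_suml; apply: eq_bigr => w _; rewrite scale1r.
apply: lspanD; first (apply: lspanB; first exact: WG).
  rewrite big_seq_cond; apply: lspan_sum => w /andP[wL pw]; apply: lspan_mem.
  exists w; split=> //; right; split; first exact: sL.
  have [pw'|//] := nested_lex_max nws (dL _ wL).
  by rewrite pw' in pw.
by apply: lspan_sum => w pw; apply: WG; exact: (W_perm sp hw).
Qed.

End Straightening.

Section Spanning.
Variables (n : nat) (m : 'I_n -> nat).
Implicit Types (a b r : posroot n) (w : seq (posroot n)).

Definition msum (i j : nat) := (\sum_(l < n | (i <= l <= j)%N) m l)%N.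

(* By dyck_refine every chain of roots extends to a Dyck path, so that the
   inequalities for chains and for Dyck paths are equivalent. *)
Definition chain_lattice (s : posroot n -> nat) := forall a p i j,
  path (@rlt n) a p -> (i <= ra a)%N -> (rq (last a p) <= j)%N || (n <= j.+1)%N ->
  (\sum_(b <- a :: p) s b <= msum i j)%N.

(** The roots whose powers give the relations: alpha_{i,j} for bounds that stop before n, and
    alpha_{i,\bar i} for those that run up to n, including the paths that end at alpha_n. *)
Definition edge_root a (j : nat) :=
  (ra a == rb a) && (n <= j.+1)%N || (rq a == j) && (j.+1 < n)%N.

Lemma size_filter_mem (T : eqType) (C w : seq T) : uniq C ->
  size [seq b <- w | b \in C] = (\sum_(b <- C) count_mem b w)%N.
Proof.
move=> uC; rewrite size_filter; elim: w => [|c w IH].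
  by rewrite big1 // => b _.
rewrite /= IH big_split /=; congr (_ + _)%N.
rewrite -(count_uniq_mem c uC); elim: C {uC IH} => [|b C IH]; first by rewrite big_nil.
by rewrite big_cons /= IH eq_sym.
Qed.

Lemma rlt_path_mem a p : path (@rlt n) a p ->
  [/\ uniq (a :: p), nested (a :: p) & forall b, b \in a :: p -> rle a b && rle b (last a p)].
Proof.
move=> ap; have := ap; rewrite (path_sortedE (@rlt_trans n)) => /andP[/allP ha _].
have le_refl b : rle b b by rewrite /rle !leqnn.
have rltW b c : rlt b c -> rle b c by case/andP.
have srt : sorted (@rlt n) (a :: p) by [].
have srte : sorted (@rle n) (a :: p) by apply: sub_sorted srt => b c /rltW.
split.
- by apply: (sorted_uniq (@rlt_trans n) _ srt) => b; rewrite /rlt eqxx.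
- move=> b c hb hc; have [bc|/ltnW bc] := leqP (index b (a :: p)) (index c (a :: p)).
    by rewrite (sorted_leq_index (@rle_trans n) le_refl srte).
  by rewrite orbC (sorted_leq_index (@rle_trans n) le_refl srte).
- move=> b hb; apply/andP; split.
    by move: hb; rewrite inE => /orP[/eqP ->|/ha /rltW].
  have := sorted_leq_index (@rle_trans n) le_refl srte b _ hb (mem_last a p); apply.
  rewrite index_last ?(sorted_uniq (@rlt_trans n) _ srt) //; last by move=> c; rewrite /rlt eqxx.
  by rewrite -ltnS -[(size p).+1]/(size (a :: p)) index_mem.
Qed.

Variables (K : numClosedFieldType) (U : lmodType K).
Variables (phi : nat -> nat -> U -> U) (v : U) (h : nat -> nat -> K).
Hypotheses (sp : sp_ops n phi) (hw : hw_vec n phi v h).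
Hypothesis nilp : forall a j N, edge_root a j -> (msum (ra a) j < N)%N ->
  act phi (nseq N a) v = 0.

Let below w0 w := (size w < size w0)%N \/
  size w = size w0 /\ lexlt (@key1 n) (fun a => count_mem a w) (fun a => count_mem a w0).

(** Only the letters on a violated chain are straightened. The others are moved to the left, where
    they multiply the whole relation; adding their multiplicities to both sides preserves
    [lexlt]. *)
Lemma straighten w : ~ chain_lattice (fun a => count_mem a w) ->
  lspan (fun g => exists w', below w w' /\ g = act phi w' v) (act phi w v).
Proof.
move=> nS.
have [a [p [i [j [ap ia lj big]]]]] : exists a p i j, [/\ path (@rlt n) a p,
    (i <= ra a)%N, (rq (last a p) <= j)%N || (n <= j.+1)%N &
    (msum i j < \sum_(b <- a :: p) count_mem b w)%N].
  apply: contrapT => H; apply: nS => a p i j h1 h2 h3; rewrite leqNgt; apply/negP => h4.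
  by apply: H; exists a, p, i, j.
have [uC nC bC] := rlt_path_mem ap.
set ws := [seq b <- w | b \in a :: p]; set rest := [seq b <- w | b \notin a :: p].
have sws : (msum i j < size ws)%N by rewrite size_filter_mem.
have memws b : b \in ws -> b \in a :: p by rewrite mem_filter => /andP[].
have pw : perm_eq w (rest ++ ws) by rewrite perm_sym perm_catC perm_filterC.
have [an ab abn aq qb] := rootP a.
(* The long root (i, i) if the bound runs up to n; otherwise alpha_{i,j}, whose second end \bar{j+1}
   has position 2n-2-j, at least n as [vanishing_nested] requires. *)
have [a0 [ei ea0 ek hk]] : exists a0, [/\ ra a0 = i, edge_root a0 j,
    (rb a0 == i) || (n <= rb a0)%N & forall r, r \in ws -> (rb a0 <= rb r)%N].
  have hrb r : r \in ws -> (i <= ra r)%N.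
    by move=> /memws /bC /andP[/andP[h1 _] _]; exact: leq_trans h1.
  have [jn|jn] := leqP n j.+1.
    have [||a0 [e1 e2]] := @root_ex n i i; [by []|lia|].
    exists a0; rewrite /edge_root e1 e2 eqxx jn /=; split=> // r rws.
    by have := hrb _ rws; have [_ ? _ _ _] := rootP r; lia.
  have hl : (rq (last a p) <= j)%N by case/orP: lj => //; lia.
  have qj r : r \in ws -> (rq r <= j)%N.
    by move=> /memws /bC /andP[_ /andP[_ h1]]; exact: leq_trans hl.
  have aj : (rq a <= j)%N.
    by have /andP[_ /andP[_ h1]] := bC a (mem_head _ _); exact: leq_trans hl.
  have [||a0 [e1 e2]] := @root_ex n i (n.*2.-2 - j); [lia|lia|].
  have [_ _ _ _ q0] := rootP a0.
  exists a0; split=> //; rewrite /edge_root ?jn ?e2; first by apply/orP; right; rewrite andbT; lia.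
    by apply/orP; right; lia.
  by move=> r /qj; have [_ _ _ _ ?] := rootP r; lia.
have nws : nested ws by move=> b c /memws hb /memws hc; exact: nC.
have hA r : r \in ws -> (i <= ra r)%N /\ (rb a0 <= rb r)%N.
  move=> rws; split; last exact: hk.
  by have /memws /bC /andP[/andP[h1 _] _] := rws; exact: leq_trans h1.
have hB : act phi (nseq (size ws) a0) v = 0 by apply: nilp ea0 _; rewrite ei.
have st := straighten_nested sp hw nws ei erefl ek hA hB.
have lowG u : pbw_lt n phi v (size w) u ->
    lspan (fun g => exists w', below w w' /\ g = act phi w' v) u.
  by apply: lspan_sub => g [w' [h1 ->]]; exists w'; split=> //; left.
have step u : lspan (fun g => exists w', ((size w' < size ws)%N \/ size w' = size ws /\
    lexlt (@key1 n) (fun a => count_mem a w') (fun a => count_mem a ws)) /\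
    g = act phi w' v) u ->
  lspan (fun g => exists w', below w w' /\ g = act phi w' v) (act phi rest u).
  apply: lspan_img => [|g [w' [hw' ->]]]; first exact: act_lin.
  apply: lspan_mem; exists (rest ++ w'); rewrite act_cat; split=> //.
  rewrite /below (perm_size pw) !size_cat ltn_add2l.
  case: hw' => [|[-> lt]]; [by left|right; split=> //].
  rewrite -(lexlt_add2l _ (fun a => count_mem a rest)) in lt.
  rewrite (@eq_lexlt _ _ _ (fun a => count_mem a rest + count_mem a w')%N
    _ (fun a => count_mem a rest + count_mem a ws)%N) // => b.
    by rewrite count_cat.
  by rewrite (seq.permP pw) count_cat.
rewrite -[act phi w v](subrK (act phi (rest ++ ws) v)).
apply: lspanD; last by rewrite act_cat; exact: step.
exact/lowG/(W_perm sp hw).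
Qed.

(** Induction on the length, then on the lexicographic rank. A word with admissible multiplicities
    is exchanged for the prescribed ordering at the cost of shorter words; any other word is
    straightened. *)
Lemma spanning (S : {ffun posroot n -> nat} -> Prop) (f : {ffun posroot n -> nat} -> seq (posroot n)) :
  (forall s : {ffun posroot n -> nat}, chain_lattice s -> S s) ->
  (forall s, S s -> forall a, count_mem a (f s) = s a) ->
  forall w, lspan (fun g => exists s, S s /\ g = act phi (f s) v) (act phi w v).
Proof.
move=> cS fS w; set G := fun g => _.
have [d] := ubnP (size w); elim: d w => // d IHd w /ltnSE wd.
have [k] := ubnP (lexrank (@key1 n) (size w) (fun a => count_mem a w)).
elim: k w wd => // k IHk w wd /ltnSE wk.
have [cw|ncw] := EM (chain_lattice (fun a => count_mem a w)).
  pose s := [ffun a => count_mem a w].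
  have Ss : S s.
    apply: cS => a p i j h1 h2 h3.
    by under eq_bigr do rewrite ffunE; exact: cw.
  have pws : perm_eq w (f s).
    by apply/allP => a _; apply/eqP; rewrite fS // ffunE.
  rewrite -[act phi w v](subrK (act phi (f s) v)); apply: lspanD; last first.
    by apply: lspan_mem; exists s.
  apply: lspan_trans (W_perm sp hw pws) => g [w' [h1 ->]].
  by apply: IHd; exact: leq_trans h1 wd.
apply: lspan_trans (straighten ncw) => g [w' [[h1|[h1 h2]] ->]].
  by apply: IHd; exact: leq_trans h1 wd.
apply: IHk; first by rewrite h1.
rewrite h1; apply: leq_trans wk; apply: lexrank_lt h2; first exact: key1_inj.
by move=> a; rewrite -h1 count_size.
Qed.

End Spanning.

(** * Dyck paths and chains *)

Section DyckChains.
Variable n : nat.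
Implicit Types (a b : posroot n) (s : posroot n -> nat).

Lemma ra_alpha (i : 'I_n) : ra (alpha i) = i. Proof. by []. Qed.
Lemma rq_alpha (i : 'I_n) : rq (alpha i) = i. Proof. by []. Qed.
Lemma ra_alpha_bar (i : 'I_n) : ra (alpha_bar i) = i. Proof. by []. Qed.
Lemma rq_alpha_bar (i : 'I_n) : (rq (alpha_bar i) + i).+2 = (n + n)%N.
Proof. by rewrite /rq /=; have := ltn_ord i; lia. Qed.

Lemma dyck_stepE a b : dyck_step a b =
  ((ra b == ra a) && (rq b == (rq a).+1)) || ((ra b == (ra a).+1) && (rq b == rq a)).
Proof. by []. Qed.

Lemma dyck_step_rlt a b : dyck_step a b -> rlt a b.
Proof.
rewrite dyck_stepE /rlt /rle => hab; apply/andP; split.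
  apply/negP => /eqP e; subst b; move: hab => /orP[] /andP[/eqP h1 /eqP h2]; lia.
by case/orP: hab => /andP[/eqP -> /eqP ->]; rewrite leqnn leqnSn.
Qed.

(** First q moves up to its final value, then r. All intermediate pairs are roots, because [ra]
    grows only to ra b, [rb] falls only to rb b, and ra b <= rb b. *)
Lemma dyck_connect a b : rle a b -> exists p, path (@dyck_step n) a p /\ last a p = b.
Proof.
have [k] := ubnP ((ra b - ra a) + (rq b - rq a)).
elim: k a => // k IH a /ltnSE hk /andP[hra hrq].
have [eab|] := eqVneq (rq a) (rq b); last first.
  move=> ne; have [an ab abn aq qb] := rootP a; have [bn bb bbn bq qbb] := rootP b.
  have [||c [c1 c2]] := @root_ex n (ra a) (rb a).-1; [lia|lia|].
  have [_ _ _ _ cq] := rootP c.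
  have [||p [h1 h2]] := IH c; rewrite /rle; [lia|by apply/andP; split; lia|].
  exists (c :: p); split=> //=; rewrite h1 andbT dyck_stepE; apply/orP; left.
  by apply/andP; split; apply/eqP; lia.
have [eab'|] := eqVneq (ra a) (ra b).
  by exists [::]; split=> //=; apply: root_injq.
move=> ne; have [an ab abn aq qb] := rootP a; have [bn bb bbn bq qbb] := rootP b.
have [||c [c1 c2]] := @root_ex n (ra a).+1 (rb a); [lia|lia|].
have [_ _ _ _ cq] := rootP c.
have [||p [h1 h2]] := IH c; rewrite /rle; [lia|by apply/andP; split; lia|].
exists (c :: p); split=> //=; rewrite h1 andbT dyck_stepE; apply/orP; right.
by apply/andP; split; apply/eqP; lia.
Qed.

Lemma leq_sum_mem s b (p : seq (posroot n)) : b \in p -> (s b <= \sum_(c <- p) s c)%N.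
Proof. by move=> bp; rewrite (big_rem b) //= leq_addr. Qed.

Lemma dyck_refine s a p : path (@rlt n) a p -> exists p',
  [/\ path (@dyck_step n) a p', last a p' = last a p &
      (\sum_(b <- p) s b <= \sum_(b <- p') s b)%N].
Proof.
elim: p a => [|b p IH] a /=; first by exists [::].
case/andP=> /andP[ab hab] /IH[p' [h1 h2 h3]].
have [q [q1 q2]] := dyck_connect hab.
exists (q ++ p'); rewrite cat_path q1 last_cat q2; split=> //.
rewrite big_cons big_cat leq_add //; apply: leq_sum_mem.
case: q q1 q2 => [|c q] _ /= e; last by rewrite -e mem_last.
by rewrite e eqxx in ab.
Qed.

Lemma lattice_pointsE (R : realType) (m : 'I_n -> nat) (s : {ffun posroot n -> nat}) :
  lattice_points R m s <-> chain_lattice m s.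
Proof.
split=> [[_ H] a p i j ap ia jl | H].
  have [an aab abn aq _] := rootP a.
  have i_n : (i < n)%N by lia.
  pose i' := Ordinal i_n.
  have [uC nC bC] := rlt_path_mem ap.
  have /andP[la _] := bC _ (mem_last a p).
  have [q [q1 q2]] := dyck_connect (a := alpha i') (b := a) ltac:(by
    rewrite /rle ra_alpha rq_alpha /=; apply/andP; split; lia).
  have [p' [h1 h2 h3]] := dyck_refine s ap.
  (* If the bound runs up to n, the path is prolonged within its last row r to the end alpha_{\bar
     r} of that row; otherwise it is prolonged to alpha_j. *)
  have [jj [e [he1 he2 he3]]] : exists (jj : 'I_n) e, [/\ rle (last a p) e, (i <= jj)%N
      & (e = alpha jj /\ (msum m i jj <= msum m i j)%N) \/
        (e = alpha_bar jj /\ (msum m i n <= msum m i j)%N)].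
    have [ln lab lbn lq _] := rootP (last a p).
    have [nj|nj] := leqP n j.+1.
      pose jj := Ordinal ln; exists jj, (alpha_bar jj); split.
      - rewrite /rle ra_alpha_bar leqnn /=; have := rq_alpha_bar jj => /= ?.
        by have [_ _ _ _ ?] := rootP (last a p); lia.
      - by move: la => /andP[h _]; apply: leq_trans h.
      - right; split=> //; rewrite /msum; apply: eq_leq; apply: eq_bigl => l.
        by have := ltn_ord l; lia.
    have lj : (rq (last a p) <= j)%N by case/orP: jl => //; lia.
    have jn : (j < n)%N by lia.
    exists (Ordinal jn), (alpha (Ordinal jn)); split.
    - by rewrite /rle ra_alpha rq_alpha /= lj andbT; apply: leq_trans lj.
    - by move: la => /andP[h _]; apply: leq_trans ia (leq_trans h (leq_trans lq lj)).
    - by left.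
  have [q' [q1' q2']] := dyck_connect he1.
  pose P := q ++ p' ++ q'.
  have lP : last (alpha i') P = e by rewrite /P !last_cat q2 h2.
  have dP : dyck (alpha i') P.
    apply/andP; split; last by rewrite /P !cat_path q1 q2 h1 h2 q1'.
    apply/existsP; exists i'; apply/existsP; exists jj; rewrite eqxx he2 lP /=.
    by case: he3 => [[-> _]|[-> _]]; rewrite eqxx ?orbT.
  have sP : (\sum_(b <- a :: p) s b <= \sum_(b <- alpha i' :: P) s b)%N.
    rewrite big_cons /P -cat_cons !big_cat leq_add //.
      by apply: leq_sum_mem; rewrite -q2 mem_last.
    exact: leq_trans h3 (leq_addr _ _).
  apply: leq_trans sP _; have [HA HB] := H _ _ dP i' jj erefl.
  case: he3 => -[ee hm]; apply: leq_trans hm.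
    by have := HA (etrans lP ee); rewrite -natr_sum ler_nat.
  have := HB (etrans lP ee); rewrite -natr_sum ler_nat => /leq_trans; apply.
  rewrite /msum; apply: eq_leq; apply: eq_bigl => l /=.
  by rewrite [(l <= n)%N]ltnW // andbT.
split=> [a|a p]; first by rewrite ler0n.
case/andP=> _ /(sub_path dyck_step_rlt) ap i j ai; split=> lj;
  rewrite -natr_sum ler_nat.
  by apply: H ap _ _; rewrite ?lj ?ai ?ra_alpha ?rq_alpha ?leqnn.
apply: leq_trans (H a p i n ap _ _) _; rewrite ?ai ?ra_alpha ?leqnSn ?orbT //.
by rewrite /msum; apply: eq_leq; apply: eq_bigl => l; rewrite [(l <= n)%N]ltnW // andbT.
Qed.

End DyckChains.

(** * Removing the minimal roots from a lattice point *)

Section Decomposition.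
Variable n : nat.
Implicit Types (a b : posroot n) (s : posroot n -> nat) (m : 'I_n -> nat).

Lemma chain_lattice_sorted m s C i j : chain_lattice m s -> sorted (@rlt n) C ->
  (forall b, b \in C -> (i <= ra b)%N) ->
  (forall b, b \in C -> (rq b <= j)%N || (n <= j.+1)%N) ->
  (\sum_(b <- C) s b <= msum m i j)%N.
Proof.
case: C => [|a p] cl srt hi hj; first by rewrite big_nil.
by apply: cl => //; [apply: hi; exact: mem_head | apply: hj; exact: mem_last].
Qed.

Variables (m : 'I_n -> nat) (l0 : 'I_n) (s : posroot n -> nat).
Hypotheses (m_l0 : (0 < m l0)%N) (m_min : forall l : 'I_n, (l < l0)%N -> m l = 0%N).
Hypothesis cl : chain_lattice m s.

Definition dec_weight (l : 'I_n) := (m l - (l == l0))%N.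

Lemma msum_dec i j : msum m i j = (msum dec_weight i j + (i <= l0 <= j))%N.
Proof.
rewrite /msum; have [h|h] := boolP (i <= l0 <= j)%N.
  rewrite (bigD1 l0) //= [in RHS](bigD1 l0) //= /dec_weight eqxx.
  rewrite addnAC subnK //; congr (_ + _)%N.
  by apply: eq_bigr => l /andP[_ /negPf ->]; rewrite subn0.
rewrite addn0; apply: eq_bigr => l hl; rewrite /dec_weight.
by case: eqP hl h => [->|] //=; rewrite ?subn0 // => ->.
Qed.

Definition straddles b := [&& (0 < s b)%N, (ra b <= l0)%N & (l0 <= rq b)%N].
Definition min_roots : {set posroot n} :=
  [set a | straddles a & [forall b, straddles b ==> ~~ rlt b a]].

Lemma min_roots_ex b : straddles b -> exists2 a, a \in min_roots & rle a b.
Proof.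
clear m_l0 m_min cl => sb; pose P c := straddles c && rle c b.
have Pb : P b by rewrite /P sb /rle !leqnn.
case: (@arg_minnP _ b P (fun c => ra c + rq c)%N Pb) => a /andP[sa ab] amin.
exists a => //; rewrite inE sa; apply/forallP => c; apply/implyP => sc.
apply/negP => /andP[nca ca].
have := amin c; rewrite /P sc (rle_trans ca ab) => /(_ isT).
move: ca => /andP[h1 h2] h3; move: nca; rewrite (@root_injq _ c a) ?eqxx //; lia.
Qed.

(** Distinct minimal roots are incomparable, hence neither edge contains the other and both ends
    increase; this is the hypothesis of [matching_lex]. *)
Lemma min_roots_anti a b : a \in min_roots -> b \in min_roots -> (ra a <= ra b)%N ->
  a != b -> (ra a < ra b)%N /\ (rb a < rb b)%N.
Proof.
clear m_l0 m_min cl; rewrite !inE => /andP[sa /forallP ha] /andP[sb /forallP hb] hab ab.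
have := hb a; rewrite sa /= /rlt ab /= rle_rb hab /= -ltnNge => lab; split=> //.
rewrite ltn_neqAle hab andbT; apply/negP => /eqP e.
have := ha b; rewrite sb /= /rlt eq_sym ab /= rle_rb -e leqnn /= -ltnNge; lia.
Qed.

Lemma msum_below i j : (forall l : 'I_n, (i <= l <= j)%N -> (l < l0)%N) -> msum m i j = 0%N.
Proof. by move=> h; rewrite /msum big1 // => l /h /m_min. Qed.

Lemma msum_above i j : (i <= l0 <= j)%N -> (msum m l0.+1 j < msum m i j)%N.
Proof.
move=> /andP[h1 h2]; rewrite /msum [X in (_ < X)%N](bigD1 l0) ?h1 ?h2 //=.
rewrite -add1n leq_add // big_mkcond [X in (_ <= X)%N]big_mkcond leq_sum // => l _.
case: ifP => // /andP[h3 h4]; rewrite h4 (leq_trans h1 (ltnW h3)) /=.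
by rewrite -val_eqE /= gtn_eqF.
Qed.

Lemma straddles_low b : (rq b < l0)%N -> s b = 0%N.
Proof.
move=> bl; have := cl (a := b) (p := [::]) (i := ra b) (j := rq b) isT (leqnn _).
rewrite /= leqnn => /(_ isT); rewrite big_seq1 msum_below ?leqn0 => [/eqP //|l].
by move=> /andP[_]; lia.
Qed.

(** The bound drops, by one, only if i <= l0 <= j. If the chain contains a minimal root, its sum
    drops as well; if not, the original inequality has to be strict. *)
Lemma chain_lattice_dec : chain_lattice dec_weight (fun a => s a - (a \in min_roots))%N.
Proof.
move=> a p i j ap ia lj; have [uC nC bC] := rlt_path_mem ap.
have leS : (\sum_(b <- a :: p) (s b - (b \in min_roots)) <= \sum_(b <- a :: p) s b)%N.
  by apply: leq_sum => b _; exact: leq_subr.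
have := msum_dec i j; have [hl|hl] := boolP (i <= l0 <= j)%N; last first.
  by rewrite addn0 => <-; apply: leq_trans leS _; exact: cl.
rewrite addn1 => e; rewrite -ltnS -e.
have [/hasP[c cC cM]|hM] := boolP (has (mem min_roots) (a :: p)).
  apply: leq_trans (cl ap ia lj); rewrite (big_rem c) //= [X in (_ < X)%N](big_rem c) //=.
  rewrite -addSn leq_add //; last by apply: leq_sum => b _; exact: leq_subr.
  move: cM => /= cM; rewrite cM; move: cM; rewrite inE => /andP[/and3P[h _ _] _]; lia.
apply: leq_ltn_trans leS _.
set C := [seq b <- a :: p | (0 < s b)%N].
have -> : (\sum_(b <- a :: p) s b = \sum_(b <- C) s b)%N.
  rewrite big_filter [RHS]big_mkcond; apply: eq_bigr => b _.
  by case: ltnP => //; rewrite leqn0 => /eqP.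
have srt : sorted (@rlt n) C by apply: sorted_filter => //; exact: rlt_trans.
have CE b : b \in C -> [/\ b \in a :: p, (0 < s b)%N & (l0 <= rq b)%N].
  rewrite mem_filter => /andP[h1 h2]; split=> //; rewrite leqNgt.
  by apply/negP => /straddles_low h3; rewrite h3 in h1.
have Cj b : b \in C -> (rq b <= j)%N || (n <= j.+1)%N.
  case/CE=> /bC /andP[_ /andP[_ h]] _ _; case/orP: lj => [lj|->]; last by rewrite orbT.
  by rewrite (leq_trans h lj).
(* A chain supported beyond l0 already obeys the bound from l0 + 1 on, which is smaller because m l0
   > 0. *)
have Clow : (forall b, b \in C -> (l0 < ra b)%N) -> (\sum_(b <- C) s b < msum m i j)%N.
  move=> h; apply: leq_ltn_trans (msum_above hl).
  exact: chain_lattice_sorted.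
case eC : C => [|r C'] in srt CE Cj Clow *; first by apply: Clow.
have [rl|rl] := leqP (ra r) l0; last first.
  apply: Clow => b; have := rlt_path_mem srt => -[_ _ h] /h /andP[/andP[h1 _] _].
  exact: leq_trans h1.
have [rC r0 lr] := CE _ (mem_head _ _).
have [r' r'M r'r] : exists2 r', r' \in min_roots & rle r' r.
  by apply: min_roots_ex; rewrite /straddles r0 rl.
have nr : r' != r.
  by apply: contraNneq hM => e'; apply/hasP; exists r => //=; rewrite -e'.
(* Prepending the minimal root r' gives a longer chain. Its bound is the same since m vanishes below
   l0, and r' contributes at least 1, whence strictness. *)
have : (\sum_(b <- r' :: r :: C') s b <= msum m 0 j)%N.
  apply: chain_lattice_sorted => //; first by rewrite /= /rlt nr r'r.
  move=> b; rewrite inE => /orP[/eqP ->|/Cj //].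
  have := Cj _ (mem_head _ _); case/orP=> [h|->]; last by rewrite orbT.
  by move: r'r => /andP[_ h']; rewrite (leq_trans h' h).
have s_r' : (0 < s r')%N by move: r'M; rewrite inE => /andP[/andP[]].
suff -> : msum m i j = msum m 0 j.
  by apply: leq_trans; rewrite [X in (_ < X)%N]big_cons -add1n leq_add.
rewrite /msum big_mkcond [RHS]big_mkcond; apply: eq_bigr => l _ /=.
case: (l <= j)%N; rewrite ?andbF //= andbT; case: leqP => // li.
by rewrite m_min //; move: hl => /andP[h1 _]; exact: leq_trans h1.
Qed.

End Decomposition.

(** * Leading monomials of minors *)

Section EdgeMatchings.
Variables (n d : nat) (A : {set 'I_d}) (c : 'I_d -> nat).
Hypothesis kc : forall k : 'I_d, k \in A -> (k <= c k)%N.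
Hypothesis c_low : forall k : 'I_d, k \in A -> ((k + c k).+1 < n + n)%N.
Hypothesis c_incr : forall k k' : 'I_d, k \in A -> k' \in A -> (k < k')%N -> (c k < c k')%N.
Implicit Types (a : posroot n) (sg : {perm 'I_d}).

Definition is_edge a (x y : nat) :=
  (ra a == x) && (rb a == y) || (ra a == y) && (rb a == x).

(** The exponent of the variable a in the term of sg when a minor of a generic symmetric matrix,
    with rows c k and columns k for k in A, is expanded. *)
Definition matching_count sg a := (\sum_(k in A) is_edge a (c k) (sg k))%N.

Lemma is_edge_inj a b x y : is_edge a x y -> is_edge b x y -> a = b.
Proof.
have [_ ha _ _ _] := rootP a; have [_ hb _ _ _] := rootP b.
move=> /orP[] /andP[/eqP h1 /eqP h2] /orP[] /andP[/eqP h3 /eqP h4];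
  apply: root_inj; lia.
Qed.

(** Let k be the first row moved. Every edge that sg assigns to rows from k on has both ends at
    least k and comes after {k, c k} for [key2], and the identity does use the edge {k, c k}. *)
Lemma matching_lex sg : (forall k, k \notin A -> sg k = k) ->
  sg = 1%g \/ lexlt (@key2 n) (matching_count sg) (matching_count 1).
Proof.
move=> fixA; have [/forallP h|] := boolP [forall k, sg k == k].
  by left; apply/permP => k; rewrite perm1; apply/eqP.
rewrite negb_forall => /existsP[k0 hk0]; right.
case: (@arg_minnP _ k0 (fun k => sg k != k) val hk0) => k sgk kmin.
have kA : k \in A by apply: contraTT sgk => /fixA ->; rewrite eqxx.
have fixk (j : 'I_d) : (j < k)%N -> sg j = j.
  by move=> jk; apply/eqP; apply: contraLR jk => /kmin; rewrite -leqNgt.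
have sg_ge (j : 'I_d) : (k <= j)%N -> (k <= sg j)%N.
  move=> kj; rewrite leqNgt; apply/negP => h.
  have /perm_inj e := fixk _ h; by rewrite e ltnNge kj in h.
have [e [e1 e2]] := root_ex (kc kA) (c_low kA).
have bigkey (j i : 'I_d) a : j \in A -> (k <= j)%N -> (k <= i)%N -> ~~ ((j == k) && (i == k)) ->
    is_edge a (c j) i -> (key2 e < key2 a)%N.
  move=> jA kj ki nk ea; have ckj : (c k <= c j)%N.
    move: kj; rewrite leq_eqVlt => /orP[/eqP/val_inj -> //|/c_incr h].
    by apply/ltnW/h.
  have nk' : (k < j)%N /\ (c k < c j)%N \/ (k < i)%N.
    move: kj ki; rewrite leq_eqVlt => /orP[/eqP/val_inj ej|kj]; last by left; split=> //; exact: c_incr.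
    rewrite leq_eqVlt => /orP[/eqP/val_inj ei|]; last by right.
    by rewrite -ej -ei eqxx in nk.
  have := kc kA; rewrite key2_lt e1 e2; have [_ ha _ _ _] := rootP a; clear - ea ha nk' ckj kj ki.
  move=> kck; case: ltngtP => //= h; case/orP: ea => /andP[/eqP h1 /eqP h2]; lia.
have restr a sg' : (key2 a <= key2 e)%N -> (forall j : 'I_d, (j < k)%N -> sg' j = j) ->
    (forall j : 'I_d, (k <= j)%N -> (k <= sg' j)%N) ->
    matching_count sg' a = (\sum_(j in A | (j < k)%N) is_edge a (c j) j
      + ((sg' k == k) && is_edge a (c k) k))%N.
  move=> ka fx ge; rewrite /matching_count (bigID (fun j : 'I_d => (j < k)%N)) /=.
  congr (_ + _)%N; first by apply: eq_bigr => j /andP[_ /fx ->].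
  rewrite (bigD1 k) /= ?kA ?ltnn // big1 ?addn0 => [|j /andP[/andP[jA]]]; last first.
    rewrite -leqNgt => kj jk; apply/eqP; rewrite eqb0; apply/negP => ea.
    have := bigkey j (sg' j) a jA kj (ge _ kj).
    by rewrite (negPf jk) => /(_ isT ea); rewrite ltnNge ka.
  case: eqP => [->|/eqP nk] //; apply/eqP; rewrite eqb0; apply/negP => ea.
  have := bigkey k (sg' k) a kA (leqnn _) (ge _ (leqnn _)).
  by rewrite (negPf nk) andbF => /(_ isT ea); rewrite ltnNge ka.
have ek : is_edge e (c k) k by rewrite /is_edge e1 e2 !eqxx orbT.
have one_fix (j : 'I_d) : (1%g : {perm 'I_d}) j = j by rewrite perm1.
have one_ge (j : 'I_d) : (k <= j)%N -> (k <= (1%g : {perm 'I_d}) j)%N by rewrite perm1.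
apply/lexltP; exists e; split.
  by rewrite !restr // perm1 eqxx ek (negPf sgk) addn0 addn1.
move=> a ka; rewrite !restr ?(ltnW ka) //.
have -> : is_edge a (c k) k = false.
  by apply/negP => /is_edge_inj /(_ ek) ea; rewrite ea ltnn in ka.
by rewrite !andbF.
Qed.

End EdgeMatchings.

Section AlternatingTensors.
Variables (K : numClosedFieldType) (n : nat) (l0 : 'I_n).
Let d := l0.+1.
Let I := 'I_(n + n).
Let X := {ffun 'I_d -> I}.
Implicit Types (a : X) (k l : 'I_d) (r : posroot n) (w : seq (posroot n)).
Implicit Types (M N : 'M[K]_(n + n)) (G : 'I_d -> 'M[K]_(n + n)) (f : X -> K).

Definition hcol (l : 'I_d) : I := lshift n (widen_ord (ltn_ord l0) l).

Lemma pos_hcol l : pos (hcol l) = ((n + n).-1 - l)%N.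
Proof. by rewrite pos_lshift. Qed.

Definition upd a k (j : I) : X := [ffun k' => if k' == k then j else a k'].

Lemma upd_same a k j : upd a k j k = j. Proof. by rewrite ffunE eqxx. Qed.
Lemma upd_other a k j k' : k' != k -> upd a k j k' = a k'.
Proof. by rewrite ffunE => /negPf ->. Qed.

(* For G = 1 this is e_1 /\ .. /\ e_d as a tensor; the general form is closed
   under the action of gl_2n. *)
Definition minor_tensor G a : K := \det (\matrix_(k, l) G k (a k) (hcol l)).

(** The derivation action of M on the d-th tensor power of the standard module, a tensor being the
    function of its coordinates. *)
Definition xop M f a : K := \sum_k \sum_j M (a k) j * f (upd a k j).

Definition setG G k N : 'I_d -> 'M[K]_(n + n) := fun k' => if k' == k then N else G k'.

Lemma DtE G a : minor_tensor G a = \sum_(s : 'S_d) (-1) ^+ s * \prod_k G k (a k) (hcol (s k)).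
Proof.
rewrite /minor_tensor /determinant; apply: eq_bigr => s _; congr (_ * _).
by apply: eq_bigr => k _; rewrite mxE.
Qed.

Lemma eq_Dt G G' a : (forall k, G k = G' k) -> minor_tensor G a = minor_tensor G' a.
Proof. by move=> e; rewrite !DtE; apply: eq_bigr => s _; congr (_ * _); apply: eq_bigr => k _; rewrite e. Qed.

Lemma xop_Dt M G a : xop M (minor_tensor G) a = \sum_k minor_tensor (setG G k (M *m G k)) a.
Proof.
apply: eq_bigr => k _; rewrite DtE.
under eq_bigr do rewrite DtE mulr_sumr.
rewrite exchange_big; apply: eq_bigr => s _ /=.
under eq_bigr do rewrite mulrCA.
rewrite -mulr_sumr; congr (_ * _).
rewrite [RHS](bigD1 k) //= /setG eqxx mxE mulr_suml.
apply: eq_bigr => j _; rewrite (bigD1 k) //= upd_same mulrA; congr (_ * _).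
by apply: eq_bigr => k' kk'; rewrite (negPf kk') upd_other.
Qed.

Definition Fr r : 'M[K]_(n + n) := spgen K n (ra r) (rb r).
Definition xact w f : X -> K := foldr (fun r => xop (Fr r)) f w.

Lemma xop_sum M (J : Type) (s : seq J) (P : pred J) (g : J -> X -> K) a :
  xop M (fun a => \sum_(i <- s | P i) g i a) a = \sum_(i <- s | P i) xop M (g i) a.
Proof.
rewrite /xop [RHS]exchange_big; apply: eq_bigr => k _.
by rewrite [RHS]exchange_big; apply: eq_bigr => j _; rewrite mulr_sumr.
Qed.

Lemma xact_sum w (J : Type) (s : seq J) (P : pred J) (g : J -> X -> K) a :
  xact w (fun a => \sum_(i <- s | P i) g i a) a = \sum_(i <- s | P i) xact w (g i) a.
Proof.
elim: w a => [|r w IH] a //=.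
by rewrite -xop_sum; congr (xop _ _ a); apply/funext => a'; exact: IH.
Qed.

Lemma xact_rcons w r G a :
  xact (rcons w r) (minor_tensor G) a = \sum_k xact w (minor_tensor (setG G k (Fr r *m G k))) a.
Proof.
rewrite -xact_sum /xact -cats1 foldr_cat /=; congr (foldr _ _ w a).
by apply/funext => a'; rewrite xop_Dt.
Qed.

Lemma F_entry p q (i j : I) : spgen K n p q i j =
  om K n q (pos j) * (pos i == p)%:R + om K n p (pos j) * (pos i == q)%:R.
Proof.
have := congr1 (fun C : 'cV_(n + n) => C i 0) (@F_evec n K p q (pos j)).
by rewrite [in LHS]evec_delta -colE !mxE.
Qed.

Lemma F_entry_neq0 p q (i j : I) : spgen K n p q i j != 0 ->
  (pos i = p /\ (q + pos j).+1 = n + n)%N \/ (pos i = q /\ (p + pos j).+1 = n + n)%N.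
Proof.
rewrite F_entry /om.
have [/andP[/eqP h1 /eqP h2] _|h1] := boolP ((pos i == p) && ((q + pos j).+1 == n + n)%N).
  by left.
have [/andP[/eqP h3 /eqP h4] _|h2] := boolP ((pos i == q) && ((p + pos j).+1 == n + n)%N).
  by right.
move: h1 h2; rewrite !negb_and => /orP[] /negPf -> /orP[] /negPf ->;
  by rewrite ?mulr0 ?mul0r ?addr0 ?add0r ?mulr0 eqxx.
Qed.

Lemma Fr_entry_edge r i j : Fr r i j != 0 -> is_edge r (pos i) ((n + n).-1 - pos j).
Proof.
move/F_entry_neq0; rewrite /is_edge; case=> -[-> h]; apply/orP; [left|right];
  rewrite eqxx ?andbT /=; apply/eqP; lia.
Qed.

Lemma edge_Fr_entry r i j : is_edge r (pos i) ((n + n).-1 - pos j) -> Fr r i j != 0.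
Proof.
have jn := pos_lt j.
move=> h; rewrite /Fr F_entry /om.
have hs x : ((x + pos j).+1 == n + n)%N = (x == (n + n).-1 - pos j)%N by lia.
rewrite !hs; have s0 x : (if (x < n)%N then -1 else 1) != 0 :> K.
  by case: ifP; rewrite ?oppr_eq0 oner_eq0.
move: h; rewrite /is_edge; set x := pos i; set y := (_ - _)%N.
have [->|ne] := eqVneq (ra r) (rb r) => h.
  have [-> ->] : rb r = x /\ y = x.
    by case/orP: h => /andP[/eqP <- /eqP <-].
  by rewrite eqxx !mulr1 -mulr2n -mulr_natr mulf_neq0 ?pnatr_eq0.
case/orP: h => /andP[/eqP h1 /eqP h2]; rewrite h1 h2 in ne *; rewrite !eqxx.
  by rewrite (negPf ne) mulr1 mul0r addr0.
by rewrite [x == y]eq_sym (negPf ne) mulr1 mul0r add0r.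
Qed.

Lemma Dt_row0 G a k : (forall l, G k (a k) (hcol l) = 0) -> minor_tensor G a = 0.
Proof.
move=> h; rewrite DtE big1 // => s _.
by rewrite (bigD1 k) //= h mul0r mulr0.
Qed.

(** Each letter changes one row of the determinant, so some row in B stays untouched, and such a row
    is zero. *)
Lemma xact_few w G (B : {set 'I_d}) a : (forall k, k \in B -> forall l, a k != hcol l) ->
  (forall k, k \in B -> G k = 1%:M) -> (size w < #|B|)%N -> xact w (minor_tensor G) a = 0.
Proof.
elim/last_ind: w G B => [|w r IH] G B hB hG.
  case/card_gt0P=> k kB; rewrite /=; apply: (Dt_row0 (k := k)) => l.
  by rewrite hG // mxE (negPf (hB _ kB l)).
rewrite size_rcons xact_rcons => sz; rewrite big1 // => k _.
apply: (IH _ (B :\ k)) => [k'|k'|].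
- by rewrite !inE => /andP[_]; exact: hB.
- by rewrite !inE /setG => /andP[/negPf -> ]; exact: hG.
- by move: sz; rewrite (cardsD1 k B); case: (k \in B); rewrite ?add1n ?add0n ?ltnS // => /ltnW.
Qed.

Section Matching.
Variables (A : {set 'I_d}) (c : 'I_d -> nat) (e : 'I_d -> posroot n) (b : X).
Hypothesis kc : forall k : 'I_d, k \in A -> (k <= c k)%N.
Hypothesis c_low : forall k : 'I_d, k \in A -> ((k + c k).+1 < n + n)%N.
Hypothesis c_incr : forall k k' : 'I_d, k \in A -> k' \in A -> (k < k')%N -> (c k < c k')%N.
Hypothesis c_out : forall k : 'I_d, k \in A -> ((c k + l0).+1 < n + n)%N.
Hypothesis eE : forall k, k \in A -> is_edge (e k) (c k) k.
Hypothesis bA : forall k, k \in A -> pos (b k) = c k.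
Hypothesis bN : forall k, k \notin A -> b k = hcol k.

Lemma b_out k : k \in A -> forall l, b k != hcol l.
Proof.
move=> kA l; apply/eqP => /(congr1 (@pos n)); rewrite bA // pos_hcol.
by have := c_out kA; have := ltn_ord l; rewrite /d; lia.
Qed.

Lemma hcol_bar l : ((n + n).-1 - pos (hcol l))%N = l.
Proof. by rewrite pos_hcol; have := ltn_ord l; have := ltn_ord l0; rewrite /d; lia. Qed.

Lemma hcol_inj : injective hcol.
Proof. by move=> l l' e'; apply: val_inj; rewrite /= -(hcol_bar l) e' hcol_bar. Qed.

(** By [xact_few] the letters have to hit each row of B once; rr records the letters already placed.
    A nonzero term of the resulting determinant is a permutation sg for which the letter in row k is
    the edge {c k, sg k}. *)
Lemma xact_exact w G (B : {set 'I_d}) (rr : 'I_d -> posroot n) : B \subset A ->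
  (forall k, (k \in B) || (k \notin A) -> G k = 1%:M) ->
  (forall k, k \in A -> k \notin B -> G k = Fr (rr k)) ->
  size w = #|B| -> xact w (minor_tensor G) b != 0 ->
  exists sg : {perm 'I_d}, [/\ forall k, k \notin A -> sg k = k,
    forall k, k \in A -> k \notin B -> is_edge (rr k) (c k) (sg k) &
    forall r, (count_mem r w + \sum_(k in A :\: B) (rr k == r) = matching_count A c sg r)%N].
Proof.
elim/last_ind: w G B rr => [|w r IH] G B rr BA G1 GF.
  move=> /esym/eqP; rewrite cards_eq0 => /eqP B0; subst B.
  rewrite /= DtE => nz.
  have [s hs] : exists s : 'S_d, \prod_k G k (b k) (hcol (s k)) != 0.
    apply: contrapT => h; move/eqP: nz; apply; rewrite big1 // => s _.
    have [->|hs] := eqVneq (\prod_k G k (b k) (hcol (s k))) 0; first by rewrite mulr0.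
    by case: h; exists s.
  have ent k : G k (b k) (hcol (s k)) != 0.
    by apply: contraNneq hs => h; rewrite (bigD1 k) //= h mul0r.
  have edge k : k \in A -> is_edge (rr k) (c k) (s k).
    move=> kA; have := ent k; rewrite GF ?inE // => /Fr_entry_edge.
    by rewrite bA // hcol_bar.
  exists s; split=> [k kA|k kA _|r].
  - have := ent k; rewrite G1 ?kA ?orbT // bN // mxE.
    by case: (hcol k =P _) => [/hcol_inj //|_]; rewrite eqxx.
  - exact: edge.
  - rewrite add0n finset.setD0; apply: eq_bigr => k kA; congr nat_of_bool.
    apply/eqP/idP => [<-|h]; [exact: edge|exact: is_edge_inj (edge _ kA) h].
rewrite size_rcons xact_rcons => sz nz.
have [k hk] : exists k, xact w (minor_tensor (setG G k (Fr r *m G k))) b != 0.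
  apply: contrapT => h; move/eqP: nz; apply; rewrite big1 // => k _.
  by apply/eqP; apply: contrapT => hk; apply: h; exists k; apply/negP.
have kB : k \in B.
  apply: contraNT hk => kB; apply/eqP; apply: (xact_few (B := B)); last by rewrite -sz.
    by move=> k' /(fintype.subsetP BA); exact: b_out.
  by move=> k' k'B; rewrite /setG; case: eqP k'B => [->|_ h]; rewrite ?(negPf kB) // G1 ?h.
have kA : k \in A by exact: (fintype.subsetP BA).
pose rr' k' := if k' == k then r else rr k'.
have [|k' h|k' k'A k'B||sg [s1 s2 s3]] := IH _ (B :\ k) rr' _ _ _ _ hk.
- by apply: fintype.subset_trans BA; exact: subD1set.
- rewrite /setG; case: eqP h => [->|nk]; rewrite ?inE ?eqxx ?kA //= => h.
  by apply: G1; case/orP: h => [/andP[_ ->]|->]; rewrite ?orbT.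
- rewrite /setG /rr'; case: eqP k'B => [_ _|/eqP nk]; first by rewrite G1 ?kB // mulmx1.
  by rewrite !inE nk /=; exact: GF.
- by move: sz; rewrite (cardsD1 k B) kB add1n => -[].
exists sg; split=> [//|k' k'A k'B|r'].
  have := s2 k' k'A; rewrite /rr' !inE (negPf k'B) andbF => /(_ isT).
  have [ek|//] := eqVneq k' k; by rewrite ek kB in k'B.
rewrite -s3 -cats1 count_cat /= addn0 -addnA; congr (_ + _)%N.
rewrite [RHS](bigD1 k) /=; last by rewrite !inE eqxx kA.
rewrite /rr' eqxx; congr (_ + _)%N; apply: eq_big => k'.
  rewrite !inE; case: (k' =P k) => [->|]; rewrite ?kB ?andbF ?andbT //.
rewrite !inE => /andP[k'B _]; have [ek|//] := eqVneq k' k.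
by rewrite ek kB in k'B.
Qed.

Lemma matching1 r : matching_count A c 1 r = (\sum_(k in A) (e k == r))%N.
Proof.
apply: eq_bigr => k kA; rewrite perm1; congr nat_of_bool.
by apply/idP/eqP => [h|<-]; [exact: is_edge_inj (eE kA) h|exact: eE].
Qed.

Definition xconst : K := minor_tensor (fun k => if k \in A then Fr (e k) else 1%:M) b.

(** A nonzero term of a permutation s makes every e k an edge {c k, s k}, so s has the same content
    as the identity; by [matching_lex] it is the identity. *)
Lemma xconst_neq0 : xconst != 0.
Proof.
rewrite /xconst DtE (bigD1 1%g) //= odd_perm1 expr0 mul1r [X in _ + X]big1 ?addr0.
  apply/prodf_neq0 => k _; rewrite perm1; case: ifP => kA.
    by apply: edge_Fr_entry; rewrite bA // hcol_bar; exact: eE.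
  by rewrite bN ?kA // mxE eqxx oner_eq0.
move=> s s1; set P := \prod_k _.
have [->|hs] := eqVneq P 0; first by rewrite mulr0.
have ent k : (if k \in A then Fr (e k) else 1%:M) (b k) (hcol (s k)) != 0.
  by apply: contraNneq hs => h; rewrite /P (bigD1 k) //= h mul0r.
have fixA k : k \notin A -> s k = k.
  move=> kA; have := ent k; rewrite (negPf kA) bN // mxE.
  by case: (hcol k =P _) => [/hcol_inj //|_]; rewrite eqxx.
have [e1|] := matching_lex kc c_low c_incr fixA; first by rewrite e1 eqxx in s1.
have -> : @matching_count n d A c s = matching_count A c 1%g; last by rewrite lexlt_irr.
apply: funext => r; rewrite matching1; apply: eq_bigr => k kA; congr nat_of_bool.
have ek : is_edge (e k) (c k) (s k).
  by have := ent k; rewrite kA => /Fr_entry_edge; rewrite bA // hcol_bar.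
by apply/idP/eqP => [h|<- //]; exact: is_edge_inj ek h.
Qed.

(** Whatever the order of w, only the placement of each letter e k in its own row k contributes: any
    other placement would again give the content of the identity matching. *)
Lemma xact_const w G (B : {set 'I_d}) : B \subset A ->
  (forall k, G k = if (k \in A) && (k \notin B) then Fr (e k) else 1%:M) ->
  (forall r, count_mem r w = \sum_(k in B) (e k == r))%N ->
  xact w (minor_tensor G) b = xconst.
Proof.
elim/last_ind: w G B => [|w r IH] G B BA GE cw.
  have B0 k : k \notin B.
    apply/negP => kB; have := cw (e k); rewrite (bigD1 k) //= eqxx.
    by move=> h; have : (0 < 0)%N by rewrite {2}h.
  by rewrite /=; apply: eq_Dt => k; rewrite GE B0 andbT.
have szw : size w = #|B|.-1.
  have : size (rcons w r) = #|B|; last by rewrite size_rcons => <-.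
  rewrite -sum1_size (sum_count_mem (fun=> 1%N)).
  under eq_bigr do rewrite muln1 cw.
  rewrite exchange_big -sum1_card; apply: eq_bigr => k kB /=.
  by rewrite (bigD1 (e k)) //= eqxx big1 // => r' /negPf; rewrite eq_sym => ->.
have [k0 k0B ek0] : exists2 k, k \in B & e k = r.
  have : (0 < count_mem r (rcons w r))%N by rewrite -cats1 count_cat /= eqxx addn1.
  rewrite cw lt0n => /eqP h; apply: contrapT => h'; apply: h.
  by rewrite big1 // => k kB; case: eqP => // ek; case: h'; exists k.
have cardB : (#|B|.-1 = #|B :\ k0|)%N by rewrite (cardsD1 k0 B) k0B.
have e_inj k k' : k \in A -> k' \in A -> e k = e k' -> k = k'.
  move=> kA k'A ee; have := eE kA; have := eE k'A; rewrite ee /is_edge.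
  have := kc kA; have := kc k'A; clear => h1 h2.
  by move=> /orP[] /andP[/eqP h3 /eqP h4] /orP[] /andP[/eqP h5 /eqP h6]; apply: val_inj => /=; lia.
rewrite xact_rcons (bigD1 k0) //= (IH _ (B :\ k0)).
- rewrite big1 ?addr0 // => k kk0.
  have [kB|kB] := boolP (k \in B); last first.
    apply: (xact_few (B := B)).
    + by move=> k' /(fintype.subsetP BA); exact: b_out.
    + move=> k' k'B; rewrite /setG; case: eqP k'B => [->|_ h]; rewrite ?(negPf kB) //.
      by rewrite GE h andbF.
    + by rewrite szw (cardsD1 k0 B) k0B.
  have kA := fintype.subsetP BA _ kB; have k0A := fintype.subsetP BA _ k0B.
  apply/eqP; apply: contrapT => /negP nz.
  pose rr k' := if k' == k then r else e k'.
  have [|k' h|k' k'A k'B||sg [s1 s2 s3]] := xact_exact (B := B :\ k) (rr := rr) _ _ _ _ nz.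
  + by apply: fintype.subset_trans BA; exact: subD1set.
  + rewrite /setG; case: eqP h => [->|nk]; rewrite ?inE ?eqxx ?kA //= => h.
    by rewrite GE; case/orP: h => [/andP[_ ->]|/negPf ->]; rewrite ?andbF.
  + rewrite /setG /rr; case: eqP k'B => [_ _|/eqP nk]; first by rewrite GE kB andbF mulmx1.
    by rewrite !inE nk /= GE k'A => ->.
  + by rewrite szw (cardsD1 k B) kB.
  have [sg1|] := matching_lex kc c_low c_incr s1.
    have := s2 k kA; rewrite !inE eqxx /= => /(_ isT).
    rewrite /rr eqxx sg1 perm1 -ek0 => /(is_edge_inj (eE kA)) /(e_inj _ _ kA k0A) ekk0.
    by rewrite ekk0 eqxx in kk0.
  have -> : @matching_count n d A c sg = matching_count A c 1%g; last by rewrite lexlt_irr.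
  apply: funext => r'; rewrite -s3 matching1 [RHS](big_setID B) /=.
  rewrite (finset.setIidPr BA) -cw -cats1 count_cat /= addn0 -addnA; congr (_ + _)%N.
  rewrite (bigD1 k) /=; last by rewrite !inE eqxx kA.
  rewrite /rr eqxx; congr (_ + _)%N; apply: eq_big => k'.
    by rewrite !inE; case: (k' =P k) => [->|]; rewrite ?kB ?andbF ?andbT.
  by rewrite !inE => /andP[_ /negPf ->].
- by apply: fintype.subset_trans BA; exact: subD1set.
- move=> k; rewrite /setG !inE; case: (k =P k0) => [->|_] /=; last exact: GE.
  by rewrite GE k0B andbF mulmx1 (fintype.subsetP BA) // ek0.
- move=> r'; have := cw r'; rewrite -cats1 count_cat /= addn0 (bigD1 k0) //= ek0 addnC => /addnI ->.
  by apply: eq_bigl => k; rewrite !inE andbC.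
Qed.

End Matching.

End AlternatingTensors.

Section HighestWedge.
Variables (K : numClosedFieldType) (n : nat) (l0 : 'I_n).
Local Notation d := (nat_of_ord l0).+1.
Local Notation I := 'I_(n + n).
Local Notation X := {ffun 'I_d -> I}.
Implicit Types (a : X) (k l : 'I_d) (r : posroot n) (M : 'M[K]_(n + n)).

Definition top_tensor : X -> K := minor_tensor (fun=> 1%:M).

(** The derivative of a determinant: replacing one row at a time and summing gives tr (P M' adj P) =
    tr M' det P. *)
Lemma xop_trace M a : (forall i l, M i (hcol l) != 0 -> exists l' : 'I_d, i = hcol l') ->
  xop M top_tensor a = (\sum_(l < d) M (hcol l) (hcol l)) * top_tensor a.
Proof.
move=> stab; rewrite /top_tensor xop_Dt.
pose P : 'M[K]_d := \matrix_(k < d, l < d) (1%:M : 'M[K]_(n + n)) (a k) (hcol l).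
pose M' : 'M[K]_d := \matrix_(l < d, l' < d) M (hcol l) (hcol l').
have -> : minor_tensor (fun=> 1%:M) a = \det P by [].
have -> : \sum_(l < d) M (hcol l) (hcol l) = \tr M' by apply: eq_bigr => l _; rewrite mxE.
have rowE k l : M (a k) (hcol l) = (P *m M') k l.
  rewrite mxE; have [[l' al']|nl] := EM (exists l' : 'I_d, a k = hcol l').
    rewrite (bigD1 l') //= big1 ?addr0 => [|l'' ll'']; rewrite !mxE al' ?eqxx ?mul1r //.
    by rewrite (inj_eq (@hcol_inj n l0)) eq_sym (negPf ll'') mul0r.
  rewrite big1 => [|l' _]; last first.
    by rewrite !mxE; case: eqP => [e|_]; [case: nl; exists l'|rewrite mul0r].
  have [//|/stab [l' e]] := eqVneq (M (a k) (hcol l)) 0.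
  by case: nl; exists l'.
have DtE' k : minor_tensor (setG (fun=> 1%:M) k (M *m 1%:M)) a = (P *m M' *m \adj P) k k.
  rewrite [RHS]mxE /minor_tensor (expand_det_row _ k); apply: eq_bigr => l _.
  rewrite !mxE /setG eqxx mulmx1 rowE mxE; congr (_ * _).
  rewrite /cofactor; congr (_ * \det _); apply/matrixP => i j; rewrite !mxE /setG.
  have /negPf -> : lift k i != k by rewrite eq_sym neq_lift.
  by rewrite !mxE.
rewrite (eq_bigr _ (fun k _ => DtE' k)) -/(mxtrace _) -mulmxA mxtrace_mulC.
by rewrite -mulmxA mul_adj_mx mul_mx_scalar mxtraceZ mulrC.
Qed.

Lemma xop_raise p q a : (n + n <= p + q)%N -> xop (spgen K n p q) top_tensor a = 0.
Proof.
move=> pq; have E i l : spgen K n p q i (hcol l) != 0 -> (n + n <= pos i + l)%N.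
  by move/F_entry_neq0; have := ltn_ord l; have := ltn_ord l0; rewrite pos_hcol; lia.
rewrite xop_trace => [|i l /E h].
  rewrite big1 ?mul0r // => l _; apply/eqP; apply: contraT => /E.
  by rewrite pos_hcol; have := ltn_ord l; have := ltn_ord l0; lia.
have := pos_lt i => hi; have hl := ltn_ord l.
have il : ((n + n).-1 - pos i < d)%N by lia.
by exists (Ordinal il); apply: pos_inj; rewrite pos_hcol /=; lia.
Qed.

Lemma xop_cartan x a : xop (cartan x) top_tensor a = weval (fund_weight K l0) x * top_tensor a.
Proof.
have E i l : cartan x i (hcol l) = (i == hcol l)%:R * x 0 (widen_ord (ltn_ord l0) l).
  have := congr1 (fun C : 'cV_(n + n) => C i 0) (cartan_evec x (pos (hcol l))).
  rewrite evec_delta -colE mxE => ->.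
  rewrite !mxE eqxx andbT mulrC; congr (_ * _).
  have -> : wtv K n (pos (hcol l)) = - wtv K n l.
    by apply: wtv_bar; rewrite pos_hcol; have := ltn_ord l; have := ltn_ord l0; lia.
  rewrite wevalN opprK weval_wtv; first by have := ltn_ord l; have := ltn_ord l0; lia.
  by move=> h; congr (x 0 _); apply: val_inj.
rewrite xop_trace => [|i l]; last first.
  by rewrite E; case: (i =P hcol l) => [-> _|_]; [exists l|rewrite mul0r eqxx].
congr (_ * _); rewrite /weval.
under eq_bigr do rewrite E eqxx mul1r.
rewrite [RHS](eq_bigr (fun i : 'I_n => if (i < d)%N then x 0 i else 0)).
  by rewrite -big_mkcond (big_ord_narrow (ltn_ord l0)).
by move=> i _; rewrite mxE ltnS; case: ifP; rewrite ?mul1r ?mul0r.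
Qed.

(** Among the columns of the top tensor, r moves only the one of index ra r. Either it is absent, or
    its image is already one of the columns; in both cases their span is stable and the trace is
    zero. *)
Lemma xop_edge_root_out r j a : edge_root r j -> ~~ (ra r <= l0 <= j)%N ->
  xop (Fr K r) top_tensor a = 0.
Proof.
move=> er out; have [an ab abn aq qb] := rootP r; have ln := ltn_ord l0.
have E i l : Fr K r i (hcol l) != 0 -> l = ra r :> nat /\ pos i = rb r.
  move/(Fr_entry_edge l0); rewrite hcol_bar /is_edge => /orP[] /andP[/eqP h1 /eqP h2];
  have := ltn_ord l; case/orP: er => /andP[/eqP h3 h4]; lia.
rewrite xop_trace => [|i l /E [h1 h2]].
  rewrite big1 ?mul0r // => l _; apply/eqP; apply: contraT => /E.
  by rewrite pos_hcol; have := ltn_ord l; lia.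
have hl := ltn_ord l; have := h1.
case/orP: er => /andP[/eqP h3 h4] h5; first by lia.
have jl : (j.+1 < d)%N by lia.
by exists (Ordinal jl); apply: pos_inj; rewrite pos_hcol /=; lia.
Qed.

(** Two different rows changed by r would both need the single column ra r in a nonzero term;
    changing the same row twice gives the square of the matrix, which vanishes on these columns. *)
Lemma xop_edge_root_sq r j a : edge_root r j -> xop (Fr K r) (xop (Fr K r) top_tensor) a = 0.
Proof.
move=> er; have [an ab abn aq qb] := rootP r; have ln := ltn_ord l0.
have E i l : Fr K r i (hcol l) != 0 -> l = ra r :> nat /\ pos i = rb r.
  move/(Fr_entry_edge l0); rewrite hcol_bar /is_edge => /orP[] /andP[/eqP h1 /eqP h2];
  have := ltn_ord l; case/orP: er => /andP[/eqP h3 h4]; lia.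
have -> : xop (Fr K r) top_tensor = fun a => \sum_k minor_tensor (setG (fun=> 1%:M) k (Fr K r *m 1%:M)) a.
  by apply: funext => a'; rewrite /top_tensor xop_Dt.
rewrite xop_sum big1 // => k _; rewrite xop_Dt big1 // => k' _.
have [->|kk'] := eqVneq k' k.
  apply: (Dt_row0 (k := k)) => l; rewrite /setG !eqxx mulmx1 mxE big1 // => t _.
  apply/eqP; apply: contraT; rewrite mulf_eq0 negb_or => /andP[/F_entry_neq0 h1 /E [h2 h3]].
  by move: h1; rewrite h3; lia.
rewrite DtE big1 // => s _; apply/eqP; rewrite mulf_eq0; apply/orP; right.
apply: contraT => h.
have ent i : setG (setG (fun=> 1%:M) k (Fr K r *m 1%:M)) k'
    (Fr K r *m setG (fun=> 1%:M) k (Fr K r *m 1%:M) k') i (a i) (hcol (s i)) != 0.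
  by apply: contraNneq h => h; rewrite (bigD1 i) //= h mul0r.
have [h1 _] : s k' = ra r :> nat /\ pos (a k') = rb r.
  by apply: E; have := ent k'; rewrite /setG eqxx (negPf kk') mulmx1.
have [h2 _] : s k = ra r :> nat /\ pos (a k) = rb r.
  by apply: E; have := ent k; rewrite /setG [k == k']eq_sym (negPf kk') eqxx mulmx1.
have /perm_inj e : s k = s k' by apply: val_inj; rewrite /= h1 h2.
by rewrite e eqxx in kk'.
Qed.

End HighestWedge.

(** * Tensor products with a contravariant form *)

Section GLModules.
Variables (K : numClosedFieldType) (n : nat).

Definition dagger (M : 'M[K]_(n + n)) : 'M[K]_(n + n) := \matrix_(i, j) (M j i)^*.

(** Working with all of gl_2n makes the adjoint simply the conjugate transpose; [dagger_F] shows
    that it preserves the lines of the [spgen p q]. *)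
Record gl_unitary (U : lmodType K) (A : 'M[K]_(n + n) -> U -> U) (form : U -> U -> K) : Prop := {
  gl_lin : forall M, linear_op (A M);
  gl_linl : forall c M N u, A (c *: M + N) u = c *: A M u + A N u;
  gl_bracket : forall M N u, A (bracket M N) u = A M (A N u) - A N (A M u);
  form_linl : forall c u1 u2 u, form (c *: u1 + u2) u = c * form u1 u + form u2 u;
  form_linr : forall c u1 u2 u, form u (c *: u1 + u2) = c^* * form u u1 + form u u2;
  form_ge0 : forall u, 0 <= form u u;
  form_def : forall u, form u u = 0 -> u = 0;
  form_adj : forall M u u', form (A M u) u' = form u (A (dagger M) u') }.

Lemma gl_sp_ops (U : lmodType K) A form : @gl_unitary U A form ->
  sp_ops n (fun p q => A (spgen K n p q)).
Proof.
move=> gl; have A0 u : A 0 u = 0.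
  by have := gl_linl gl (-1) 0 0 u; rewrite scaler0 addr0 scaleN1r addNr.
split=> [p q|p q u|p q r s u]; first exact: (gl_lin gl).
  by rewrite F_sym.
have AZ c M : A (c *: M) u = c *: A M u.
  by have := gl_linl gl c M 0 u; rewrite !addr0 A0 addr0.
have AD M N : A (M + N) u = A M u + A N u.
  by have := gl_linl gl 1 M N u; rewrite !scale1r.
rewrite -(gl_bracket gl) bracket_F.
move: (spgen K n p s) (spgen K n p r) (spgen K n q s) (spgen K n q r) => f1 f2 f3 f4.
by rewrite !AD !AZ.
Qed.

Variables (U : lmodType K) (A : 'M[K]_(n + n) -> U -> U) (form : U -> U -> K).
Hypothesis gl : gl_unitary A form.
Variable l0 : 'I_n.
Local Notation d := (nat_of_ord l0).+1.
Local Notation I := 'I_(n + n).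
Local Notation X := {ffun 'I_d -> I}.
Implicit Types (M N : 'M[K]_(n + n)) (a : X) (k : 'I_d).

Definition slot k M (g : X -> U) a : U := \sum_j M (a k) j *: g (upd a k j).
Definition tensA M (g : {ffun X -> U}) : {ffun X -> U} :=
  [ffun a => A M (g a) + \sum_k slot k M g a].
Definition tens_form (g g' : {ffun X -> U}) : K := \sum_a form (g a) (g' a).

Lemma upd_upd a k i j : upd (upd a k i) k j = upd a k j.
Proof. by apply/ffunP => k'; rewrite !ffunE; case: eqP. Qed.

Lemma upd_comm a k k' i j : k != k' -> upd (upd a k i) k' j = upd (upd a k' j) k i.
Proof.
move=> kk'; apply/ffunP => k''; rewrite !ffunE.
by case: eqP => [->|//]; rewrite eq_sym (negPf kk').
Qed.

Lemma upd_id a k : upd a k (a k) = a.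
Proof. by apply/ffunP => k'; rewrite ffunE; case: eqP => [->|]. Qed.

Lemma slot_comm k k' M N g a : k != k' ->
  slot k M (slot k' N g) a = slot k' N (slot k M g) a.
Proof.
move=> kk'; rewrite /slot; under eq_bigr do rewrite scaler_sumr.
under [RHS]eq_bigr do rewrite scaler_sumr.
rewrite exchange_big; apply: eq_bigr => j _; apply: eq_bigr => i _.
rewrite !scalerA upd_other 1?eq_sym // upd_other // (upd_comm _ _ _ kk').
by rewrite mulrC.
Qed.

Lemma slot_mul k M N g a : slot k M (slot k N g) a = slot k (M *m N) g a.
Proof.
rewrite /slot; under eq_bigr do rewrite scaler_sumr.
rewrite exchange_big; apply: eq_bigr => j _ /=.
rewrite mxE scaler_suml; apply: eq_bigr => i _.
by rewrite scalerA upd_same upd_upd.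
Qed.

Lemma slot_linl k c M N g a : slot k (c *: M + N) g a = c *: slot k M g a + slot k N g a.
Proof.
rewrite /slot scaler_sumr -big_split; apply: eq_bigr => j _ /=.
by rewrite !mxE scalerDl scalerA.
Qed.

Lemma slot_sum k M (J : Type) (s : seq J) (P : pred J) (g : J -> X -> U) a :
  slot k M (fun a => \sum_(i <- s | P i) g i a) a = \sum_(i <- s | P i) slot k M (g i) a.
Proof.
rewrite /slot [RHS]exchange_big; apply: eq_bigr => j _.
by rewrite scaler_sumr.
Qed.

Lemma slotD k M (g g' : X -> U) a :
  slot k M (fun a => g a + g' a) a = slot k M g a + slot k M g' a.
Proof.
by rewrite /slot -big_split; apply: eq_bigr => j _; rewrite scalerDr.
Qed.

Lemma eq_slot k M (g g' : X -> U) a : g =1 g' -> slot k M g a = slot k M g' a.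
Proof. by move=> e; apply: eq_bigr => j _; rewrite e. Qed.

Lemma tensA_bracket M N g :
  tensA (bracket M N) g = tensA M (tensA N g) - tensA N (tensA M g).
Proof.
apply/ffunP => a.
have E M1 N1 : tensA M1 (tensA N1 g) a = A M1 (A N1 (g a))
    + (\sum_k slot k N1 (fun a => A M1 (g a)) a + \sum_k slot k M1 (fun a => A N1 (g a)) a)
    + \sum_k \sum_k' slot k M1 (slot k' N1 g) a.
  rewrite ffunE {1}/tensA ffunE (linear_opD (gl_lin gl M1)) -!addrA; congr (_ + _).
  congr (_ + _).
    rewrite (linear_op_sum (gl_lin gl M1)); apply: eq_bigr => k _.
    rewrite (linear_op_sum (gl_lin gl M1)); apply: eq_bigr => j _.
    by rewrite (linear_opZ (gl_lin gl M1)).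
  rewrite -big_split; apply: eq_bigr => k _ /=.
  rewrite -slot_sum -slotD; apply: eq_slot => a'.
  by rewrite ffunE.
rewrite [RHS]ffunE [X in _ = _ + X]ffunE !E ffunE (gl_bracket gl).
set S1 := \sum_k slot k N _ a; set S2 := \sum_k slot k M _ a.
rewrite [S2 + S1]addrC.
move: (S1 + S2) (A M (A N (g a))) (A N (A M (g a))) => S x y.
have -> : \sum_k slot k (bracket M N) g a =
    \sum_k \sum_k' slot k M (slot k' N g) a - \sum_k \sum_k' slot k N (slot k' M g) a.
  rewrite [X in _ - X]exchange_big -sumrB; apply: eq_bigr => k _.
  rewrite -sumrB (bigD1 k) //= big1 ?addr0 => [|k' kk'].
    rewrite !slot_mul /bracket addrC -scaleN1r slot_linl.
    by rewrite scaleN1r addrC.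
  by rewrite slot_comm ?subrr // eq_sym.
set P := \sum_k \sum_k' _; set Q := \sum_k \sum_k' _.
rewrite !opprD !addrA.
by rewrite [RHS](ACl (1*4*(2*5)*3*6)) /= subrr addr0.
Qed.

Lemma dagger_dagger M : dagger (dagger M) = M.
Proof. by apply/matrixP => i j; rewrite !mxE conjCK. Qed.

Lemma form_suml (J : Type) (s : seq J) (P : pred J) (g : J -> U) u :
  form (\sum_(i <- s | P i) g i) u = \sum_(i <- s | P i) form (g i) u.
Proof.
apply: (big_morph (fun x => form x u)) => [x y|].
  by have := form_linl gl 1 x y u; rewrite scale1r mul1r.
by have := form_linl gl (-1) 0 0 u; rewrite scaler0 addr0 mulN1r addNr.
Qed.

Lemma form_sumr (J : Type) (s : seq J) (P : pred J) (g : J -> U) u :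
  form u (\sum_(i <- s | P i) g i) = \sum_(i <- s | P i) form u (g i).
Proof.
apply: (big_morph (form u)) => [x y|].
  by have := form_linr gl 1 x y u; rewrite scale1r rmorph1 mul1r.
by have := form_linr gl (-1) 0 0 u; rewrite scaler0 addr0 rmorphN1 mulN1r addNr.
Qed.

Lemma formZl c u u' : form (c *: u) u' = c * form u u'.
Proof.
have := form_linl gl c u 0 u'; rewrite addr0 => ->.
have := form_suml [::] predT (fun _ : unit => 0) u'; rewrite !big_nil => ->.
by rewrite addr0.
Qed.

Lemma formZr c u u' : form u (c *: u') = c^* * form u u'.
Proof.
have := form_linr gl c u' 0 u; rewrite addr0 => ->.
have := form_sumr [::] predT (fun _ : unit => 0) u; rewrite !big_nil => ->.
by rewrite addr0.
Qed.

Lemma formDl u1 u2 u : form (u1 + u2) u = form u1 u + form u2 u.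
Proof. by have := form_linl gl 1 u1 u2 u; rewrite scale1r mul1r. Qed.

Lemma formDr u1 u2 u : form u (u1 + u2) = form u u1 + form u u2.
Proof. by have := form_linr gl 1 u1 u2 u; rewrite scale1r rmorph1 mul1r. Qed.

Lemma slot_adj k M (g g' : X -> U) :
  \sum_a form (slot k M g a) (g' a) = \sum_a form (g a) (slot k (dagger M) g' a).
Proof.
rewrite /slot; under eq_bigr do rewrite form_suml.
under [RHS]eq_bigr do rewrite form_sumr.
rewrite !pair_bigA /=.
(* Exchanging the k-th entry of the multi-index with the summation index transposes the matrix. *)
pose h (p : X * I) := (upd p.1 k p.2, p.1 k).
have hK : involutive h.
  by move=> [a j]; rewrite /h /= upd_upd upd_id upd_same.
rewrite (reindex_inj (inv_inj hK)); apply: eq_bigr => -[a j] _ /=.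
by rewrite upd_same upd_upd upd_id formZl formZr mxE conjCK.
Qed.

Lemma tens_gl_unitary : gl_unitary tensA tens_form.
Proof.
split.
- move=> M c g1 g2; apply/ffunP => a; rewrite !ffunE (gl_lin gl) scalerDr addrACA.
  congr (_ + _); rewrite scaler_sumr -big_split; apply: eq_bigr => k _ /=.
  rewrite /slot scaler_sumr -big_split; apply: eq_bigr => j _ /=.
  by rewrite !ffunE scalerDr !scalerA [c * _]mulrC.
- move=> c M N g; apply/ffunP => a; rewrite !ffunE (gl_linl gl) scalerDr addrACA.
  congr (_ + _); rewrite scaler_sumr -big_split; apply: eq_bigr => k _ /=.
  exact: slot_linl.
- exact: tensA_bracket.
- move=> c g1 g2 g; rewrite /tens_form mulr_sumr -big_split; apply: eq_bigr => a _ /=.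
  by rewrite !ffunE (form_linl gl).
- move=> c g1 g2 g; rewrite /tens_form mulr_sumr -big_split; apply: eq_bigr => a _ /=.
  by rewrite !ffunE (form_linr gl).
- by move=> g; apply: sumr_ge0 => a _; exact: (form_ge0 gl).
- move=> g /eqP; rewrite psumr_eq0 => [/allP h|a _]; last exact: (form_ge0 gl).
  apply/ffunP => a; rewrite ffunE; apply: (form_def gl); apply/eqP.
  by apply: h; rewrite mem_index_enum.
- move=> M g g'; rewrite /tens_form.
  under eq_bigr do rewrite ffunE formDl (form_adj gl) form_suml.
  under [RHS]eq_bigr do rewrite ffunE formDr form_sumr.
  rewrite !big_split; congr (_ + _) => /=.
  rewrite exchange_big [RHS]exchange_big; apply: eq_bigr => k _.
  exact: slot_adj.
Qed.

End GLModules.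

Section Splits.
Variable T : eqType.
Implicit Types w : seq T.

(** The terms of the coproduct of a word, each letter going to one of the two tensor factors. *)
Fixpoint splits w : seq (seq T * seq T) :=
  if w is x :: w' then
    [seq (x :: p.1, p.2) | p <- splits w'] ++ [seq (p.1, x :: p.2) | p <- splits w']
  else [:: ([::], [::])].

Lemma splits_count w p x : p \in splits w ->
  (count_mem x w = count_mem x p.1 + count_mem x p.2)%N.
Proof.
elim: w p => [|y w IH] p /=; first by rewrite inE => /eqP ->.
by rewrite mem_cat => /orP[] /mapP[q /IH -> ->] /=; [rewrite addnA|rewrite addnCA].
Qed.

Lemma splits_size w p : p \in splits w -> size w = (size p.1 + size p.2)%N.
Proof.
elim: w p => [|y w IH] p /=; first by rewrite inE => /eqP ->.
by rewrite mem_cat => /orP[] /mapP[q /IH -> ->] /=; rewrite ?addSn ?addnS.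
Qed.

Lemma splits_ex w (s1 s2 : T -> nat) : (forall x, count_mem x w = s1 x + s2 x)%N ->
  exists2 p, p \in splits w & (forall x, count_mem x p.1 = s1 x) /\ (forall x, count_mem x p.2 = s2 x).
Proof.
elim: w s1 s2 => [|y w IH] s1 s2 /= e.
  exists ([::], [::]); rewrite ?inE //=; split=> x; have := e x; lia.
have [s1y|s1y] := posnP (s1 y).
  have [|p pw [h1 h2]] := IH s1 (fun x => s2 x - (y == x))%N.
    by move=> x; have := e x; case: (y =P x) => [<-|_]; lia.
  exists (p.1, y :: p.2); first by rewrite mem_cat; apply/orP; right; apply/mapP; exists p.
  split=> x //=; rewrite h2; have := e x; case: (y =P x) => [<-|_]; lia.
have [|p pw [h1 h2]] := IH (fun x => s1 x - (y == x))%N s2.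
  by move=> x; have := e x; case: (y =P x) => [<-|_]; lia.
exists (y :: p.1, p.2); first by rewrite mem_cat; apply/orP; left; apply/mapP; exists p.
split=> x //=; rewrite h1; have := e x; case: (y =P x) => [<-|_]; lia.
Qed.

End Splits.

Section TensorWords.
Variables (K : numClosedFieldType) (n : nat).
Variables (U : lmodType K) (A : 'M[K]_(n + n) -> U -> U) (form : U -> U -> K).
Hypothesis gl : gl_unitary A form.
Variable l0 : 'I_n.
Local Notation d := (nat_of_ord l0).+1.
Local Notation I := 'I_(n + n).
Local Notation X := {ffun 'I_d -> I}.
Implicit Types (M N : 'M[K]_(n + n)) (a : X) (f : X -> K) (w : seq (posroot n)).

Definition glphi (V : lmodType K) (B : 'M[K]_(n + n) -> V -> V) (p q : nat) := B (spgen K n p q).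

Definition tens f (u : U) : {ffun X -> U} := [ffun a => f a *: u].

Lemma tensA_tens M f u : tensA A M (tens f u) = tens f (A M u) + tens (xop M f) u.
Proof.
apply/ffunP => a; rewrite !ffunE (linear_opZ (gl_lin gl M)); congr (_ + _).
rewrite /xop scaler_suml; apply: eq_bigr => k _.
rewrite /slot scaler_suml; apply: eq_bigr => j _.
by rewrite ffunE scalerA.
Qed.

Lemma act_tens w f u : act (glphi (tensA A (l0 := l0))) w (tens f u) =
  \sum_(p <- splits w) tens (xact p.2 f) (act (glphi A) p.1 u).
Proof.
elim: w => [|r w IH] /=; first by rewrite big_seq1.
rewrite IH /opr /glphi (linear_op_sum (gl_lin (tens_gl_unitary gl l0) _)).
rewrite big_cat !big_map -[RHS]big_split /=; apply: eq_bigr => p _ /=.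
exact: tensA_tens.
Qed.

End TensorWords.

(** * Models with an explicit highest weight vector, built by tensoring *)

Section Models.
Variables (K : numClosedFieldType) (n : nat).
Implicit Types (m : 'I_n -> nat) (w : seq (posroot n)).

(* The functional phi extracts s: it kills all words preceding s for the order
   comparing degrees first, then key2-lexicographically (larger first). *)
Definition extracts (U : lmodType K) (phi : nat -> nat -> U -> U) (v : U)
    (s : posroot n -> nat) (ph : U -> K) :=
  [/\ forall c u1 u2, ph (c *: u1 + u2) = c * ph u1 + ph u2,
      forall w, (size w < \sum_a s a)%N -> ph (act phi w v) = 0,
      forall w, size w = (\sum_a s a)%N -> ph (act phi w v) != 0 ->
        (forall a, count_mem a w = s a) \/ lexlt (@key2 n) (fun a => count_mem a w) s
    & exists2 k, k != 0 & forall w, (forall a, count_mem a w = s a) -> ph (act phi w v) = k].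

(** The data carried by the induction on m: [hm_nil] feeds the spanning half and [hm_extract] the
    independence half. *)
Record hw_model m (U : lmodType K) (A : 'M[K]_(n + n) -> U -> U) (v : U) : Prop := {
  hm_neq0 : v <> 0;
  hm_raise : forall p q, (n + n <= p + q)%N -> A (spgen K n p q) v = 0;
  hm_cartan : forall x, A (cartan x) v = weval (dominant_weight K m) x *: v;
  hm_nil : forall (a : posroot n) j N, edge_root a j -> (msum m (ra a) j < N)%N ->
    act (glphi A) (nseq N a) v = 0;
  hm_extract : forall s : posroot n -> nat, chain_lattice m s -> exists ph, extracts (glphi A) v s ph }.

Lemma chain_lattice0 m s : (forall l, m l = 0%N) -> chain_lattice m s ->
  forall a, s a = 0%N.
Proof.
move=> m0 cl a; have := cl a [::] 0 n isT (leq0n _); rewrite leqnSn orbT => /(_ isT).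
by rewrite big_seq1 /msum big1 // leqn0 => /eqP.
Qed.

Lemma hw_model0 m : (forall l, m l = 0%N) ->
  hw_model m (fun _ (_ : K^o) => 0) (1 : K^o).
Proof.
move=> m0; have act0 w : w <> [::] -> act (glphi (fun (_ : 'M[K]_(n + n)) (_ : K^o) => 0)) w 1 = 0.
  by case: w.
split.
- by move/eqP; rewrite oner_eq0.
- by [].
- move=> x; rewrite (_ : dominant_weight K m = 0); last first.
    by rewrite /dominant_weight big1 // => l _; rewrite m0 mulr0n.
  by rewrite (_ : weval 0 x = 0) ?scale0r // /weval big1 // => i _; rewrite mxE mul0r.
- by move=> a j [|N] // _ _; apply: act0.
- move=> s cl; have s0 := chain_lattice0 m0 cl.
  have S0 : (\sum_a s a = 0)%N by rewrite big1.
  exists id; split=> // [w|w|].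
  + by rewrite S0.
  + by rewrite S0 => /size0nil -> _; left=> a; rewrite s0.
  + exists 1; first exact: oner_neq0.
    move=> w; case: w => // a w /(_ a); rewrite /= eqxx s0; lia.
Qed.

End Models.

Section TensorStep.
Variables (K : numClosedFieldType) (n : nat).
Variables (U : lmodType K) (A : 'M[K]_(n + n) -> U -> U) (form : U -> U -> K).
Hypothesis gl : gl_unitary A form.
Variables (m : 'I_n -> nat) (l0 : 'I_n) (v : U).
Hypotheses (m_l0 : (0 < m l0)%N) (m_min : forall l : 'I_n, (l < l0)%N -> m l = 0%N).
Hypothesis hm : hw_model (dec_weight m l0) A v.
Local Notation d := (nat_of_ord l0).+1.
Local Notation I := 'I_(n + n).
Local Notation X := {ffun 'I_d -> I}.
Implicit Types (r : posroot n) (w : seq (posroot n)) (s : posroot n -> nat).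

Let vT := tens (@top_tensor K n l0) v.
Let phiT := glphi (tensA A (l0 := l0)).

Lemma splits_nseq (T : eqType) N (x : T) p : p \in splits (nseq N x) ->
  p.1 = nseq (size p.1) x /\ p.2 = nseq (size p.2) x.
Proof.
elim: N p => [|N IH] p /=; first by rewrite inE => /eqP ->.
by rewrite mem_cat => /orP[] /mapP[q /IH [h1 h2] ->] /=; rewrite -h1 -h2.
Qed.

(** The alternating factor absorbs at most one copy of r, and none unless ra r <= l0 <= j, which is
    when the bound grows by one. *)
Lemma tens_step_nil r j N : edge_root r j -> (msum m (ra r) j < N)%N ->
  act phiT (nseq N r) vT = 0.
Proof.
move=> er; rewrite (msum_dec m_l0) => hN.
rewrite (act_tens gl) big_seq big1 // => p ps.
have [e1 e2] := splits_nseq ps; have := splits_size ps; rewrite size_nseq => sz.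
apply/ffunP => a; rewrite !ffunE e1 e2.
have [h2|h2] := leqP 2 (size p.2).
  rewrite (_ : xact _ _ a = 0) ?scale0r //; case: (size p.2) h2 => [|[|k]] // _.
  elim: k a => [|k IH] a /=; first exact: (xop_edge_root_sq K a er).
  rewrite /xop big1 // => k' _; rewrite big1 // => i _.
  by rewrite [X in _ * X]IH mulr0.
have [hr|hr] := boolP ((size p.2 == 1) && ~~ (ra r <= l0 <= j))%N.
  case/andP: hr => /eqP -> /= out.
  by rewrite (xop_edge_root_out K a er out) scale0r.
rewrite (hm_nil hm er) ?scaler0 //.
by move: hr h2 hN sz; case: (ra r <= l0 <= j)%N; case: (size p.2) => [|[|]] //=; lia.
Qed.

Lemma tens0r f : tens f (0 : U) = 0 :> {ffun X -> U}.
Proof. by apply/ffunP => a; rewrite !ffunE scaler0. Qed.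

Section Extract.
Variable s : posroot n -> nat.
Hypothesis cl : chain_lattice m s.
Let Ms := min_roots l0 s.
(** AA holds the lower ends of the minimal roots and [er] the root at each of them. The coordinate
    [bb] is that of the top tensor with index k changed to the upper end of er k, for k in AA. *)
Let AA : {set 'I_d} := [set k : 'I_d | [exists r, (r \in Ms) && (ra r == k)]].
Let er (k : 'I_d) : posroot n := odflt (alpha l0) [pick r | (r \in Ms) && (ra r == k)].
Let bb : X := [ffun k => if k \in AA then odflt (hcol k) [pick i | pos i == rb (er k)] else hcol k].

Let erP k : k \in AA -> er k \in Ms /\ ra (er k) = k.
Proof.
rewrite inE => /existsP[r hr]; rewrite /er; case: pickP => [r' /andP[h1 /eqP h2]|/(_ r)] //=.
by rewrite hr.
Qed.

Let MsP r : r \in Ms -> [/\ (0 < s r)%N, (ra r <= l0)%N & (l0 <= rq r)%N].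
Proof. by rewrite inE => /andP[/and3P[]]. Qed.

Let kc k : k \in AA -> (k <= rb (er k))%N.
Proof. by move=> /erP[_ <-]; have [] := rootP (er k). Qed.

Let c_low k : k \in AA -> ((k + rb (er k)).+1 < n + n)%N.
Proof. by move=> /erP[_ <-]; have [] := rootP (er k). Qed.

Let c_incr k k' : k \in AA -> k' \in AA -> (k < k')%N -> (rb (er k) < rb (er k'))%N.
Proof.
move=> /erP[h1 h2] /erP[h3 h4] kk'.
have [||_ //] := min_roots_anti h1 h3; first by rewrite h2 h4 ltnW.
by apply: contraTneq kk' => e; rewrite -h2 e h4 ltnn.
Qed.

Let c_out k : k \in AA -> ((rb (er k) + l0).+1 < n + n)%N.
Proof.
move=> /erP[/MsP[_ _ h] _]; have [_ _ _ _ h'] := rootP (er k); lia.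
Qed.

Let eE k : k \in AA -> is_edge (er k) (rb (er k)) k.
Proof. by move=> /erP[_ h]; rewrite /is_edge h !eqxx orbT. Qed.

Let bA k : k \in AA -> pos (bb k) = rb (er k).
Proof.
move=> kA; rewrite ffunE kA; case: pickP => [i /eqP //|] /=.
have [|i hi] := @pos_surj n (rb (er k)); first by have := c_low kA; lia.
by move/(_ i); rewrite hi eqxx.
Qed.

Let bN k : k \notin AA -> bb k = hcol k.
Proof. by move=> /negPf kA; rewrite ffunE kA. Qed.

Let sumMs r : (\sum_(k in AA) (er k == r) = (r \in Ms))%N.
Proof.
have [rM|rM] := boolP (r \in Ms); last first.
  rewrite big1 // => k kA; case: eqP => // e; have [h _] := erP kA.
  by rewrite e (negPf rM) in h.
have [_ rl _] := MsP rM.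
pose k : 'I_d := Ordinal (rl : (ra r < d)%N).
have kA : k \in AA by rewrite inE; apply/existsP; exists r; rewrite rM eqxx.
have [ek1 ek2] := erP kA.
have ekr : er k = r.
  apply/eqP; apply: contraT => ne.
  have [||h _] := min_roots_anti ek1 rM; [by rewrite ek2|by []|].
  by rewrite ek2 ltnn in h.
rewrite (bigD1 k) //= ekr eqxx big1 // => k' /andP[k'A k'k].
case: eqP => // e; have [_ h] := erP k'A; case/eqP: k'k.
by apply: val_inj; rewrite /= -h e.
Qed.

Let cardAA : #|AA| = (\sum_r (r \in Ms))%N.
Proof.
rewrite -(eq_bigr _ (fun r _ => sumMs r)) exchange_big -sum1_card.
apply: eq_bigr => k _ /=; rewrite (bigD1 (er k)) //= eqxx big1 // => r.
by rewrite eq_sym => /negPf ->.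
Qed.

Let s' r := (s r - (r \in Ms))%N.

Let sE r : s r = (s' r + (r \in Ms))%N.
Proof. by rewrite subnK //; have [/MsP[h _ _]|//] := boolP (r \in Ms). Qed.

Let xact_small w : (size w < #|AA|)%N -> xact w (@top_tensor K n l0) bb = 0.
Proof.
move=> h; apply: (xact_few (B := AA)) => // k kA l.
by apply: (b_out (A := AA) (c := fun k => rb (er k))) => //.
Qed.

Let xact_lead w : size w = #|AA| -> xact w (@top_tensor K n l0) bb != 0 ->
  (forall r, count_mem r w = (r \in Ms)) \/
  lexlt (@key2 n) (fun r => count_mem r w) (fun r => r \in Ms : nat).
Proof.
move=> sz nz.
have [//|k -> //|sg [s1 _ s3]] := xact_exact (A := AA) (c := fun k => rb (er k)) (b := bb)
   c_out bA bN (B := AA) (rr := er) (fintype.subxx _) _ _ sz nz.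
have cw r : count_mem r w = matching_count AA (fun k => rb (er k)) sg r.
  by rewrite -s3 big1 ?addn0 // => k; rewrite inE => /andP[/negPf ->].
have m1 r : matching_count AA (fun k => rb (er k)) 1%g r = (r \in Ms).
  by rewrite (matching1 (e := er)) // sumMs.
have [sg1|lt] := matching_lex kc c_low c_incr s1.
  by left=> r; rewrite cw sg1 m1.
by right; rewrite (eq_lexlt _ cw (fun r => esym (m1 r))).
Qed.

Let xact_val w : (forall r, count_mem r w = (r \in Ms)) ->
  xact w (@top_tensor K n l0) bb = xconst K AA er bb.
Proof.
move=> cw; apply: (xact_const kc c_low c_incr c_out eE bA bN (B := AA)) => //.
  by move=> k; rewrite andbN.
by move=> r; rewrite sumMs.
Qed.

(** The functional takes the coordinate [bb] and then extracts s minus the minimal roots in U. In a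
    split of a word, both factors vanish below their degrees and have a leading term; [lexlt] is
    compatible with addition, so leading terms multiply. *)
Lemma tens_step_extract :
  (exists h, hw_vec n phiT vT h) -> exists ph, extracts phiT vT s ph.
Proof.
move=> [h hw]; have cl' := chain_lattice_dec m_l0 m_min cl.
have [ph [ph_lin ph_small ph_lead [k1 k1_0 ph_val]]] := hm_extract hm cl'.
have sumE : (\sum_r s r = \sum_r s' r + #|AA|)%N.
  by rewrite cardAA -big_split; apply: eq_bigr => r _; exact: sE.
pose phT (g : {ffun X -> U}) := ph (g bb).
have phZ c u : ph (c *: u) = c * ph u.
  have ph0 : ph 0 = 0 by have := ph_lin (-1) 0 0; rewrite scaler0 addr0 mulN1r addNr.
  by have := ph_lin c u 0; rewrite addr0 ph0 addr0.
have phTE w : phT (act phiT w vT) =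
    \sum_(p <- splits w) xact p.2 (@top_tensor K n l0) bb * ph (act (glphi A) p.1 v).
  rewrite /phT /phiT /vT (act_tens gl) sum_ffunE.
  rewrite (big_morph ph (id1 := 0) (op1 := +%R)) => [|x y|].
  - by apply: eq_bigr => p _; rewrite ffunE phZ.
  - by have := ph_lin 1 x y; rewrite scale1r mul1r.
  - by have := phZ 0 0; rewrite scale0r mul0r.
have term0 w p : p \in splits w -> xact p.2 (@top_tensor K n l0) bb * ph (act (glphi A) p.1 v) != 0 ->
    (#|AA| <= size p.2)%N /\ (\sum_r s' r <= size p.1)%N.
  move=> ps; rewrite mulf_eq0 negb_or => /andP[h2 h1].
  split; rewrite leqNgt; apply/negP => lt.
    by rewrite xact_small ?eqxx in h2.
  by rewrite ph_small ?eqxx in h1.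
have lin c g1 g2 : phT (c *: g1 + g2) = c * phT g1 + phT g2.
  by rewrite /phT !ffunE ph_lin.
have small w : (size w < \sum_r s r)%N -> phT (act phiT w vT) = 0.
  move=> sz; rewrite phTE big_seq big1 // => p ps; apply/eqP.
  apply: contraTT sz => nz; have [h1 h2] := term0 _ _ ps nz.
  by rewrite -leqNgt sumE (splits_size ps) leq_add.
have exactly w p : size w = (\sum_r s r)%N -> p \in splits w ->
    xact p.2 (@top_tensor K n l0) bb * ph (act (glphi A) p.1 v) != 0 ->
    (forall r, count_mem r p.1 = s' r) /\ (forall r, count_mem r p.2 = (r \in Ms))
    \/ lexlt (@key2 n) (fun r => count_mem r w) s.
  move=> sz ps nz; have [h1 h2] := term0 _ _ ps nz.
  have e1 : size p.1 = (\sum_r s' r)%N by have := splits_size ps; rewrite sz sumE; lia.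
  have e2 : size p.2 = #|AA| by have := splits_size ps; rewrite sz sumE; lia.
  move: nz; rewrite mulf_eq0 negb_or => /andP[n2 n1].
  have cw := splits_count _ ps.
  have [c1|c1] := ph_lead _ e1 n1; have [c2|c2] := xact_lead e2 n2.
  - by left.
  - right; rewrite (eq_lexlt _ cw sE).
    rewrite (@eq_lexlt _ _ _ (fun r => s' r + count_mem r p.2)%N _ (fun r => s' r + (r \in Ms))%N).
    + by rewrite lexlt_add2l.
    + by move=> r; rewrite c1.
    + by [].
  - right; rewrite (eq_lexlt _ cw sE).
    rewrite (@eq_lexlt _ _ _ (fun r => (r \in Ms) + count_mem r p.1)%N
        _ (fun r => (r \in Ms) + s' r)%N).
    + by rewrite lexlt_add2l.
    + by move=> r; rewrite c2 addnC.
    + by move=> r; rewrite addnC.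
  - right; rewrite (eq_lexlt _ cw sE).
    apply: (lexlt_trans (@key2_inj n) (t := fun r => count_mem r p.1 + (r \in Ms))%N).
      by rewrite lexlt_add2l.
    rewrite (@eq_lexlt _ _ _ (fun r => (r \in Ms) + count_mem r p.1)%N
        _ (fun r => (r \in Ms) + s' r)%N).
    + by rewrite lexlt_add2l.
    + by move=> r; rewrite addnC.
    + by move=> r; rewrite addnC.
exists phT; split=> //.
  move=> w sz; rewrite phTE => nz.
  have [p ps pnz] : exists2 p, p \in splits w &
      xact p.2 (@top_tensor K n l0) bb * ph (act (glphi A) p.1 v) != 0.
    apply: contrapT => hn; move/eqP: nz; apply; rewrite big_seq big1 // => p ps.
    by apply/eqP; apply: contrapT => /negP hp; apply: hn; exists p.
  have [[c1 c2]|] := exactly _ _ sz ps pnz; [left=> r|by right].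
  by rewrite (splits_count _ ps) c1 c2 -sE.
pose w0 := flatten [seq nseq (s r) r | r <- index_enum (posroot n)].
have cw0 r : count_mem r w0 = s r.
  rewrite /w0 count_flatten -map_comp sumnE big_map /=.
  rewrite (bigD1 r) //= count_nseq /= eqxx mul1n big1 ?addn0 // => r' /negPf r'r.
  by rewrite count_nseq /= r'r.
have sizew w : (forall r, count_mem r w = s r) -> size w = (\sum_r s r)%N.
  move=> cw; rewrite -sum1_size (sum_count_mem (fun=> 1%N)).
  by apply: eq_bigr => r _; rewrite muln1 cw.
exists (phT (act phiT w0 vT)); last first.
  move=> w cw; have pw : perm_eq w w0 by apply/allP => r _; rewrite /= cw cw0.
  have := W_perm (gl_sp_ops (tens_gl_unitary gl l0)) hw pw.
  rewrite (sizew _ cw) => hW.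
  suff : phT (act phiT w vT - act phiT w0 vT) = 0.
    by rewrite -scaleN1r addrC lin mulN1r => /eqP; rewrite addrC subr_eq0 => /eqP.
  elim: hW => [|c g u [w' [h1 ->]] _ IH].
    by have := lin (-1) 0 0; rewrite scaler0 addr0 mulN1r addNr.
  by rewrite lin IH addr0 small ?mulr0.
rewrite phTE.
(* The splits with the right content in both factors all give the same value, and there is at least
   one, so their sum is a positive integer times a nonzero constant. *)
pose gd (p : seq (posroot n) * seq (posroot n)) :=
  [forall r, (count_mem r p.1 == s' r) && (count_mem r p.2 == (r \in Ms))].
rewrite (bigID gd) /= [X in _ + X]big_seq_cond [X in _ + X]big1 ?addr0; last first.
  move=> p /andP[ps npg]; apply/eqP; apply: contraNT npg => nz.
  have [[c1 c2]|] := exactly _ _ (sizew _ cw0) ps nz.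
    by apply/forallP => r; rewrite c1 c2 !eqxx.
  by rewrite (eq_lexlt _ cw0 (frefl _)) lexlt_irr.
rewrite (eq_bigr (fun=> xconst K AA er bb * k1)); last first.
  move=> p /forallP hp; congr (_ * _).
    by apply: xact_val => r; have /andP[_ /eqP] := hp r.
  by apply: ph_val => r; have /andP[/eqP] := hp r.
rewrite -big_filter big_const_seq count_predT iter_addr_0 -mulr_natr mulf_neq0 //.
  by rewrite mulf_neq0 // (xconst_neq0 K kc c_low c_incr eE bA bN).
have [|p pw [c1 c2]] := @splits_ex _ w0 s' (fun r => r \in Ms : nat).
  by move=> r; rewrite cw0 -sE.
rewrite pnatr_eq0 size_filter -lt0n -has_count; apply/hasP; exists p => //.
by apply/forallP => r; rewrite c1 c2 !eqxx.
Qed.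

End Extract.

Lemma hw_model_tens : hw_model m (tensA A (l0 := l0)) vT.
Proof.
have raise p q : (n + n <= p + q)%N -> tensA A (spgen K n p q) vT = 0.
  move=> pq; rewrite /vT (tensA_tens gl) (hm_raise hm pq) tens0r add0r.
  by apply/ffunP => a; rewrite !ffunE xop_raise // scale0r.
have domE : dominant_weight K m = dominant_weight K (dec_weight m l0) + fund_weight K l0.
  rewrite /dominant_weight (bigD1 l0) //= [X in _ = X + _](bigD1 l0) //= addrAC.
  rewrite -mulrSr /dec_weight eqxx subn1 prednK //; congr (_ + _).
  by apply: eq_bigr => l /negPf ->; rewrite subn0.
have cart x : tensA A (cartan x) vT = weval (dominant_weight K m) x *: vT.
  rewrite /vT (tensA_tens gl) (hm_cartan hm) domE wevalD.
  apply/ffunP => a; rewrite !ffunE xop_cartan !scalerA -scalerDl.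
  by congr (_ *: _); rewrite mulrDl mulrC.
split=> //.
- move=> /ffunP /(_ [ffun l => hcol l]); rewrite !ffunE => /eqP.
  rewrite scaler_eq0 => /orP[|/eqP]; last exact: (hm_neq0 hm).
  rewrite /top_tensor /minor_tensor (_ : \matrix_(_, _) _ = 1%:M) ?det1 ?oner_eq0 //.
  by apply/matrixP => i j; rewrite !mxE ffunE (inj_eq (@hcol_inj n l0)).
- exact: tens_step_nil.
- move=> s cl; apply: (tens_step_extract cl).
  exists (fun p q => xget 0 [set c : K | tensA A (spgen K n p q) vT = c *: vT]%classic).
  split=> p q pq; first exact: raise.
  have [x ex] := F_cartan K pq.
  have h : tensA A (spgen K n p q) vT = weval (dominant_weight K m) x *: vT by rewrite ex cart.
  by rewrite /glphi; case: xgetP => [c _ //|] /(_ _ h).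
Qed.

End TensorStep.

Lemma hw_model_exists (K : numClosedFieldType) n (m : 'I_n -> nat) :
  exists (U : lmodType K) (A : 'M[K]_(n + n) -> U -> U) (form : U -> U -> K) (v : U),
    gl_unitary A form /\ hw_model m A v.
Proof.
have [k] := ubnP (\sum_l m l)%N; elim: k m => // k IH m /ltnSE hk.
have [/forallP m0|] := boolP [forall l, m l == 0%N].
  exists K^o, (fun _ _ => 0), (fun a b => a * b^*), 1; split; last first.
    by apply: hw_model0 => l; apply/eqP.
  split=> //.
  - by move=> M c u1 u2; rewrite scaler0 addr0.
  - by move=> c M N u; rewrite scaler0 addr0.
  - by move=> M N u; rewrite subr0.
  - by move=> c u1 u2 u; rewrite mulrDl -mulrA.
  - by move=> c u1 u2 u; rewrite rmorphD rmorphM mulrDr mulrCA.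
  - by move=> u; rewrite mul_conjC_ge0.
  - by move=> u /eqP; rewrite mul_conjC_eq0 => /eqP.
  - by move=> M u u'; rewrite mul0r rmorph0 mulr0.
rewrite negb_forall => /existsP[i hi].
(* The smallest index is split off because [chain_lattice_dec] needs m to vanish below l0. *)
case: (@arg_minnP _ i (fun l => m l != 0%N) val hi) => l0 ml0 lmin.
have m_min (l : 'I_n) : (l < l0)%N -> m l = 0%N.
  by move=> ll0; apply/eqP; apply: contraLR ll0 => /lmin; rewrite -leqNgt.
rewrite -lt0n in ml0.
have [|U [A [form [v [gl hm]]]]] := IH (dec_weight m l0).
  apply: leq_trans hk; rewrite (bigD1 l0) //= [X in (_ < X)%N](bigD1 l0) //=.
  rewrite /dec_weight eqxx -addSn leq_add //; first lia.
  by apply: leq_sum => l _; exact: leq_subr.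
exists {ffun {ffun 'I_l0.+1 -> 'I_(n + n)} -> U}, (tensA A (l0 := l0)), (tens_form form (l0 := l0)), (tens (@top_tensor K n l0) v).
split; first exact: tens_gl_unitary.
exact: (hw_model_tens gl ml0 m_min hm).
Qed.

(** * Comparison with the irreducible module *)

Section SpModule.
Variables (K : numClosedFieldType) (n : nat) (V : lmodType K).
Variable rho : 'M[K]_(n + n) -> V -> V.
Hypothesis mod : is_sp_module rho.
Implicit Types (u : V) (X Y : 'M[K]_(n + n)).

Lemma in_spD c X Y : in_sp X -> in_sp Y -> in_sp (c *: X + Y).
Proof.
rewrite /in_sp linearP /= mulmxDl mulmxDr -scalemxAl -scalemxAr addrACA -scalerDr.
by move=> -> ->; rewrite scaler0 addr0.
Qed.

Lemma in_sp0 : in_sp (0 : 'M[K]_(n + n)).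
Proof. by rewrite /in_sp trmx0 mul0mx mulmx0 addr0. Qed.

Lemma rho_lin X : in_sp X -> linear_op (rho X).
Proof. by case: mod => h _ _ sX c u1 u2; rewrite h. Qed.

Lemma rho0 u : rho 0 u = 0.
Proof.
case: mod => _ h _; have := h 0 0 in_sp0 in_sp0 (-1) u.
by rewrite scaler0 addr0 scaleN1r addNr.
Qed.

Lemma rhoZ c X u : in_sp X -> rho (c *: X) u = c *: rho X u.
Proof.
by move=> sX; case: mod => _ h _; have := h X 0 sX in_sp0 c u; rewrite addr0 rho0 addr0.
Qed.

Lemma rhoD X Y u : in_sp X -> in_sp Y -> rho (X + Y) u = rho X u + rho Y u.
Proof. by move=> sX sY; case: mod => _ h _; have := h X Y sX sY 1 u; rewrite !scale1r. Qed.

Lemma in_spZ c X : in_sp X -> in_sp (c *: X).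
Proof. by move=> sX; rewrite -[_ *: _]addr0; apply: in_spD sX in_sp0. Qed.

Lemma in_spDD X Y : in_sp X -> in_sp Y -> in_sp (X + Y).
Proof. by move=> sX sY; rewrite -[X]scale1r; apply: in_spD. Qed.

Lemma rho_sum (J : Type) (s : seq J) (X : J -> 'M[K]_(n + n)) u : (forall j, in_sp (X j)) ->
  in_sp (\sum_(j <- s) X j) /\ rho (\sum_(j <- s) X j) u = \sum_(j <- s) rho (X j) u.
Proof.
move=> sX; elim: s => [|j s [IH1 IH2]].
  by rewrite !big_nil rho0; split=> //; exact: in_sp0.
by rewrite !big_cons; split; [exact: in_spDD|rewrite rhoD // IH2].
Qed.

Definition rphi (p q : nat) := rho (spgen K n p q).

Lemma rho_expand X u : in_sp X -> exists z : 'I_(n + n) -> 'I_(n + n) -> K,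
  rho X u = 2^-1 *: \sum_i \sum_j z i j *: rphi (pos i) (pos j) u.
Proof.
move=> sX; exists (fun i j => (X *m (symp_form K n)^T) i j); rewrite {1}(sp_expand sX).
have sF i j : in_sp ((X *m (symp_form K n)^T) i j *: spgen K n (pos i) (pos j)).
  by apply: in_spZ; exact: F_in_sp.
have sFF i : in_sp (\sum_j (X *m (symp_form K n)^T) i j *: spgen K n (pos i) (pos j)).
  by have [] := rho_sum (index_enum _) u (sF i).
have [sS e] := rho_sum (index_enum _) u sFF.
rewrite rhoZ // e; congr (_ *: _); apply: eq_bigr => i _.
have [_ ->] := rho_sum (index_enum _) u (sF i).
by apply: eq_bigr => j _; rewrite rhoZ //; exact: F_in_sp.
Qed.

Lemma rho_sp_ops : sp_ops n rphi.
Proof.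
split=> [p q|p q u|p q r s u].
- by apply: rho_lin; exact: F_in_sp.
- by rewrite /rphi F_sym.
case: mod => _ _ h; rewrite /rphi -h; try exact: F_in_sp.
have E c1 c2 c3 c4 X1 X2 X3 X4 : in_sp X1 -> in_sp X2 -> in_sp X3 -> in_sp X4 ->
    rho (c1 *: X1 + c2 *: X2 + c3 *: X3 + c4 *: X4) u =
    c1 *: rho X1 u + c2 *: rho X2 u + c3 *: rho X3 u + c4 *: rho X4 u.
  move=> s1 s2 s3 s4; have z1 := in_spZ c1 s1; have z2 := in_spZ c2 s2.
  have z3 := in_spZ c3 s3; have z4 := in_spZ c4 s4.
  have d1 := in_spDD z1 z2; have d2 := in_spDD d1 z3.
  by rewrite (rhoD u d2 z4) (rhoD u d1 z3) (rhoD u z1 z2) !rhoZ.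
by rewrite bracket_F E //; exact: F_in_sp.
Qed.

Variables (lam : 'rV[K]_n) (v : V).
Hypothesis v0 : v <> 0.
Hypothesis v_wt : weight_space rho lam v.
Hypothesis v_top : forall (a : posroot n) X, in_root_space (root_weight K a) X -> rho X v = 0.

Definition hw_scalar (mu : 'rV[K]_n) (p q : nat) : K :=
  weval mu (xget 0 [set x : 'rV[K]_n | spgen K n p q = cartan x]%classic).

Lemma hw_scalarE p q : (p + q).+1 = (n + n)%N ->
  spgen K n p q = cartan (xget 0 [set x : 'rV[K]_n | spgen K n p q = cartan x]%classic).
Proof. by move=> pq; have [x ex] := F_cartan K pq; case: xgetP => [y _ //|] /(_ _ ex). Qed.

Lemma rho_hw_vec : hw_vec n rphi v (hw_scalar lam).
Proof.
split=> p q pq; rewrite /rphi; last first.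
  by rewrite {1}(hw_scalarE pq) v_wt.
have [pn|pn] := ltnP p (n + n); last by rewrite F_out // rho0.
have [qn|qn] := ltnP q (n + n); last by rewrite F_sym F_out // rho0.
by have [a ha] := F_pos_root_space K pn qn pq; exact: v_top ha.
Qed.

(* The height grading is given by the element of h with eigenvalue 2n-1-2p on
   the vector at position p. *)
Lemma rho_notin_lower c :
  lspan (fun g => exists w : seq (posroot n), w <> [::] /\ g = act rphi w v) (c *: v) -> c = 0.
Proof.
pose x0 : 'rV[K]_n := \row_j ((n + n).-1%:R - j.*2%:R).
have wE p : (p < n + n)%N -> weval (wtv K n p) x0 = (n + n).-1%:R - p.*2%:R.
  move=> pn; have [pn'|pn'] := ltnP p n; first by rewrite weval_wtv mxE.
  have qn : ((n + n).-1 - p < n)%N by lia.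
  rewrite (@wtv_bar _ _ p ((n + n).-1 - p)%N); last lia.
  rewrite wevalN weval_wtv mxE /= opprB; apply/eqP.
  rewrite subr_eq addrAC eq_sym subr_eq -!natrD eqr_nat; apply/eqP; lia.
pose ht (a : posroot n) := ((n + n).-1.*2 - (ra a + rb a).*2)%N.
have cs := cartan_in_sp x0.
apply: (hw_notin_lower rho_sp_ops (H := rho (cartan x0)) (ht := ht) (lam := weval lam x0)) => //.
- exact: rho_lin.
- by move=> a; rewrite /ht; have [_ _ ? _ _] := rootP a; lia.
- move=> a u; rewrite /opr /rphi; case: mod => _ _ h.
  apply/eqP; rewrite addrC -subr_eq -h //; last exact: F_in_sp.
  rewrite bracket_cartan_F rhoZ; last exact: F_in_sp.
  rewrite scaleNr; apply/eqP; congr (- (_ *: _)).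
  have [an ab abn _ _] := rootP a; rewrite wevalD !wE; [|lia|lia].
  rewrite addrACA -opprD -!natrD -natrB; last by rewrite /ht; lia.
  by congr (_%:R); rewrite /ht; lia.
Qed.

End SpModule.

Section Transfer.
Variables (K : numClosedFieldType) (n : nat) (V : lmodType K).
Variable rho : 'M[K]_(n + n) -> V -> V.
Variables (m : 'I_n -> nat) (v : V).
Hypothesis irr : is_irreducible_highest_weight rho (dominant_weight K m) v.
Variables (U : lmodType K) (A : 'M[K]_(n + n) -> U -> U) (form : U -> U -> K) (t : U).
Hypotheses (gl : gl_unitary A form) (hm : hw_model m A t).

Let mod : is_sp_module rho. Proof. by case: irr. Qed.
Let v0 : v <> 0. Proof. by case: irr => _ _ []. Qed.
Let hwV : hw_vec n (rphi rho) v (hw_scalar (dominant_weight K m)).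
Proof. by case: irr => _ _ [_ h1 h2]; exact: rho_hw_vec. Qed.
Let v_lower c : lspan (fun g => exists w : seq (posroot n), w <> [::] /\ g = act (rphi rho) w v) (c *: v) -> c = 0.
Proof. by case: irr => _ _ [_ h1 _]; exact: rho_notin_lower. Qed.
Let spT := gl_sp_ops gl.

Let hwT : hw_vec n (glphi A) t (hw_scalar (dominant_weight K m)).
Proof.
split=> p q pq; first exact: (hm_raise hm).
by rewrite /glphi {1}(hw_scalarE K pq) (hm_cartan hm).
Qed.

Let P : lmodType K := (V * U)%type.
Let phi (p q : nat) (x : P) : P := (rphi rho p q x.1, glphi A p q x.2).

Let spP : sp_ops n phi.
Proof.
have spV := rho_sp_ops mod.
split=> [p q c x y|p q x|p q r s x].
- by apply: injective_projections; [exact: (sp_lin spV)|exact: (sp_lin spT)].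
- by apply: injective_projections; [exact: (sp_sym spV)|exact: (sp_sym spT)].
- by apply: injective_projections; [exact: (sp_comm spV)|exact: (sp_comm spT)].
Qed.

Let hwP : hw_vec n phi (v, t) (hw_scalar (dominant_weight K m)).
Proof.
split=> p q pq; rewrite /phi /=.
  by rewrite (hw_pos hwV pq) (hw_pos hwT pq).
by rewrite (hw_cartan hwV pq) (hw_cartan hwT pq).
Qed.

Let actP (w : seq (posroot n)) : act phi w (v, t) = (act (rphi rho) w v, act (glphi A) w t).
Proof. by elim: w => //= a w ->. Qed.

(** The submodule generated by the pair of highest weight vectors. [LW_snd] and [LW_fst] make it the
    graph of an isomorphism between V and the submodule generated by t. *)
Let LW := lspan (fun g : P => exists w : seq (posroot n), g = act phi w (v, t)).

(** The form is thus contravariant for sp: the adjoint of a lowering operator is a multiple of the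
    opposite raising one. *)
Lemma dagger_F p q : (p < n + n)%N -> (q < n + n)%N ->
  exists c, dagger (spgen K n p q) = c *: spgen K n ((n + n).-1 - p) ((n + n).-1 - q).
Proof.
move=> pn qn.
have dagE : dagger (spgen K n p q) = (spgen K n p q)^T.
  apply/matrixP => i j; rewrite [LHS]mxE [RHS]mxE F_entry rmorphD !rmorphM /= !rmorph_nat.
  have omC x y : (om K n x y)^* = om K n x y.
    by rewrite /om; case: ifP => _; [case: ifP => _|]; rewrite ?rmorphN1 ?rmorph1 ?rmorph0.
  by rewrite !omC -F_entry.
pose sg r : K := if (r < n)%N then -1 else 1.
exists (- (sg p * sg q)); rewrite dagE; apply/matrixP => i j.
rewrite [LHS]mxE [RHS]mxE !F_entry.
have omE' x y : (x < n + n)%N -> om K n x (pos y) = sg x * (pos y == (n + n).-1 - x)%N%:R.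
  move=> xn; rewrite /om -/(sg x); have yn := pos_lt y.
  have -> : ((x + pos y).+1 == n + n)%N = (pos y == (n + n).-1 - x)%N by lia.
  by case: eqP; rewrite ?mulr1 ?mulr0.
rewrite !omE' //; try lia.
have barK x : (x < n + n)%N -> ((n + n).-1 - ((n + n).-1 - x) = x)%N by lia.
rewrite !barK //.
have sgb x : (x < n + n)%N -> sg ((n + n).-1 - x)%N = - sg x.
  by move=> xn; rewrite /sg; case: ltnP => ?; case: ltnP => ?; rewrite ?opprK //; lia.
rewrite !sgb //.
by rewrite /sg; case: (p < n)%N; case: (q < n)%N; ring.
Qed.

Let form_lower y : lspan (fun g => exists w : seq (posroot n), w <> [::] /\ g = act (glphi A) w t) y ->
  form t y = 0.
Proof.
have formr0 u : form u 0 = 0.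
  by have := form_linr gl (-1) 0 0 u; rewrite scaler0 addr0 rmorphN1 mulN1r addNr.
elim=> [//|c g y' [w [w0 ->]] _ IH]; rewrite (form_linr gl) IH addr0.
case: w w0 => // a w _; rewrite /= /opr /glphi.
rewrite -(dagger_dagger (spgen K n (ra a) (rb a))) -(form_adj gl).
have [_ _ hab _ _] := rootP a.
have [||c' ->] := @dagger_F (ra a) (rb a); [lia|lia|].
have AZ M u : A (c' *: M) u = c' *: A M u.
  have A0 : A 0 u = 0.
    by have := gl_linl gl (-1) 0 0 u; rewrite scaler0 addr0 scaleN1r addNr.
  by have := gl_linl gl c' M 0 u; rewrite addr0 A0 addr0.
rewrite AZ (hm_raise hm) ?scaler0; last lia.
have := form_linl gl (-1) 0 0 (act (fun p q : nat => A (spgen K n p q)) w t).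
by rewrite scaler0 addr0 mulN1r addNr => ->; rewrite mulr0.
Qed.

Let LW_split x y : LW (x, y) -> exists c x' y', [/\ x = c *: v + x', y = c *: t + y',
  lspan (fun g => exists w : seq (posroot n), w <> [::] /\ g = act (rphi rho) w v) x' &
  lspan (fun g => exists w : seq (posroot n), w <> [::] /\ g = act (glphi A) w t) y'].
Proof.
move=> /words_split [c [[x' y'] [e h]]]; exists c, x', y'; split.
- by have := congr1 fst e.
- by have := congr1 snd e.
- apply: (lspan_img (f := fst : P -> V) (u := (x', y'))) h => // g [w [w0 ->]].
  by apply: lspan_mem; exists w; rewrite actP.
- apply: (lspan_img (f := snd : P -> U) (u := (x', y'))) h => // g [w [w0 ->]].
  by apply: lspan_mem; exists w; rewrite actP.
Qed.

(** For such y the coefficient of t vanishes, as that of v does, so y is orthogonal to t. Passing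
    adjoints across, y is orthogonal to every word applied to t; being a combination of these, it is
    orthogonal to itself. *)
Lemma LW_snd y : LW (0, y) -> y = 0.
Proof.
move=> Wy; apply: (form_def gl).
have top z : LW (0, z) -> form t z = 0.
  move=> /LW_split [c [x' [y' [ex -> hx hy]]]].
  have c0 : c = 0.
    apply: oppr_inj; rewrite oppr0; apply: v_lower.
    suff -> : - c *: v = x' by [].
    by apply/eqP; rewrite scaleNr eq_sym -addr_eq0 addrC -ex.
  by rewrite c0 scale0r add0r form_lower.
have orth (w : seq (posroot n)) z : LW (0, z) -> form (act (glphi A) w t) z = 0.
  elim: w z => [|a w IH] z Wz; first exact: top.
  rewrite /= /opr /glphi (form_adj gl); have [_ _ hab _ _] := rootP a.
  have [||c' ->] := @dagger_F (ra a) (rb a); [lia|lia|].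
  apply: IH; set M := spgen K n _ _.
  have AZ u : A (c' *: M) u = c' *: A M u.
    have A0 : A 0 u = 0.
      by have := gl_linl gl (-1) 0 0 u; rewrite scaler0 addr0 scaleN1r addNr.
    by have := gl_linl gl c' M 0 u; rewrite addr0 A0 addr0.
  have := words_stable spP hwP ((n + n).-1 - ra a) ((n + n).-1 - rb a) Wz.
  rewrite /phi /= (linear_op0 (sp_lin (rho_sp_ops mod) _ _)) => /(lspanZ c').
  by rewrite AZ; congr lspan; rewrite /glphi -/M; congr (_, _); rewrite scaler0.
have hy : lspan (fun g => exists w : seq (posroot n), g = act (glphi A) w t) y.
  apply: (lspan_img (f := snd : P -> U) (u := (0, y))) Wy => // g [w ->].
  by apply: lspan_mem; exists w; rewrite actP.
have : forall y', lspan (fun g => exists w : seq (posroot n), g = act (glphi A) w t) y' -> form y' y = 0.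
  move=> y'; elim=> [|c g u [w ->] _ IH].
    by have := form_linl gl (-1) 0 0 y; rewrite scaler0 addr0 mulN1r addNr.
  by rewrite (form_linl gl) IH addr0 orth // mulr0.
exact.
Qed.

(** The x in question form a submodule of V. If it were V, it would contain v; pairing the second
    component with t gives c = 0, so v would be a combination of nonempty words applied to v. *)
Lemma LW_fst x : LW (x, 0) -> x = 0.
Proof.
move=> Wx; case: irr => _ [_ hsub] _.
pose N : set V := [set y | LW (y, 0)]%classic.
have sN : is_submodule rho N.
  split.
  - exact: lspan_nil.
  - move=> c u1 u2 h1 h2; have := lspanD (lspanZ c h1) h2.
    by rewrite /N /= -[_ + _]/(c *: u1 + u2, c *: 0 + 0) scaler0 addr0.
  - move=> X u sX hu; have [z ez] := rho_expand mod u sX; rewrite /N /=.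
    have -> : (rho X u, 0) = 2^-1 *: \sum_i \sum_j z i j *: phi (pos i) (pos j) (u, 0) :> P.
      have -> : \sum_i \sum_j z i j *: phi (pos i) (pos j) (u, 0) =
          (\sum_i \sum_j z i j *: rphi rho (pos i) (pos j) u, 0) :> P.
        have pairsum (J : finType) (g : J -> P) : (forall j, (g j).2 = 0) ->
            \sum_j g j = (\sum_j (g j).1, 0).
          move=> g0; apply: injective_projections.
            by rewrite (big_morph fst (id1 := 0) (op1 := +%R)).
          by rewrite (big_morph snd (id1 := 0) (op1 := +%R)) // big1.
        have phi0 p q : (phi p q (u, 0)).2 = 0 by rewrite /= /glphi (linear_op0 (gl_lin gl _)).
        rewrite pairsum => [|i].
          congr (_, _); apply: eq_bigr => i _.
          by rewrite pairsum // => j; rewrite -[LHS]/(z i j *: (phi _ _ (u, 0)).2) phi0 scaler0.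
        by rewrite pairsum // => j; rewrite -[LHS]/(z i j *: (phi _ _ (u, 0)).2) phi0 scaler0.
      by rewrite ez; apply: injective_projections; rewrite /= ?scaler0.
    apply: lspanZ; apply: lspan_sum => i _; apply: lspan_sum => j _; apply: lspanZ.
    exact: (words_stable spP hwP).
have [N0|NT] := hsub N sN.
  by have : N x by []; rewrite N0.
have : N v by rewrite NT.
move=> /LW_split [c [x' [y' [ex ey hx hy]]]]; exfalso.
have c0 : c = 0.
  have := form_lower hy; have -> : y' = - c *: t.
    by apply/eqP; rewrite scaleNr -addr_eq0 addrC -ey.
  rewrite (formZr gl) => /eqP; rewrite mulf_eq0 conjC_eq0 oppr_eq0 => /orP[/eqP //|/eqP h].
  by case: (hm_neq0 hm); exact: (form_def gl).
have e1 : 1 *: v = x' by rewrite scale1r {1}ex c0 scale0r add0r.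
by rewrite -e1 in hx; have /eqP := v_lower hx; rewrite oner_eq0.
Qed.

Lemma model_transfer (J : Type) (s : seq J) (c : J -> K) (w : J -> seq (posroot n)) :
  (\sum_(j <- s) c j *: act (rphi rho) (w j) v = 0) <->
  (\sum_(j <- s) c j *: act (glphi A) (w j) t = 0).
Proof.
have h : LW (\sum_(j <- s) c j *: act (rphi rho) (w j) v,
             \sum_(j <- s) c j *: act (glphi A) (w j) t).
  elim: s => [|j s IH]; first by rewrite !big_nil; exact: lspan_nil.
  have hj : LW (act (rphi rho) (w j) v, act (glphi A) (w j) t).
    by apply: lspan_mem; exists (w j); rewrite actP.
  by rewrite !big_cons; exact: lspanD (lspanZ (c j) hj) IH.
by split=> e; move: h; rewrite e; [exact: LW_snd|exact: LW_fst].
Qed.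

Lemma words_full u : lspan (fun g => exists w : seq (posroot n), g = act (rphi rho) w v) u.
Proof.
case: irr => _ [_ hsub] _.
pose N : set V := lspan (fun g => exists w : seq (posroot n), g = act (rphi rho) w v).
have sN : is_submodule rho N.
  split; first exact: lspan_nil.
    by move=> c u1 u2 h1 h2; apply: lspanD => //; exact: lspanZ.
  move=> X u' sX hu; have [z ->] := rho_expand mod u' sX.
  apply: lspanZ; apply: lspan_sum => i _; apply: lspan_sum => j _; apply: lspanZ.
  exact: (words_stable (rho_sp_ops mod) hwV).
have [N0|NT] := hsub N sN; last by have : N u by rewrite NT.
have : N v by apply: lspan_mem; exists [::].
by rewrite N0 => /v0.
Qed.

(** The vanishing of root powers on v is a one-term linear relation, transferred from the model. *)
Lemma module_spanning (S : {ffun posroot n -> nat} -> Prop)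
    (f : {ffun posroot n -> nat} -> seq (posroot n)) :
  (forall s : {ffun posroot n -> nat}, chain_lattice m s -> S s) ->
  (forall s, S s -> forall a, count_mem a (f s) = s a) ->
  forall u, lspan (fun g => exists s, S s /\ g = act (rphi rho) (f s) v) u.
Proof.
move=> cS fS u; apply: lspan_trans (words_full u) => g [w ->].
apply: (spanning (rho_sp_ops mod) hwV _ cS fS) => a j N er hN.
have [_ h] := model_transfer [:: tt] (fun=> 1) (fun=> nseq N a).
by move: h; rewrite !big_seq1 !scale1r; apply; exact: (hm_nil hm er).
Qed.

End Transfer.

Lemma seq_minimal (T : eqType) (r : rel T) (s : seq T) : irreflexive r -> transitive r ->
  s != [::] -> exists2 x, x \in s & forall y, y \in s -> ~~ r y x.
Proof.
move=> irr tr; elim: s => // a [|b s] IH _.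
  by exists a; rewrite ?mem_head // => y; rewrite inE => /eqP ->; rewrite irr.
have [//|x xs hx] := IH; have [ax|ax] := boolP (r a x); last first.
  exists x; first by rewrite inE xs orbT.
  by move=> y; rewrite inE => /orP[/eqP ->|/hx].
exists a; first exact: mem_head.
move=> y; rewrite inE => /orP[/eqP ->|ys]; first by rewrite irr.
by apply: contra (hx _ ys) => ya; exact: tr ax.
Qed.

(** * Linear independence in the model *)

Section Independence.
Variables (K : numClosedFieldType) (n : nat) (m : 'I_n -> nat).
Variables (U : lmodType K) (A : 'M[K]_(n + n) -> U -> U) (t : U).
Hypothesis hm : hw_model m A t.

Lemma sum_count_size (w : seq (posroot n)) (s : posroot n -> nat) :
  (forall a, count_mem a w = s a) -> size w = (\sum_a s a)%N.
Proof.
move=> cw; rewrite -sum1_size (sum_count_mem (fun=> 1%N)).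
by apply: eq_bigr => r _; rewrite muln1 cw.
Qed.

(** Among the s with nonzero coefficient take one of largest degree and, in this degree, minimal for
    [key2]; the functional that extracts it kills all other terms. *)
Lemma model_independent (r : seq {ffun posroot n -> nat})
    (w : {ffun posroot n -> nat} -> seq (posroot n)) (c : {ffun posroot n -> nat} -> K) :
  uniq r -> (forall s, s \in r -> chain_lattice m s /\ forall a, count_mem a (w s) = s a) ->
  \sum_(s <- r) c s *: act (glphi A) (w s) t = 0 -> forall s, s \in r -> c s = 0.
Proof.
move=> ur hr e0 s1 s1r; apply/eqP; apply: contraT => c1.
pose deg (s : {ffun posroot n -> nat}) := (\sum_a s a)%N.
pose before (s s' : {ffun posroot n -> nat}) :=
  (deg s' < deg s)%N || (deg s == deg s') && lexlt (@key2 n) s s'.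
have b_irr : irreflexive before by move=> s; rewrite /before ltnn lexlt_irr andbF.
have b_tr : transitive before.
  move=> y x z /orP[h1|/andP[/eqP h1 l1]] /orP[h2|/andP[/eqP h2 l2]]; rewrite /before.
  - by rewrite (ltn_trans h2 h1).
  - by rewrite -h2 h1.
  - by rewrite h1 h2.
  - by rewrite h1 h2 eqxx (lexlt_trans (@key2_inj n) l1 l2) orbT.
have nz : [seq s <- r | c s != 0] != [::].
  apply/negP => /eqP e; have : s1 \in [seq s <- r | c s != 0] by rewrite mem_filter c1.
  by rewrite e.
have [s0 s0r hmin] := seq_minimal b_irr b_tr nz.
move: s0r; rewrite mem_filter => /andP[cs0 s0r].
have [cl0 cw0] := hr _ s0r.
have [ph [ph_lin ph_small ph_lead [k k0 ph_val]]] := hm_extract hm cl0.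
have ph0 : ph 0 = 0 by have := ph_lin (-1) 0 0; rewrite scaler0 addr0 mulN1r addNr.
have : ph (\sum_(s <- r) c s *: act (glphi A) (w s) t) = c s0 * k.
  rewrite (big_morph ph (id1 := 0) (op1 := +%R)) => [|x y|//]; last first.
    by have := ph_lin 1 x y; rewrite scale1r mul1r.
  have phZ d u : ph (d *: u) = d * ph u by have := ph_lin d u 0; rewrite addr0 ph0 addr0.
  rewrite (bigD1_seq s0) //= phZ ph_val // big_seq_cond big1 ?addr0 // => s /andP[sr ss0].
  rewrite phZ; have [->|cs] := eqVneq (c s) 0; first by rewrite mul0r.
  have [_ cw] := hr _ sr.
  have /hmin : s \in [seq s <- r | c s != 0] by rewrite mem_filter cs.
  rewrite /before negb_or -leqNgt => /andP[]; rewrite leq_eqVlt => /orP[/eqP es|lt _]; last first.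
    by rewrite ph_small ?mulr0 // (sum_count_size cw).
  rewrite es eqxx /= => nl; have [->|h] := eqVneq (ph (act (glphi A) (w s) t)) 0; first by rewrite mulr0.
  have [|e|l] := ph_lead (w s) _ h; first by rewrite (sum_count_size cw).
    by case/eqP: ss0; apply/ffunP => a; rewrite -e cw.
  by rewrite -(eq_lexlt _ cw (frefl _)) l in nl.
by rewrite e0 ph0 => /esym/eqP; rewrite mulf_eq0 (negPf cs0) (negPf k0).
Qed.

End Independence.

(** * Finite bases and dimensions *)

Section Bases.
Local Open Scope classical_set_scope.
Variables (F : fieldType) (V : lmodType F).

Lemma lspan_fset (I : choiceType) (S : set I) (b : I -> V) u :
  lspan (fun g => exists s, S s /\ g = b s) u ->
  exists (t : {fset I}) (c : I -> F), [set` t] `<=` S /\ u = \sum_(i <- t) c i *: b i.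
Proof.
elim=> [|c0 g u' [s [Ss ->]] _ [t [c [tS ->]]]].
  by exists fset0, (fun=> 0); split=> [x //|]; rewrite big_seq_fset0.
(* The generator s may already lie in t, and c is arbitrary outside t; the indicators cover both
   cases. *)
exists (s |` t)%fset, (fun i => (i \in t)%:R * c i + (i == s)%:R * c0); split.
  by move=> x /=; rewrite in_fset1U => /orP[/eqP -> //|/tS].
have e0 : \sum_(i <- t) c i *: b i = \sum_(i <- (s |` t)%fset) ((i \in t)%:R * c i) *: b i.
  have [st|st] := boolP (s \in t).
    by rewrite (mem_fset1U st) big_seq [RHS]big_seq; apply: eq_bigr => i ->; rewrite mul1r.
  rewrite big_fsetU1 //= (negPf st) mul0r scale0r add0r.
  by rewrite big_seq [RHS]big_seq; apply: eq_bigr => i ->; rewrite mul1r.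
under [RHS]eq_bigr do rewrite scalerDl.
rewrite big_split /= -e0 addrC; congr (_ + _).
rewrite (bigD1_seq s) ?fset1U1 ?fset_uniq //= eqxx mul1r big1 ?addr0 // => i /negPf ->.
by rewrite mul0r scale0r.
Qed.

Lemma basis_has_dim (U : set V) (I : choiceType) (S : set I) (b : I -> V) :
  finite_set S -> is_basis U S b -> has_dim U #|` fset_set S|.
Proof.
move=> fS [bU bI bG]; set A := fset_set S.
have AS i : i \in A -> S i by rewrite in_fset_set // inE.
have SA i : S i -> i \in A by rewrite in_fset_set // inE.
pose e (k : 'I_(#|` A|)) := tnth (in_tuple (enum_fset A)) k.
have eA k : e k \in A by exact: mem_tnth.
pose ix i : option 'I_(#|` A|) := insub (index i (enum_fset A)).
have ixe k : ix (e k) = Some k.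
  rewrite /ix /e (tnth_nth (e k)) /= index_uniq ?fset_uniq //.
  exact: valK.
have e_inj : injective e by move=> k k' ek; have := ixe k; rewrite ek ixe => -[].
exists (fun k => b (e k)); split=> [k _|t c _ e0 k kt|u Uu].
- by apply/bU/AS.
- pose c' i := if ix i is Some k then c k else 0.
  have -> : c k = c' (e k) by rewrite /c' ixe.
  apply: (bI [fset e k' | k' in t]%fset c') => [i /=||]; last by apply/imfsetP; exists k.
    by case/imfsetP=> k' _ ->; apply: AS.
  rewrite big_imfset => [|k1 k2 _ _ /e_inj //] /=.
  by rewrite -[RHS]e0; apply: eq_bigr => k' _; rewrite /c' ixe.
- have [t [c [tS ->]]] := bG u Uu.
  exists [fset k in index_enum 'I_(#|` A|)]%fset, (fun k => (e k \in t)%:R * c (e k)); split=> //.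
  have pA : perm_eq (enum_fset [fset k in index_enum 'I_(#|` A|)]%fset) (index_enum 'I_(#|` A|)).
    apply: uniq_perm; rewrite ?fset_uniq ?index_enum_uniq // => k.
    by rewrite mem_index_enum !inE mem_index_enum.
  rewrite (perm_big _ pA) /=.
  rewrite -(big_tnth _ _ (enum_fset A) xpredT (fun i => ((i \in t)%:R * c i) *: b i)).
  have pt : perm_eq (enum_fset t) [seq i <- enum_fset A | i \in t].
    apply: uniq_perm; rewrite ?filter_uniq ?fset_uniq // => i.
    by rewrite mem_filter; case it : (i \in t) => //=; rewrite SA //; exact: tS.
  rewrite (perm_big _ pt) /= big_filter big_mkcond; apply: eq_bigr => i _.
  by case: ifP => _; rewrite ?mul1r ?mul0r ?scale0r.
Qed.

End Bases.

Section Main.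
Local Open Scope classical_set_scope.

(** A chain with one root already bounds each coordinate by the sum of all m_l. *)
Lemma finite_lattice_points (R : realType) n (m : 'I_n -> nat) :
  finite_set (lattice_points R m).
Proof.
set B := msum m 0 n.
pose h (g : {ffun posroot n -> 'I_B.+1}) : {ffun posroot n -> nat} := [ffun a => g a : nat].
apply: (@sub_finite_set _ _ (h @` [set: _])); last exact/finite_image/finite_finset.
move=> s /lattice_pointsE cl; exists [ffun a => inord (s a)] => //.
apply/ffunP => a; rewrite !ffunE inordK // ltnS.
have := cl a [::] 0 n isT (leq0n _); rewrite leqnSn orbT => /(_ isT).
by rewrite big_seq1.
Qed.

End Main.

Local Open Scope classical_set_scope.

(** * Weight spaces and the character *)

Section WeightSpaces.
Variables (K : numClosedFieldType) (n : nat) (V : lmodType K).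
Variable rho : 'M[K]_(n + n) -> V -> V.
Hypothesis mod : is_sp_module rho.
Variables (f : posroot n -> 'M[K]_(n + n)) (lam : 'rV[K]_n) (v : V).
Hypothesis v_wt : weight_space rho lam v.
Hypothesis f_root : forall a, in_root_space (- root_weight K a) (f a).

Lemma monomial_weight w :
  weight_space rho (lam - \sum_(a <- w) root_weight K a) (monomial_act rho f w v).
Proof.
elim: w => [|a w IH] x /=; first by rewrite big_nil subr0; exact: v_wt.
have [sf wf] := f_root a; have cx := cartan_in_sp x.
case: mod => _ _ br; have := br _ _ cx sf (monomial_act rho f w v).
rewrite wf (rhoZ mod) // IH (linear_opZ (rho_lin mod sf)).
move/esym/eqP; rewrite subr_eq => /eqP ->; rewrite -scalerDl; congr (_ *: _).
rewrite -wevalD big_cons; congr weval.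
by rewrite opprD addrC addrAC addrA.
Qed.

(** Applying a Cartan element minus its value under mu to the expansion of a vector of weight mu
    gives a relation among basis vectors, so coefficients at other weights vanish. *)
Lemma weight_space_basis (S : set {ffun posroot n -> nat})
    (b : {ffun posroot n -> nat} -> V) (wt_of : {ffun posroot n -> nat} -> 'rV[K]_n) mu :
  (forall s, S s -> weight_space rho (wt_of s) (b s)) -> is_basis [set: V] S b ->
  is_basis (weight_space rho mu) [set s | S s /\ wt_of s = mu] b.
Proof.
move=> bw [_ bI bG]; split.
- by move=> s [Ss <-]; exact: bw.
- by move=> t c tS; apply: bI => s /tS [].
- move=> u uw; have [t [c [tS ue]]] := bG u I.
  have c0 i : i \in t -> wt_of i <> mu -> c i = 0.
    move=> it nw; apply/eqP; apply: contraT => ci; case: nw; apply: weval_inj => x.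
    have lc := rho_lin mod (cartan_in_sp x).
    have : \sum_(j <- t) (c j * (weval (wt_of j) x - weval mu x)) *: b j = 0.
      have := uw x; rewrite ue (linear_op_sum lc) scaler_sumr => /eqP.
      rewrite -subr_eq0 -sumrB => /eqP h; rewrite -[RHS]h.
      rewrite [LHS]big_seq [RHS]big_seq; apply: eq_bigr => j jt.
      rewrite (linear_opZ lc) (bw j (tS _ jt)) !scalerA -scalerBl mulrBr.
      by rewrite [_ * c j]mulrC.
    move/(bI t _ tS)/(_ i it)/eqP; rewrite mulf_eq0 (negPf ci) subr_eq0.
    by move/eqP.
  exists [fset i in t | wt_of i == mu]%fset, c; split.
    by move=> i /=; rewrite !inE => /andP[/tS ? /eqP].
  have pt : perm_eq (enum_fset [fset i in t | wt_of i == mu]%fset)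
      [seq i <- enum_fset t | wt_of i == mu].
    apply: uniq_perm; rewrite ?filter_uniq ?fset_uniq // => i.
    by rewrite mem_filter !inE andbC.
  rewrite ue (perm_big _ pt) /= big_filter [RHS]big_mkcond [LHS]big_seq [RHS]big_seq.
  apply: eq_bigr => i it.
  by case: eqP => // /(c0 i it) ->; rewrite scale0r.
Qed.

End WeightSpaces.

Theorem corollary0p1 (R : realType) (n : nat) (n_gt0 : (0 < n)%N)
    (m : 'I_n -> nat)
    (V : lmodType (complex R)) (rho : 'M[complex R]_(n + n) -> V -> V) (v : V)
    (f : posroot n -> 'M[complex R]_(n + n))
    (w : {ffun posroot n -> nat} -> seq (posroot n)) :
  let lambda : 'rV[complex R]_n := dominant_weight (complex R) m in
  let S : set {ffun posroot n -> nat} := lattice_points R m in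
  is_irreducible_highest_weight rho lambda v ->
  (forall a, f a <> 0 /\ in_root_space (- root_weight (complex R) a) (f a)) ->
  (forall s, S s -> forall a, count_mem a (w s) = s a) ->
  [/\ is_basis [set: V] S (fun s => monomial_act rho f (w s) v),
      finite_set S /\ has_dim [set: V] #|` fset_set S|
    & is_character rho (\sum_(s \in S) formal_exp (lambda - wt (complex R) s))].
Proof.
move=> lambda S irr hf hw.
have [U [A [form [t [gl hm]]]]] := hw_model_exists (complex R) m.
have [mod _ [v0 v_wt v_top]] := irr.
have /choice [k hk] : forall a, exists c, c != 0 /\ f a = c *: spgen (complex R) n (ra a) (rb a).
  move=> a; have [fa0 fa] := hf a; have [c ec] := root_space_F fa.
  exists c; split=> //; apply/eqP => c0; apply: fa0.
  by rewrite ec c0 scale0r.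
have monoE l : monomial_act rho f l v = (\prod_(a <- l) k a) *: act (rphi rho) l v.
  elim: l => [|a l IH]; first by rewrite big_nil scale1r.
  have sF := F_in_sp (complex R) n (ra a) (rb a).
  rewrite /= IH (proj2 (hk a)) (rhoZ mod) // (linear_opZ (rho_lin mod sF)) scalerA big_cons.
  by [].
have k0 l : \prod_(a <- l) k a != 0.
  by rewrite prodf_seq_neq0; apply/allP => a _; rewrite (proj1 (hk a)).
have fS : finite_set S by exact: finite_lattice_points.
have bas : is_basis [set: V] S (fun s => monomial_act rho f (w s) v).
  split=> // [r c rS|u _].
    under eq_bigr do rewrite monoE scalerA.
    move/(model_transfer irr gl hm r _ w) => e i ir.
    have := model_independent hm (fset_uniq r) _ e ir.
    have hr s : s \in enum_fset r -> chain_lattice m s /\ forall a, count_mem a (w s) = s a.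
      by move=> /rS Ss; split; [exact/(lattice_pointsE R)|exact: hw].
    by move=> /(_ hr) /eqP; rewrite mulf_eq0 (negPf (k0 _)) orbF => /eqP.
  apply: lspan_fset.
  have hS (s : {ffun posroot n -> nat}) : chain_lattice m s -> S s.
    by move=> cl; apply/lattice_pointsE.
  apply: lspan_trans (module_spanning irr gl hm hS hw u) => g [s [Ss ->]].
  rewrite -[act _ _ _](scalerK (k0 (w s))); apply: lspanZ.
  by apply: lspan_mem; exists s; rewrite monoE.
split=> //; first by split=> //; exact: basis_has_dim bas.
have f_root a : in_root_space (- root_weight (complex R) a) (f a) by case: (hf a).
have wtE s : S s -> \sum_(a <- w s) root_weight (complex R) a = wt (complex R) s.
  move=> Ss; transitivity (\sum_a root_weight (complex R) a *+ count_mem a (w s)); last first.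
    by apply: eq_bigr => a _; rewrite hw.
  elim: (w s) => [|a l IH]; first by rewrite big_nil big1.
  rewrite big_cons IH (bigD1 a) //= [RHS](bigD1 a) //= eqxx add1n mulrS addrA.
  by congr (_ + _); apply: eq_bigr => b ba; rewrite eq_sym (negPf ba).
move=> mu; pose Smu := [set s | S s /\ lambda - wt (complex R) s = mu].
exists #|` fset_set Smu|; split.
  apply: basis_has_dim; first by apply: sub_finite_set fS => s [].
  apply: (weight_space_basis mod) bas => s Ss.
  by rewrite -(wtE s Ss); exact: (monomial_weight mod v_wt f_root).
(* The coefficient at mu counts the lattice points of weight lambda - mu, which index the basis of
   the weight space. *)
rewrite fsbig_finite //= raddf_sum /=.
have pS : perm_eq (enum_fset (fset_set Smu))
    [seq s <- enum_fset (fset_set S) | lambda - wt (complex R) s == mu].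
  apply: uniq_perm; rewrite ?filter_uniq ?fset_uniq // => s.
  have fSmu : finite_set Smu by apply: sub_finite_set fS => s' [].
  rewrite mem_filter !in_fset_set //; apply/idP/andP.
    by rewrite inE => -[Ss <-]; rewrite eqxx inE.
  by rewrite !inE => -[/eqP e Ss].
rewrite (perm_size pS) size_filter -sum1_count -natz natr_sum [RHS]big_mkcond /=.
apply: eq_bigr => s _; rewrite /formal_exp mcoeffU.
by case: eqP.
Qed.
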